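(* Let $\Gamma$ be a countable discrete group and $(X,\mu)$ a standard probability space. The extreme points of $\mathrm{A}_{\sim_s}(\Gamma,X,\mu)$ are precisely those stable weak equivalence classes which contain an ergodic action; that is, for $a\in\mathrm{A}(\Gamma,X,\mu)$, the class $[a]_s$ is an extreme point of $\mathrm{A}_{\sim_s}(\Gamma,X,\mu)$ if and only if $a$ is stably weakly equivalent to an ergodic measure-preserving action of $\Gamma$ on some (possibly atomic) probability space.
   Context: A probability space is a standard Borel space with a Borel probability measure (atoms allowed, possibly countable or finite); it is a standard probability space if the measure is nonatomic. A measure-preserving action $\Gamma\curvearrowright^a(Y,\nu)$ is a Borel action preserving $\nu$, two actions being identified if they agree almost everywhere; $\gamma^a$ denotes the transformation given by $\gamma\in\Gamma$. $\mathrm{A}(\Gamma,X,\mu)$ is the set of measure-preserving actions of $\Gamma$ on $(X,\mu)$. Sums: if $a_i$ ($1\le i\le m$) are measure-preserving actions on $(Y_i,\nu_i)$ and $\alpha_i\ge0$, $\sum\alpha_i=1$, then $\sum_i\alpha_ia_i$ is the action on $\bigsqcup_iY_i$ with the measure $A\mapsto\sum_i\alpha_i\nu_i(A\cap Y_i)$ which acts as $a_i$ on $Y_i$. Stable weak containment: for actions $a$ on $(Y_1,\nu_1)$ and $b$ on $(Y_2,\nu_2)$ (arbitrary probability spaces), $a\prec_sb$ if for all measurable $A_1,\dots,A_k\subseteq Y_1$, finite $F\subseteq\Gamma$ and $\epsilon>0$ there are $m\geq 1$, positive reals $\alpha_1,\dots,\alpha_m$ with $\sum\alpha_i=1$, and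 measurable subsets $B_1,\dots,B_k$ of the underlying space of the action $c=\sum_{l=1}^m\alpha_lb$ (on $m$ disjoint copies of $Y_2$, with measure $\nu'=\sum_l\alpha_l\nu_2$) such that $|\nu_1(\gamma^aA_i\cap A_j)-\nu'(\gamma^{c}B_i\cap B_j)|<\epsilon$ for all $\gamma\in F$, $i,j\le k$. $a\sim_sb$ (stable weak equivalence) means $a\prec_sb$ and $b\prec_sa$. $\mathrm{A}_{\sim_s}(\Gamma,X,\mu)$ is the quotient of $\mathrm{A}(\Gamma,X,\mu)$ by $\sim_s$, and $[a]_s$ is the class of $a$. Convex structure: $t[a]_s+(1-t)[b]_s$ is the stable weak equivalence class of $ta+(1-t)b$ (transported to $(X,\mu)$ by any isomorphism of probability spaces); this is well defined. A point $x\in\mathrm{A}_{\sim_s}(\Gamma,X,\mu)$ is an extreme point if $x=ty+(1-t)z$ with $0<t<1$ and $y,z\in\mathrm{A}_{\sim_s}(\Gamma,X,\mu)$ implies $y=z=x$. *)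

(* Defs.v *)
From HB Require Import structures.
From mathcomp Require Import all_boot all_order all_algebra.
From mathcomp Require Import all_classical all_reals all_analysis.

Set Implicit Arguments.
Unset Strict Implicit.
Unset Printing Implicit Defensive.
Import Order.TTheory GRing.Theory Num.Theory.

Local Open Scope classical_set_scope.
Local Open Scope ring_scope.

Section probability_spaces.
Context (R : realType) (d : measure_display).

(* [completePseudoMetricType] + [hausdorff_space] is complete metrizability
   (the uniformity has a countable base and is separated and complete). *)
Definition standard_borel (Y : measurableType d) : Prop :=
  exists (P : completePseudoMetricType R) (f : Y -> P),
    [/\ hausdorff_space P,
        exists2 D : set P, countable D & dense D,
        bijective f
      & forall A : set Y, measurable A <-> <<s open >> (f @` A)].

Definition nonatomic (Y : measurableType d) (nu : probability Y R) : Prop :=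
  forall A, measurable A -> (0 < nu A)%E ->
    exists B, [/\ measurable B, B `<=` A, (0 < nu B)%E & (nu B < nu A)%E].

Definition standard_probability_space
    (Y : measurableType d) (nu : probability Y R) : Prop :=
  standard_borel Y /\ nonatomic nu.

End probability_spaces.

Definition measure_preserving (R : realType) (d1 d2 : measure_display)
    (Y1 : measurableType d1) (Y2 : measurableType d2)
    (nu1 : probability Y1 R) (nu2 : probability Y2 R) (f : Y1 -> Y2) : Prop :=
  measurable_fun [set: Y1] f /\
  forall A, measurable A -> nu1 (f @^-1` A) = nu2 A.

(* The acting group is always countable in use, so that a Borel action is an
   action by Borel maps. *)
Record mpaction (G : groupType) (R : realType) (d : measure_display)
    (Y : measurableType d) (nu : probability Y R) := MPAction {
  mpact :> G -> Y -> Y ;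
  mpact1 : forall y, mpact 1%g y = y ;
  mpactM : forall g h y, mpact (g * h)%g y = mpact g (mpact h y) ;
  mpact_mp : forall g, measure_preserving nu nu (mpact g) }.

Definition ergodic (G : groupType) (R : realType) (d : measure_display)
    (Y : measurableType d) (nu : probability Y R) (a : mpaction G nu) : Prop :=
  forall A, measurable A -> (forall g, a g @` A = A) ->
    nu A = 0%E \/ nu A = 1%E.

Section disjoint_union.
Context (n : nat) (d : measure_display) (Y : 'I_n.+1 -> measurableType d).

Definition dunion : Type := {i : 'I_n.+1 & Y i}.

HB.instance Definition _ := Choice.on dunion.
HB.instance Definition _ :=
  isPointed.Build dunion (existT (fun i => Y i) ord0 point).

Definition dunion_measurable : set (set dunion) :=
  [set A | forall i, measurable (existT (fun i => Y i) i @^-1` A)].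

Let dunion_measurable0 : dunion_measurable set0.
Proof. by move=> i; rewrite preimage_set0; exact: measurable0. Qed.

Let dunion_measurableC A : dunion_measurable A -> dunion_measurable (~` A).
Proof. by move=> mA i; rewrite preimage_setC; exact/measurableC/mA. Qed.

Let dunion_measurable_bigcup (F : (set dunion)^nat) :
  (forall k, dunion_measurable (F k)) -> dunion_measurable (\bigcup_k F k).
Proof.
move=> mF i; rewrite preimage_bigcup.
by apply: bigcupT_measurable => k; exact: mF.
Qed.

Definition dunion_display : measure_display -> measure_display.
Proof. exact. Qed.

HB.instance Definition _ := @isMeasurable.Build (dunion_display d) dunion
  dunion_measurable dunion_measurable0 dunion_measurableC
  dunion_measurable_bigcup.

Lemma measurable_dunionP (A : set dunion) :
  measurable A <-> forall i, measurable (existT (fun i => Y i) i @^-1` A).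
Proof. by []. Qed.

End disjoint_union.

Record weights (R : realType) (n : nat) := Weights {
  weight :> 'I_n.+1 -> R ;
  weight_ge0 : forall i, 0 <= weight i ;
  weight_sum1 : \sum_i weight i = 1 }.

Section sum_of_actions.
Context (G : groupType) (R : realType) (n : nat) (d : measure_display).
Context (Y : 'I_n.+1 -> measurableType d) (nu : forall i, probability (Y i) R).
Context (w : weights R n).

Definition dunion_measure (A : set (dunion Y)) : \bar R :=
  (\sum_i (w i)%:E * nu i (existT (fun i => Y i) i @^-1` A))%E.

Let dunion_measure0 : dunion_measure set0 = 0%E.
Proof.
by rewrite /dunion_measure big1// => i _; rewrite preimage_set0 measure0 mule0.
Qed.

Let dunion_measure_ge0 A : (0 <= dunion_measure A)%E.
Proof.
by apply: sume_ge0 => i _; rewrite mule_ge0// lee_fin weight_ge0.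
Qed.

Let dunion_measure_sigma_additive : semi_sigma_additive dunion_measure.
Proof.
move=> F mF tF mUF; rewrite [X in _ --> X](_ : _ =
    lim ((fun k => \sum_(0 <= i < k) dunion_measure (F i))%E @ \oo)).
  by apply: is_cvg_ereal_nneg_natsum => k _; exact: dunion_measure_ge0.
rewrite nneseries_sum//; last first.
  by move=> i k _; rewrite mule_ge0// lee_fin weight_ge0.
apply: eq_bigr => /= i _; rewrite nneseriesZl; last by move=> k _.
rewrite preimage_bigcup measure_semi_bigcup//.
- by move=> k; exact: mF.
- apply/trivIsetP => /= k l _ _ kl; rewrite -preimage_setI.
  by move/trivIsetP : tF => /(_ _ _ _ _ kl) ->//; rewrite preimage_set0.
- by rewrite -preimage_bigcup; exact: mUF.
Qed.

HB.instance Definition _ := isMeasure.Build _ _ _ dunion_measure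
  dunion_measure0 dunion_measure_ge0 dunion_measure_sigma_additive.

Let dunion_measure_setT : dunion_measure [set: dunion Y] = 1%E.
Proof.
rewrite /dunion_measure -(weight_sum1 w) -sumEFin; apply: eq_bigr => i _.
by rewrite preimage_setT probability_setT mule1.
Qed.

HB.instance Definition _ :=
  Measure_isProbability.Build _ _ _ dunion_measure dunion_measure_setT.

Context (a : forall i, mpaction G (nu i)).

Definition sum_act (g : G) (y : dunion Y) : dunion Y :=
  existT (fun i => Y i) (projT1 y) (a (projT1 y) g (projT2 y)).

Let sum_act1 y : sum_act 1%g y = y.
Proof. by case: y => i y; rewrite /sum_act/= mpact1. Qed.

Let sum_actM g h y : sum_act (g * h)%g y = sum_act g (sum_act h y).
Proof. by case: y => i y; rewrite /sum_act/= mpactM. Qed.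

Let sum_act_mp g :
  measure_preserving dunion_measure dunion_measure (sum_act g).
Proof.
split=> [_ A mA|A mA].
  rewrite setTI; apply/measurable_dunionP => i.
  rewrite -[X in measurable X]setTI.
  exact: ((mpact_mp (a i) g).1 measurableT _ (mA i)).
apply: eq_bigr => i _; congr *%E.
by rewrite -((mpact_mp (a i) g).2 _ (mA i)).
Qed.

Definition sum_action : mpaction G dunion_measure :=
  MPAction sum_act1 sum_actM sum_act_mp.

End sum_of_actions.

Section stable_weak_containment.
Context (G : groupType) (R : realType) (d1 d2 : measure_display).
Context (Y1 : measurableType d1) (nu1 : probability Y1 R).
Context (Y2 : measurableType d2) (nu2 : probability Y2 R).

(* The number m of copies is n.+1. *)
Definition stable_weak_contained
    (a : mpaction G nu1) (b : mpaction G nu2) : Prop :=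
  forall (k : nat) (A : 'I_k -> set Y1) (F : set G) (eps : R),
    (forall i, measurable (A i)) -> finite_set F -> 0 < eps ->
    exists (n : nat) (w : weights R n)
           (B : 'I_k -> set (dunion (fun _ : 'I_n.+1 => Y2))),
      let nu' := dunion_measure (fun _ => nu2) w in
      let c := sum_action w (fun _ => b) in
      [/\ forall l, 0 < w l,
          forall i, measurable (B i)
        & forall g i j, F g ->
            `| fine (nu1 (a g @` A i `&` A j))
               - fine (nu' (c g @` B i `&` B j)) | < eps].

End stable_weak_containment.

Definition stable_weak_equiv (G : groupType) (R : realType)
    (d1 d2 : measure_display)
    (Y1 : measurableType d1) (nu1 : probability Y1 R)
    (Y2 : measurableType d2) (nu2 : probability Y2 R)
    (a : mpaction G nu1) (b : mpaction G nu2) : Prop :=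
  stable_weak_contained a b /\ stable_weak_contained b a.

(* [transport a b]: b is a transported by an isomorphism phi of probability
   spaces, i.e. a bijection modulo null sets, with inverse psi. *)
Definition transport (G : groupType) (R : realType) (d1 d2 : measure_display)
    (Y1 : measurableType d1) (nu1 : probability Y1 R)
    (Y2 : measurableType d2) (nu2 : probability Y2 R)
    (a : mpaction G nu1) (b : mpaction G nu2) : Prop :=
  exists (phi : Y1 -> Y2) (psi : Y2 -> Y1),
    [/\ measure_preserving nu1 nu2 phi,
        measure_preserving nu2 nu1 psi,
        {ae nu1, forall y, psi (phi y) = y},
        {ae nu2, forall y, phi (psi y) = y}
      & forall g, {ae nu1, forall y, phi (a g y) = b g (phi y)}].

Section pair_weights.
Context (R : realType) (t : {i01 R}).

Definition pair_weight (i : 'I_2) : R :=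
  if i == ord0 then t%:num else 1 - t%:num.

Let pair_weight_ge0 i : 0 <= pair_weight i.
Proof. by rewrite /pair_weight; case: ifP => // _; rewrite subr_ge0. Qed.

Let pair_weight_sum1 : \sum_i pair_weight i = 1.
Proof. by rewrite big_ord_recl big_ord1 /pair_weight/= addrC subrK. Qed.

Definition pair_weights : weights R 1 :=
  Weights pair_weight_ge0 pair_weight_sum1.

End pair_weights.

Section convex_structure.
Context (G : groupType) (R : realType) (d : measure_display).
Context (X : measurableType d) (mu : probability X R).

(* t a + (1 - t) b, an action on two disjoint copies of X *)
Definition conv_action (t : {i01 R}) (a b : mpaction G mu) :=
  sum_action (pair_weights t) (fun i : 'I_2 => if i == ord0 then a else b).

Definition stable_class (a : mpaction G mu) : set (mpaction G mu) :=
  [set b | stable_weak_equiv a b].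

(* The quotient by stable weak equivalence is the set of classes. Actions that
   agree almost everywhere lie in the same class, so they need not be
   identified beforehand. *)
Definition stable_classes : set (set (mpaction G mu)) := range stable_class.

(* The class of (any transport to X of) t a + (1 - t) b, where a and b are
   representatives of y and z. *)
Definition conv_class (t : {i01 R}) (y z : set (mpaction G mu)) :
    set (mpaction G mu) :=
  [set c' | exists a b c : mpaction G mu,
    [/\ y a, z b, transport (conv_action t a b) c & stable_class c c']].

Definition extreme_point (x : set (mpaction G mu)) : Prop :=
  stable_classes x /\
  forall (t : {i01 R}) (y z : set (mpaction G mu)),
    0 < t%:num < 1 -> stable_classes y -> stable_classes z ->
    x = conv_class t y z -> y = x /\ z = x.

End convex_structure.

(* Main.v *)
Require Import Defs.
From HB Require Import structures.
From mathcomp Require Import all_boot all_order all_algebra.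
From mathcomp Require Import all_classical all_reals all_analysis.
From mathcomp Require Import measurable_realfun.
From mathcomp Require Import ring lra.

Set Implicit Arguments.
Unset Strict Implicit.
Unset Printing Implicit Defensive.
Import Order.TTheory GRing.Theory Num.Theory.
Import numFieldNormedType.Exports.

Local Open Scope classical_set_scope.
Local Open Scope ring_scope.

(** A correlation of an action a is the measure of g A & B, for an element g of
    the group and measurable sets A and B. Stable weak containment compares the
    correlations of k-tuples of sets up to convex combinations; so, by
    finite-dimensional separation, the class of a is determined by its support
    function [supp a], which sends a finite linear combination of correlations
    to its supremum over all tuples of sets ([swe_suppP]). The support function
    of [t a + (1 - t) b] is the corresponding average ([supp_conv]).

    If e is ergodic and stably weakly contained in a sum of actions, it is
    stably weakly contained in each summand of positive weight
    ([ergodic_supp_le]). By the mean ergodic theorem some average of the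
    translates of any given set D is nearly constant; that an average is nearly
    constant is expressed by correlations, so it is inherited by the sets which
    imitate D in the sum, and these must then have the same measure in every
    summand. So if the class of e is the class of [t b + (1 - t) c], the support
    function of e is both below those of b and c and equal to their average; the
    three are equal, and the class is extreme ([extreme_of_ergodic]).

    Conversely, let the class of a be extreme. All standard probability spaces
    are isomorphic ([standard_isomorphic]), so that a may be taken on the line,
    with an invariant measure m, and so that the conditional actions on an
    invariant set and on its complement have copies on X, of which a is a convex
    combination. As the class is extreme, every conditional action of a on an
    invariant set of positive measure has the support function of a
    ([extreme_conditional]).

    This lets a single ergodic component be found in the class, with no
    decomposition of the action into its components ([ergodic_component]). Let
    [fh B] be the limit in the mean ergodic theorem for the indicator function
    of B, that is, its conditional expectation on the invariant sets. For almost
    every x the numbers [fh B x] are the values of a probability measure [Nu x]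
    ([disintegration]), which is invariant. It is ergodic, because averages of
    translates of rational sets are nearly constant for [Nu x]
    ([conditional_dispersion]). Its correlations are at most the support
    function of a, and approach it: at almost every x, since otherwise these
    inequalities would fail throughout an invariant set of positive measure, and
    hence for the conditional action on it. Countably many such conditions
    suffice, and any x which satisfies them all provides the action. *)

(** * Real-valued probabilities and expectations of bounded functions *)

Section real_probability.
Context (R : realType) (d : measure_display).
Context (Y : measurableType d) (nu : probability Y R).
Implicit Types (A B : set Y) (f g : Y -> R).

Definition pr A : R := fine (nu A).

Lemma prE A : measurable A -> nu A = (pr A)%:E.
Proof. by move=> mA; rewrite /pr fineK// fin_num_measure. Qed.

Lemma pr_ge0 A : 0 <= pr A.
Proof. by rewrite /pr fine_ge0. Qed.

Lemma pr_setT : pr setT = 1.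
Proof. by rewrite /pr probability_setT. Qed.

Lemma pr_set0 : pr set0 = 0.
Proof. by rewrite /pr measure0. Qed.

Lemma le_pr A B : measurable A -> measurable B -> A `<=` B -> pr A <= pr B.
Proof.
move=> mA mB AB; rewrite /pr fine_le ?fin_num_measure//.
by rewrite le_measure ?inE.
Qed.

Lemma pr_le1 A : measurable A -> pr A <= 1.
Proof. by move=> mA; rewrite -pr_setT le_pr. Qed.

(** Bounded measurable functions, the algebra on which the expectation below is a
    positive linear functional without integrability conditions. *)
Definition bmf f := measurable_fun setT f /\ exists M, forall x, `|f x| <= M.

Lemma bmf_cst c : bmf (fun=> c).
Proof. by split=> //; exists `|c|. Qed.

Lemma bmf_indic A : measurable A -> bmf (\1_A).
Proof.
move=> mA; split; first exact: measurable_indic.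
by exists 1 => x; rewrite indicE ger0_norm// lern1 leq_b1.
Qed.

Lemma bmfD f g : bmf f -> bmf g -> bmf (fun x => f x + g x).
Proof.
move=> [mf [M fM]] [mg [N gN]]; split; first exact: measurable_funD.
by exists (M + N) => x; rewrite (le_trans (ler_normD _ _))// lerD.
Qed.

Lemma bmfM f g : bmf f -> bmf g -> bmf (fun x => f x * g x).
Proof.
move=> [mf [M fM]] [mg [N gN]]; split; first exact: measurable_funM.
by exists (M * N) => x; rewrite normrM ler_pM.
Qed.

Lemma bmfZ c f : bmf f -> bmf (fun x => c * f x).
Proof. by move=> bf; apply: bmfM => //; exact: bmf_cst. Qed.

Lemma bmfB f g : bmf f -> bmf g -> bmf (fun x => f x - g x).
Proof.
move=> [mf [M fM]] [mg [N gN]]; split; first exact: measurable_funB.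
by exists (M + N) => x; rewrite (le_trans (ler_normB _ _))// lerD.
Qed.

Lemma bmfX2 f : bmf f -> bmf (fun x => f x ^+ 2).
Proof. by move=> bf; exact: bmfM. Qed.

Lemma bmf_norm f : bmf f -> bmf (fun x => `|f x|).
Proof.
move=> [mf [M fM]]; split; first exact: measurableT_comp.
by exists M => x; rewrite normr_id.
Qed.

Lemma bmf_sum (I : Type) (s : seq I) (F : I -> Y -> R) :
  (forall i, bmf (F i)) -> bmf (fun x => \sum_(i <- s) F i x).
Proof.
move=> bF; elim: s => [|i s IH].
  by under eq_fun do rewrite big_nil; exact: bmf_cst.
by under eq_fun do rewrite big_cons; exact: bmfD.
Qed.

Definition expect f : R := \int[nu]_x f x.

Lemma bmf_integrable f : bmf f -> nu.-integrable setT (EFin \o f).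
Proof.
move=> [mf [M fM]].
apply: (@le_integrable _ _ _ _ _ measurableT _ (cst M%:E)) => //.
- exact/measurable_EFinP.
- move=> x _ /=; rewrite lee_fin (le_trans (fM x))// ler_norm//.
- exact: finite_measure_integrable_cst.
Qed.

Lemma expectD f g : bmf f -> bmf g ->
  expect (fun x => f x + g x) = expect f + expect g.
Proof. by move=> bf bg; rewrite /expect RintegralD//; exact: bmf_integrable. Qed.

Lemma expectB f g : bmf f -> bmf g ->
  expect (fun x => f x - g x) = expect f - expect g.
Proof. by move=> bf bg; rewrite /expect RintegralB//; exact: bmf_integrable. Qed.

Lemma expectZ c f : bmf f -> expect (fun x => c * f x) = c * expect f.
Proof. by move=> bf; rewrite /expect RintegralZl//; exact: bmf_integrable. Qed.

Lemma expect_cst c : expect (fun=> c) = c.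
Proof.
by rewrite /expect Rintegral_cst// [X in fine X](probability_setT nu) mulr1.
Qed.

Lemma expect_sum (I : Type) (s : seq I) (F : I -> Y -> R) :
  (forall i, bmf (F i)) ->
  expect (fun x => \sum_(i <- s) F i x) = \sum_(i <- s) expect (F i).
Proof.
move=> bF; elim: s => [|i s IH].
  by rewrite big_nil; under eq_fun do rewrite big_nil; rewrite expect_cst.
under eq_fun do rewrite big_cons.
by rewrite big_cons expectD ?IH//; exact: bmf_sum.
Qed.

Lemma expect_ge0 f : (forall x, 0 <= f x) -> 0 <= expect f.
Proof. by move=> f0; apply: Rintegral_ge0 => x _. Qed.

Lemma le_expect f g : bmf f -> bmf g -> (forall x, f x <= g x) ->
  expect f <= expect g.
Proof.
by move=> bf bg fg; apply: le_Rintegral => //; exact: bmf_integrable.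
Qed.

Lemma expect_indic A : measurable A -> expect (\1_A) = pr A.
Proof. by move=> mA; rewrite /expect /Rintegral integral_indic// setIT. Qed.

Lemma eq_expect f g : f =1 g -> expect f = expect g.
Proof. by move=> /funext ->. Qed.

Lemma expect_sqr_ge f : bmf f -> expect f ^+ 2 <= expect (fun x => f x ^+ 2).
Proof.
move=> bf; set c := expect f.
have : 0 <= expect (fun x => (f x - c) ^+ 2).
  by apply: expect_ge0 => x; exact: sqr_ge0.
rewrite (@eq_expect _ (fun x => (f x ^+ 2 - (2 * c) * f x) + c ^+ 2)); last first.
  by move=> x; ring.
have bf2 := bmfX2 bf.
rewrite expectD; [|exact: bmfB (bmfZ _ bf)|exact: bmf_cst].
rewrite expectB//; last exact: bmfZ.
by rewrite expectZ// expect_cst -/c => ?; nra.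
Qed.

Lemma eq_expect_ae f g : bmf f -> bmf g -> {ae nu, forall x, f x = g x} ->
  expect f = expect g.
Proof.
move=> bf bg fg; rewrite /expect /Rintegral; congr fine.
apply: ae_eq_integral => //.
- exact/measurable_EFinP/bf.1.
- exact/measurable_EFinP/bg.1.
- by apply: filterS fg => x fgx _ /=; rewrite fgx.
Qed.

Lemma prU A B : measurable A -> measurable B -> A `&` B = set0 ->
  pr (A `|` B) = pr A + pr B.
Proof.
move=> mA mB AB; rewrite /pr measureU// fineD ?fin_num_measure//.
Qed.

Lemma pr_setID A B : measurable A -> measurable B ->
  pr A = pr (A `&` B) + pr (A `\` B).
Proof.
move=> mA mB; rewrite -prU; first by rewrite setUIDK.
- exact: measurableI.
- exact: measurableD.
- by apply/seteqP; split=> x//= [[_ Bx] [_]].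
Qed.

Lemma pr_setC A : measurable A -> pr (~` A) = 1 - pr A.
Proof. by move=> mA; rewrite -pr_setT (pr_setID measurableT mA) setTI setTD; lra. Qed.

Lemma pr_ae A B : measurable A -> measurable B ->
  {ae nu, forall x, A x <-> B x} -> pr A = pr B.
Proof.
move=> mA mB AB; rewrite -!expect_indic//; apply: eq_expect_ae.
- exact: bmf_indic.
- exact: bmf_indic.
apply: filterS AB => x AB; rewrite !indicE; congr (_%:R); congr nat_of_bool.
by apply/idP/idP; rewrite !inE => /AB.
Qed.

Lemma pr_diff_le A B : measurable A -> measurable B ->
  `|pr A - pr B| <= pr (A `\` B) + pr (B `\` A).
Proof.
move=> mA mB; rewrite (pr_setID mA mB) (pr_setID mB mA) setIC.
have := pr_ge0 (A `\` B); have := pr_ge0 (B `\` A).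
by move=> *; rewrite ler_norml; apply/andP; split; lra.
Qed.

Lemma prU_le A B : measurable A -> measurable B ->
  pr (A `|` B) <= pr A + pr B.
Proof.
move=> mA mB; rewrite (pr_setID (measurableU _ _ mA mB) mA) setUK setDUl setDv set0U lerD2l.
by apply: le_pr => //; exact: measurableD.
Qed.

Lemma measurable_le (u : Y -> R) (c : R) : measurable_fun setT u ->
  measurable [set x | u x <= c].
Proof.
move=> mu; rewrite (_ : [set _ | _] = u @^-1` `]-oo, c]); last first.
  by apply/seteqP; split => x; rewrite /preimage/= in_itv.
by rewrite -[X in measurable X]setTI; exact: mu.
Qed.

Lemma measurable_ge (u : Y -> R) (c : R) : measurable_fun setT u ->
  measurable [set x | c <= u x].
Proof.
move=> mu; rewrite (_ : [set _ | _] = u @^-1` `[c, +oo[); last first.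
  by apply/seteqP; split => x; rewrite /preimage/= in_itv/= andbT.
by rewrite -[X in measurable X]setTI; exact: mu.
Qed.

End real_probability.

Lemma small_inv (R : realType) (e : R) : 0 < e -> exists n, n.+1%:R^-1 < e.
Proof. by move=> e0; have := ltr_add_invr e0; under eq_exists do rewrite add0r. Qed.

Lemma inv_le (R : realType) m n : (m <= n)%N -> n.+1%:R^-1 <= m.+1%:R^-1 :> R.
Proof. by move=> mn; rewrite lef_pV2 ?posrE// ler_nat. Qed.

Section continuity_of_probability.
Context (R : realType) (d : measure_display).
Context (Y : measurableType d) (nu : probability Y R).

Lemma pr_bigcup_gt (F : nat -> set Y) (s : R) : (forall n, measurable (F n)) ->
  (forall n, F n `<=` F n.+1) -> s < pr nu (\bigcup_n F n) ->
  exists n, s < pr nu (F n).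
Proof.
move=> mF ndF sF; have mUF : measurable (\bigcup_n F n) by exact: bigcupT_measurable.
have : nu (F n) @[n --> \oo] --> nu (\bigcup_n F n).
  apply: nondecreasing_cvg_mu => //; apply/nondecreasing_seqP => n.
  exact/subsetPset.
rewrite prE// => /fine_cvg/(cvgr_gt (pr nu (\bigcup_n F n)))/(_ s sF)[n _ /(_ n (leqnn n))].
by exists n.
Qed.

Lemma pr_bigcap_lt (F : nat -> set Y) (s : R) : (forall n, measurable (F n)) ->
  (forall n, F n.+1 `<=` F n) -> pr nu (\bigcap_n F n) < s ->
  exists n, pr nu (F n) < s.
Proof.
move=> mF niF Fs; have mIF : measurable (\bigcap_n F n) by exact: bigcapT_measurable.
have [n|n||n] := @pr_bigcup_gt (fun n => ~` F n) (1 - s).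
- exact: measurableC.
- exact: subsetC.
- by rewrite -setC_bigcap pr_setC//; lra.
- by rewrite pr_setC// => ?; exists n; lra.
Qed.

End continuity_of_probability.

(** * Correlations and support functions *)

Section actions.
Context (G : groupType) (R : realType) (d : measure_display).
Context (Y : measurableType d) (nu : probability Y R) (a : mpaction G nu).
Implicit Types (A B : set Y) (g h : G).

Lemma mpactK g : cancel (a g) (a g^-1%g).
Proof. by move=> y; rewrite -mpactM mulVg mpact1. Qed.

Lemma mpactVK g : cancel (a g^-1%g) (a g).
Proof. by move=> y; rewrite -mpactM mulgV mpact1. Qed.

Lemma act_imageE g A : a g @` A = a g^-1%g @^-1` A.
Proof.
apply/seteqP; split=> [_ [y Ay <-]|y Ay]; first by rewrite /preimage/= mpactK.
by exists (a g^-1%g y) => //; rewrite mpactVK.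
Qed.

Lemma measurable_act g : measurable_fun setT (a g).
Proof. exact: (mpact_mp a g).1. Qed.

Lemma measurable_act_preimage g A : measurable A -> measurable (a g @^-1` A).
Proof. by move=> mA; rewrite -[X in measurable X]setTI; exact: measurable_act. Qed.

Lemma measurable_act_image g A : measurable A -> measurable (a g @` A).
Proof. by rewrite act_imageE; exact: measurable_act_preimage. Qed.

Lemma pr_act_preimage g A : measurable A -> pr nu (a g @^-1` A) = pr nu A.
Proof. by move=> mA; rewrite /pr (mpact_mp a g).2. Qed.

Lemma pr_act_image g A : measurable A -> pr nu (a g @` A) = pr nu A.
Proof. by rewrite act_imageE; exact: pr_act_preimage. Qed.

Definition corr g A B : R := pr nu (a g @` A `&` B).

Lemma corr_ge0 g A B : 0 <= corr g A B.
Proof. exact: pr_ge0. Qed.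

Lemma measurable_corr g A B : measurable A -> measurable B ->
  measurable (a g @` A `&` B).
Proof. by move=> mA mB; apply: measurableI => //; exact: measurable_act_image. Qed.

Lemma corr_le1 g A B : measurable A -> measurable B -> corr g A B <= 1.
Proof. by move=> mA mB; exact/pr_le1/measurable_corr. Qed.

Lemma act_image1 A : a 1%g @` A = A.
Proof.
by apply/seteqP; split=> [_ [x Ax <-]|x Ax]; [rewrite mpact1|exists x; rewrite ?mpact1].
Qed.

Lemma corr1 A : corr 1%g A A = pr nu A.
Proof. by rewrite /corr act_image1 setIid. Qed.

(** An entry (c, g, i, j) stands for c times the correlation of the i-th and the
    j-th set under g. *)
Definition test k := seq (R * G * 'I_k * 'I_k).

Definition pairing k (phi : test k) (B : 'I_k -> set Y) : R :=
  \sum_(p <- phi) p.1.1.1 * corr p.1.1.2 (B p.1.2) (B p.2).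

Definition test_norm k (phi : test k) : R := \sum_(p <- phi) `|p.1.1.1|.

Lemma test_norm_ge0 k (phi : test k) : 0 <= test_norm phi.
Proof. by apply: sumr_ge0 => p _. Qed.

Lemma pairing_le_norm k (phi : test k) (B : 'I_k -> set Y) : (forall i, measurable (B i)) ->
  `|pairing phi B| <= test_norm phi.
Proof.
move=> mB; rewrite (le_trans (ler_norm_sum _ _ _))// ler_sum// => p _.
by rewrite normrM ler_piMr// ger0_norm ?corr_ge0// corr_le1.
Qed.

(** The support function, in the direction phi, of the closed convex hull of
    the correlation arrays of k-tuples of sets. *)
Definition supp k (phi : test k) : R :=
  sup [set pairing phi B | B in [set B : 'I_k -> set Y | forall i, measurable (B i)]].

Lemma has_sup_supp k (phi : test k) :
  has_sup [set pairing phi B | B in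
    [set B : 'I_k -> set Y | forall i, measurable (B i)]].
Proof.
split; first by exists (pairing phi (fun=> set0)), (fun=> set0).
exists (test_norm phi) => _ [B mB <-].
exact: le_trans (ler_norm _) (pairing_le_norm _ mB).
Qed.

Lemma pairing_le_supp k (phi : test k) (B : 'I_k -> set Y) : (forall i, measurable (B i)) ->
  pairing phi B <= supp phi.
Proof. by move=> mB; apply: ub_le_sup; [exact: (has_sup_supp phi).2|exists B]. Qed.

Lemma supp_adherent k (phi : test k) (e : R) : 0 < e ->
  exists2 B : 'I_k -> set Y, forall i, measurable (B i) & supp phi - e < pairing phi B.
Proof.
by move=> e0; have [_ [B mB <-] eB] := sup_adherent e0 (has_sup_supp phi); exists B.
Qed.

Lemma supp_le k (phi : test k) (M : R) :
  (forall B : 'I_k -> set Y, (forall i, measurable (B i)) -> pairing phi B <= M) -> supp phi <= M.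
Proof.
move=> BM; apply: ge_sup; first exact: (has_sup_supp phi).1.
by move=> _ [B mB <-]; exact: BM.
Qed.

End actions.

Lemma pairing_close (G : groupType) (R : realType) (d1 d2 : measure_display)
    (Y1 : measurableType d1) (nu1 : probability Y1 R)
    (Y2 : measurableType d2) (nu2 : probability Y2 R)
    (a : mpaction G nu1) (b : mpaction G nu2) k (phi : test G R k)
    (A : 'I_k -> set Y1) (B : 'I_k -> set Y2) (e : R) :
  (forall p, p \in phi ->
    `|corr a p.1.1.2 (A p.1.2) (A p.2) - corr b p.1.1.2 (B p.1.2) (B p.2)| <= e) ->
  pairing a phi A <= pairing b phi B + e * test_norm phi.
Proof.
move=> AB; rewrite -lerBlDl /pairing /test_norm -sumrB mulr_sumr big_seq [leRHS]big_seq.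
apply: ler_sum => p pphi; rewrite -mulrBr (le_trans (ler_norm _))// normrM mulrC.
by rewrite ler_wpM2r// AB.
Qed.

Section sum_actions.
Context (G : groupType) (R : realType) (n : nat) (d : measure_display).
Context (Y : 'I_n.+1 -> measurableType d) (nu : forall i, probability (Y i) R).
Context (w : weights R n) (a : forall i, mpaction G (nu i)).

Definition slice (i : 'I_n.+1) (B : set (dunion Y)) : set (Y i) :=
  existT (fun i => Y i) i @^-1` B.

Arguments slice i B : clear implicits.

Lemma pr_sum B : measurable B ->
  pr (dunion_measure nu w) B = \sum_i w i * pr (nu i) (slice i B).
Proof.
move=> mB; rewrite /pr /= /dunion_measure.
rewrite (eq_bigr (fun i => (w i * pr (nu i) (slice i B))%:E)) ?sumEFin// => i _.
by rewrite EFinM -prE//; exact: mB.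
Qed.

Lemma corr_sum g B B' : measurable B -> measurable B' ->
  corr (sum_action w a) g B B' =
  \sum_i w i * corr (a i) g (slice i B) (slice i B').
Proof.
move=> mB mB'; rewrite /corr pr_sum; last exact: measurable_corr.
apply: eq_bigr => i _; congr (_ * pr _ _).
by rewrite !act_imageE.
Qed.

Lemma pairing_sum k (phi : test G R k) (B : 'I_k -> set (dunion Y)) : (forall i, measurable (B i)) ->
  pairing (sum_action w a) phi B =
  \sum_i w i * pairing (a i) phi (fun j => slice i (B j)).
Proof.
move=> mB; rewrite /pairing.
under eq_bigr do rewrite corr_sum// mulr_sumr.
rewrite exchange_big/=; apply: eq_bigr => i _; rewrite mulr_sumr.
by apply: eq_bigr => p _; ring.
Qed.

End sum_actions.
Arguments slice {n d Y} i B.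

Lemma supp_conv (G : groupType) (R : realType) d (X : measurableType d)
    (mu : probability X R) (t : {i01 R}) (a b : mpaction G mu) k (phi : test G R k) :
  supp (conv_action t a b) phi =
  t%:num * supp a phi + (1 - t%:num) * supp b phi.
Proof.
have t0 : 0 <= t%:num by [].
have t1 : 0 <= 1 - t%:num by rewrite subr_ge0.
have pE B : (forall i, measurable (B i)) -> pairing (conv_action t a b) phi B =
    t%:num * pairing a phi (fun j => slice (ord0 : 'I_2) (B j)) +
    (1 - t%:num) * pairing b phi (fun j => slice (lift ord0 ord0 : 'I_2) (B j)).
  by move=> mB; rewrite pairing_sum// big_ord_recl big_ord1.
apply/eqP; rewrite eq_le; apply/andP; split.
  apply: supp_le => B mB; rewrite pE//.
  by apply: lerD; apply: ler_wpM2l => //; apply: pairing_le_supp => i; exact: mB.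
apply/ler_addgt0Pr => e e0.
have [A mA Ae] := supp_adherent a phi e0.
have [B mB Be] := supp_adherent b phi e0.
pose C j : set (dunion (fun _ : 'I_2 => X)) :=
  [set x | if projT1 x == ord0 then A j (projT2 x) else B j (projT2 x)].
have mC j : measurable (C j).
  by move=> i; rewrite /C /preimage/=; case: (i == ord0) => //; [exact: mA|exact: mB].
have := pairing_le_supp (conv_action t a b) phi mC.
rewrite pE// /slice /C /preimage/= => h.
rewrite -lerBlDr (le_trans _ h)//.
have -> : t%:num * supp a phi + (1 - t%:num) * supp b phi - e =
   t%:num * (supp a phi - e) + (1 - t%:num) * (supp b phi - e) by ring.
by apply: lerD; apply: ler_wpM2l => //; exact: ltW.
Qed.

(** * Stable weak containment as an inequality of support functions *)

Section stable_weak_containment_dual.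
Context (G : groupType) (R : realType) (d1 d2 : measure_display).
Context (Y1 : measurableType d1) (nu1 : probability Y1 R).
Context (Y2 : measurableType d2) (nu2 : probability Y2 R).
Context (a : mpaction G nu1) (b : mpaction G nu2).

Lemma supp_le_of_swc k (phi : test G R k) :
  stable_weak_contained a b -> supp a phi <= supp b phi.
Proof.
move=> ab; apply: supp_le => A mA; apply/ler_addgt0Pr => e e0.
pose N := test_norm phi + 1.
have N0 : 0 < N by rewrite ltr_wpDl// test_norm_ge0.
have [] := ab k A [set` [seq p.1.1.2 | p <- phi]] (e / N) mA.
- exact: finite_seq.
- by rewrite divr_gt0.
move=> n [w] [B] [w0 mB AB].
have -> : e = e / N * N by rewrite divfK// gt_eqF.
have leB : pairing (sum_action w (fun _ => b)) phi B <= supp b phi.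
  rewrite pairing_sum// -[leRHS]mul1r -(weight_sum1 w) mulr_suml.
  apply: ler_sum => i _; apply: ler_wpM2l; first exact: weight_ge0.
  by apply: pairing_le_supp => j; exact: mB.
apply: (@le_trans _ _ (pairing (sum_action w (fun _ => b)) phi B + e / N * test_norm phi)); last first.
  apply: lerD => //; apply: ler_wpM2l; last by rewrite /N lerDl.
  by rewrite divr_ge0// ltW.
apply: pairing_close => p pphi; apply/ltW/AB => /=.
by apply/mapP; exists p.
Qed.

(** The correlation arrays of tuples of sets in weighted sums of copies of [b];
    they form the convex hull of the correlation arrays of b, so that
    [mixtures_move] keeps them convex. *)
Definition mixtures k : set (G * 'I_k * 'I_k -> R) :=
  [set q | exists (n : nat) (w : weights R n) (C : 'I_n.+1 -> 'I_k -> set Y2),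
    [/\ forall l, 0 < w l, forall l i, measurable (C l i)
      & q = fun x => \sum_l w l * corr b x.1.1 (C l x.1.2) (C l x.2)]].

Let array k (B : 'I_k -> set Y2) (x : G * 'I_k * 'I_k) : R :=
  corr b x.1.1 (B x.1.2) (B x.2).

Lemma mixtures_array k (B : 'I_k -> set Y2) : (forall i, measurable (B i)) ->
  mixtures (array B).
Proof.
move=> mB.
have w1 : \sum_(i < 1) (1 : R) = 1 by rewrite big_ord1.
exists 0%N, (@Weights R 0 (fun=> 1) (fun=> ler01) w1), (fun=> B); split => //=.
by apply/funext => x; rewrite big_ord1 mul1r.
Qed.

Lemma mixtures_move k (q : G * 'I_k * 'I_k -> R) (B : 'I_k -> set Y2) (s : R) :
  mixtures q -> (forall i, measurable (B i)) -> 0 < s < 1 ->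
  mixtures (fun x => (1 - s) * q x + s * array B x).
Proof.
move=> [n [w [C [w0 mC ->]]]] mB /andP[s0 s1].
pose w' (l : 'I_n.+2) := if unlift ord0 l is Some l' then (1 - s) * w l' else s.
have w'0 l : 0 < w' l.
  by rewrite /w'; case: unliftP => // l' _; rewrite mulr_gt0// subr_gt0.
have w'1 : \sum_l w' l = 1.
  rewrite big_ord_recl /w' unlift_none.
  under eq_bigr do rewrite liftK.
  by rewrite -mulr_sumr weight_sum1 mulr1 addrC subrK.
exists n.+1, (Weights (fun l => ltW (w'0 l)) w'1),
  (fun l => if unlift ord0 l is Some l' then C l' else B); split => //=.
  by move=> l i; case: unliftP.
apply/funext => x; rewrite [RHS]big_ord_recl /w' unlift_none addrC; congr (_ + _).
by rewrite mulr_sumr; apply: eq_bigr => l _; rewrite !liftK mulrA.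
Qed.

Lemma mixtures_itv k (q : G * 'I_k * 'I_k -> R) x : mixtures q -> 0 <= q x <= 1.
Proof.
move=> [n [w [C [w0 mC ->]]]]; apply/andP; split.
  by apply: sumr_ge0 => l _; rewrite mulr_ge0 ?weight_ge0// corr_ge0.
rewrite -(weight_sum1 w); apply: ler_sum => l _.
by rewrite ler_piMr ?weight_ge0// corr_le1.
Qed.

Definition int_test k (phi : seq (int * G * 'I_k * 'I_k)) : test G R k :=
  [seq (p.1.1.1%:~R, p.1.1.2, p.1.2, p.2) | p <- phi].

(** Finite-dimensional separation, from a near-minimizer q of the distance of
    the array p of A to the convex set of mixtures: p - q is a functional which
    is larger at p than at any mixture, by a definite amount; rounding a large
    multiple of it gives integer coefficients. *)
Lemma swc_of_supp :
  (forall k (phi : seq (int * G * 'I_k * 'I_k)),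
      supp a (int_test phi) <= supp b (int_test phi)) ->
  stable_weak_contained a b.
Proof.
move=> Hab k A F eps mA finF eps0.
have [s Fs] := (finite_seqP F).1 finF.
pose idx := [seq (g, x.1, x.2) | g <- s, x <- enum {: 'I_k * 'I_k}].
have idxP g i j : F g -> (g, i, j) \in idx.
  rewrite Fs => /= gs; apply/allpairsPdep.
  by exists g, (i, j); rewrite mem_enum.
pose N : R := (size idx)%:R.
pose p (x : G * 'I_k * 'I_k) : R := corr a x.1.1 (A x.1.2) (A x.2).
pose dist2 (q : G * 'I_k * 'I_k -> R) := \sum_(x <- idx) (p x - q x) ^+ 2.
have p01 x : 0 <= p x <= 1 by rewrite corr_ge0 corr_le1.
apply: contrapT => far.
have dist_ge q : mixtures q -> eps ^+ 2 <= dist2 q.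
  move=> mq; rewrite leNgt; apply/negP => lt_eps; apply: far.
  have [n [w [C [w0 mC qE]]]] := mq.
  pose U j : set (dunion (fun _ : 'I_n.+1 => Y2)) :=
    [set x | C (projT1 x) j (projT2 x)].
  have mU j : measurable (U j) by apply/measurable_dunionP => l; exact: mC.
  exists n, w, U; split => // g i j Fg.
  change (`|p (g, i, j) - corr (sum_action w (fun=> b)) g (U i) (U j)| < eps).
  rewrite corr_sum//.
  have -> : \sum_l w l * corr b g (slice l (U i)) (slice l (U j)) =
      q (g, i, j) by rewrite qE.
  rewrite -(ltr_pXn2r (n := 2))// ?nnegrE ?ltW//.
  rewrite -normrX ger0_norm ?sqr_ge0//; apply: le_lt_trans lt_eps.
  rewrite /dist2 (big_rem (g, i, j)) ?idxP//= lerDl.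
  by apply: sumr_ge0 => y _; exact: sqr_ge0.
have N0 : 0 <= N by [].
pose S := [set dist2 q | q in @mixtures k].
have S0 : S !=set0.
  by eexists; exists (array (fun=> set0)) => //; exact: mixtures_array.
have infS : has_inf S by split => //; exists (eps ^+ 2) => _ [q /dist_ge ? <-].
have e20 : 0 < eps ^+ 2 by rewrite exprn_gt0.
pose u := Num.min (1 / 2) (eps ^+ 2 / (2 * (N + 1))).
have u0 : 0 < u.
  by rewrite /u lt_min; apply/andP; split; [lra|rewrite divr_gt0// mulr_gt0// ltr_wpDl].
have u1 : u < 1 by rewrite /u gt_min; apply/orP; left; lra.
have uN : u * N <= eps ^+ 2 / 2.
  have : u <= eps ^+ 2 / (2 * (N + 1)) by rewrite /u ge_min lexx orbT.
  rewrite ler_pdivlMr ?mulr_gt0// ?ltr_wpDl// => h.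
  by have := ltW u0; nra.
pose eta := u * eps ^+ 2 / 2.
have eta0 : 0 < eta by rewrite /eta divr_gt0// mulr_gt0.
have [_ [q mq <-] qeta] := inf_adherent eta0 infS.
have ltq q' : mixtures q' -> dist2 q - eta < dist2 q'.
  move=> mq'; rewrite ltrBlDr (lt_le_trans qeta)// lerD2r ge_inf//.
    exact: infS.2.
  by exists q'.
(* Moving q by the small step u towards the array of B remains among the
   mixtures, so it decreases the squared distance by at most eta. *)
have deriv (B : 'I_k -> set Y2) : (forall i, measurable (B i)) ->
    \sum_(x <- idx) (p x - q x) * (array B x - q x) <= eps ^+ 2 / 2.
  move=> mB; set D := (X in X <= _).
  have us : 0 < u < 1 by rewrite u0.
  have := ltq _ (mixtures_move mq mB us).
  have -> : dist2 (fun x => (1 - u) * q x + u * array B x) =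
      dist2 q - 2 * u * D + u ^+ 2 * \sum_(x <- idx) (array B x - q x) ^+ 2.
    rewrite /dist2 /D !mulr_sumr -sumrB -big_split/=; apply: eq_bigr => x _; ring.
  have : \sum_(x <- idx) (array B x - q x) ^+ 2 <= N.
    rewrite /N -sum1_size natr_sum; apply: ler_sum => x _.
    have /andP[q0 q1] := mixtures_itv x mq.
    have /andP[B0 B1] := mixtures_itv x (mixtures_array mB).
    by rewrite -[leRHS](expr1n _ 2) -ler_sqrt ?expr1n// sqrtr_sqr sqrtr1 ler_norml; lra.
  set V := \sum_(x <- idx) _ => VN h.
  have h2 : 2 * u * D <= u * (eps ^+ 2) / 2 + u * (u * N).
    have : u ^+ 2 * V <= u * (u * N) by rewrite expr2 -mulrA !ler_pM2l.
    by rewrite /eta in h; lra.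
  have h3 : u * (2 * D) <= u * (eps ^+ 2).
    have : u * (u * N) <= u * (eps ^+ 2 / 2) by rewrite ler_pM2l.
    by lra.
  by move: h3; rewrite ler_pM2l//; lra.
have sep (B : 'I_k -> set Y2) : (forall i, measurable (B i)) ->
    \sum_(x <- idx) (p x - q x) * array B x <=
    \sum_(x <- idx) (p x - q x) * p x - eps ^+ 2 / 2.
  move=> mB; have h := deriv B mB; have := dist_ge _ mq.
  have -> : dist2 q = \sum_(x <- idx) (p x - q x) * p x -
                      \sum_(x <- idx) (p x - q x) * q x.
    by rewrite -sumrB; apply: eq_bigr => x _; ring.
  have -> : \sum_(x <- idx) (p x - q x) * array B x =
    \sum_(x <- idx) (p x - q x) * (array B x - q x) +
    \sum_(x <- idx) (p x - q x) * q x.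
    by rewrite -big_split/=; apply: eq_bigr => x _; ring.
  by lra.
(* rounding changes each side by at most N; with this M the gap is 2 N + 1 *)
pose M : R := 2 * (2 * N + 1) / eps ^+ 2.
pose c x : int := Num.floor (M * (p x - q x)).
have cM x : `|(c x)%:~R - M * (p x - q x)| <= 1.
  have /andP[h1 h2] := floor_itv (M * (p x - q x)).
  by rewrite intrD in h2; rewrite ler_norml /c; apply/andP; split; lra.
pose phi := [seq (c x, x.1.1, x.1.2, x.2) | x <- idx].
have M0 : 0 <= M by rewrite /M; apply: divr_ge0; lra.
have round (v : G * 'I_k * 'I_k -> R) : (forall x, 0 <= v x <= 1) ->
    `|\sum_(x <- idx) (c x)%:~R * v x - M * \sum_(x <- idx) (p x - q x) * v x| <= N.
  move=> v01; rewrite mulr_sumr -sumrB (le_trans (ler_norm_sum _ _ _))//.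
  rewrite /N -sum1_size natr_sum; apply: ler_sum => x _.
  have v1 : `|v x| <= 1 by rewrite ler_norml; have /andP[] := v01 x; lra.
  rewrite mulrA -mulrBl normrM -[leRHS]mulr1; exact: ler_pM.
have phiE d (Y : measurableType d) (nu : probability Y R) (e : mpaction G nu) B :
    pairing e (int_test phi) B =
    \sum_(x <- idx) (c x)%:~R * corr e x.1.1 (B x.1.2) (B x.2).
  by rewrite /pairing /int_test /phi !big_map.
have := Hab k phi; apply/negP; rewrite -ltNge.
apply: lt_le_trans (pairing_le_supp a (int_test phi) mA); rewrite phiE.
apply: (@le_lt_trans _ _ (\sum_(x <- idx) (c x)%:~R * p x - 1)); last first.
  by rewrite ltrBlDr ltrDl.
apply: supp_le => B mB; rewrite phiE.
have h1 := round p p01.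
have h2 := round (array B) (fun x => mixtures_itv x (mixtures_array mB)).
have h3 := sep B mB.
have : M * (\sum_(x <- idx) (p x - q x) * array B x) <=
       M * (\sum_(x <- idx) (p x - q x) * p x - eps ^+ 2 / 2) by exact: ler_wpM2l.
have -> : M * (\sum_(x <- idx) (p x - q x) * p x - eps ^+ 2 / 2) =
          M * \sum_(x <- idx) (p x - q x) * p x - (2 * N + 1).
  by rewrite /M; field; rewrite gt_eqF.
move: h1 h2; rewrite !ler_norml /array => /andP[h11 h12] /andP[h21 h22]; lra.
Qed.

End stable_weak_containment_dual.

Section stable_weak_equivalence_dual.
Context (G : groupType) (R : realType) (d1 d2 : measure_display).
Context (Y1 : measurableType d1) (nu1 : probability Y1 R).
Context (Y2 : measurableType d2) (nu2 : probability Y2 R).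
Context (a : mpaction G nu1) (b : mpaction G nu2).

Definition supp_eq := forall k (phi : test G R k), supp a phi = supp b phi.

Lemma swe_suppP : stable_weak_equiv a b <-> supp_eq.
Proof.
split=> [[ab ba] k phi|ab].
  by apply/eqP; rewrite eq_le !supp_le_of_swc.
by split; apply: swc_of_supp => k phi; rewrite ab.
Qed.

End stable_weak_equivalence_dual.

(** * Isomorphisms modulo null sets *)

Definition iso_mod0 (R : realType) (d1 d2 : measure_display)
    (Y1 : measurableType d1) (nu1 : probability Y1 R)
    (Y2 : measurableType d2) (nu2 : probability Y2 R)
    (phi : Y1 -> Y2) (psi : Y2 -> Y1) : Prop :=
  [/\ measure_preserving nu1 nu2 phi, measure_preserving nu2 nu1 psi,
      {ae nu1, forall y, psi (phi y) = y} & {ae nu2, forall y, phi (psi y) = y}].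

Definition isomorphic (R : realType) (d1 d2 : measure_display)
    (Y1 : measurableType d1) (nu1 : probability Y1 R)
    (Y2 : measurableType d2) (nu2 : probability Y2 R) : Prop :=
  exists phi psi, iso_mod0 nu1 nu2 phi psi.

Section measure_preserving.
Context (R : realType) (d1 d2 : measure_display).
Context (Y1 : measurableType d1) (nu1 : probability Y1 R).
Context (Y2 : measurableType d2) (nu2 : probability Y2 R).

Lemma mp_preimage (f : Y1 -> Y2) A : measure_preserving nu1 nu2 f ->
  measurable A -> measurable (f @^-1` A).
Proof. by move=> [mf _] mA; rewrite -[X in measurable X]setTI; exact: mf. Qed.

Lemma mp_pr (f : Y1 -> Y2) A : measure_preserving nu1 nu2 f ->
  measurable A -> pr nu1 (f @^-1` A) = pr nu2 A.
Proof. by move=> [_ mf] mA; rewrite /pr mf. Qed.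

Lemma ae_comp (f : Y1 -> Y2) (P : Y2 -> Prop) : measure_preserving nu1 nu2 f ->
  {ae nu2, forall y, P y} -> {ae nu1, forall y, P (f y)}.
Proof.
move=> mf [N [mN N0 PN]]; exists (f @^-1` N); split.
- exact: mp_preimage mf mN.
- by rewrite mf.2.
- by move=> y /= nP; exact: PN.
Qed.

End measure_preserving.

Lemma mp_comp (R : realType) (d1 d2 d3 : measure_display)
    (Y1 : measurableType d1) (nu1 : probability Y1 R)
    (Y2 : measurableType d2) (nu2 : probability Y2 R)
    (Y3 : measurableType d3) (nu3 : probability Y3 R)
    (f : Y1 -> Y2) (g : Y2 -> Y3) : measure_preserving nu1 nu2 f ->
  measure_preserving nu2 nu3 g -> measure_preserving nu1 nu3 (g \o f).
Proof.
move=> mf mg; split; first exact: measurableT_comp mg.1 mf.1.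
by move=> A mA; rewrite comp_preimage mf.2 ?mg.2//; exact: mp_preimage mg mA.
Qed.

Section isomorphic.
Context (R : realType) (d1 d2 d3 : measure_display).
Context (Y1 : measurableType d1) (nu1 : probability Y1 R).
Context (Y2 : measurableType d2) (nu2 : probability Y2 R).
Context (Y3 : measurableType d3) (nu3 : probability Y3 R).

Lemma iso_mod0_comp f f' g g' : iso_mod0 nu1 nu2 f f' -> iso_mod0 nu2 nu3 g g' ->
  iso_mod0 nu1 nu3 (g \o f) (f' \o g').
Proof.
move=> [mf mf' ff' f'f] [mg mg' gg' g'g]; split.
- exact: mp_comp mg.
- exact: mp_comp mf'.
- have := ae_comp mf gg'; apply: filterS2 ff' => y /= fy gfy.
  by rewrite gfy.
- have := ae_comp mg' f'f; apply: filterS2 g'g => y /= gy fgy.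
  by rewrite fgy.
Qed.

Lemma iso_mod0_sym f f' : iso_mod0 nu1 nu2 f f' -> iso_mod0 nu2 nu1 f' f.
Proof. by case. Qed.

End isomorphic.

Section transport.
Context (G : groupType) (R : realType) (d1 d2 d3 : measure_display).
Context (Y1 : measurableType d1) (nu1 : probability Y1 R).
Context (Y2 : measurableType d2) (nu2 : probability Y2 R).
Context (Y3 : measurableType d3) (nu3 : probability Y3 R).
Context (a : mpaction G nu1) (b : mpaction G nu2) (c : mpaction G nu3).

Lemma transport_sym : transport a b -> transport b a.
Proof.
move=> [f [f' [mf mf' f'f ff' fa]]]; exists f', f; split => // g.
have h1 := ae_comp mf' (fa g).
have h2 := ae_comp mf' (ae_comp (mpact_mp a g) f'f).
apply: filterS3 h1 h2 ff' => y /= h1 h2 h3.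
by rewrite -[in LHS]h3 -h1 h2.
Qed.

Lemma transport_trans : transport a b -> transport b c -> transport a c.
Proof.
move=> [f [f' [mf mf' f'f ff' fa]]] [k [k' [mk mk' k'k kk' kb]]].
have [mh mh' h'h hh'] := iso_mod0_comp (And4 mf mf' f'f ff') (And4 mk mk' k'k kk').
exists (k \o f), (f' \o k'); split => // g.
have := ae_comp mf (kb g); apply: filterS2 (fa g) => y /= -> ->//.
Qed.

Lemma transport_supp_le k (phi : test G R k) : transport a b ->
  supp b phi <= supp a phi.
Proof.
move=> [f [f' [mf mf' f'f ff' fa]]]; apply: supp_le => B mB.
have mfB i : measurable (f @^-1` B i) by exact: mp_preimage mf (mB i).
rewrite (_ : pairing b phi B = pairing a phi (fun i => f @^-1` B i)).
  exact: pairing_le_supp.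
apply: eq_bigr => p _; congr (_ * _); rewrite /corr -(mp_pr mf); last first.
  exact: measurable_corr.
apply: pr_ae; [exact: mp_preimage mf (measurable_corr _ _ _ _)|exact: measurable_corr|].
apply: filterS (fa p.1.1.2^-1%g) => y fay.
by rewrite !act_imageE /preimage/= fay.
Qed.

End transport.

Lemma transport_supp_eq (G : groupType) (R : realType) (d1 d2 : measure_display)
    (Y1 : measurableType d1) (nu1 : probability Y1 R)
    (Y2 : measurableType d2) (nu2 : probability Y2 R)
    (a : mpaction G nu1) (b : mpaction G nu2) :
  transport a b -> supp_eq a b.
Proof.
move=> tab k phi; apply/eqP; rewrite eq_le; apply/andP; split.
  exact/transport_supp_le/transport_sym.
exact: transport_supp_le.
Qed.

Lemma countable_enum (G : groupType) : countable [set: G] ->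
  exists e : nat -> G, forall g, exists n, e n = g.
Proof.
move=> /countable_injP[f finj]; exists (fun n => xget 1%g [set g | f g = n]).
move=> g; exists (f g); case: xgetP => [h _ /= fhg|/(_ g)/(_ erefl)//].
by apply: finj => //; rewrite inE.
Qed.

Lemma ae_countable (G : groupType) (R : realType) (d : measure_display)
    (Y : measurableType d) (nu : probability Y R) (P : G -> Y -> Prop) :
  countable [set: G] -> (forall g, {ae nu, forall y, P g y}) ->
  {ae nu, forall y, forall g, P g y}.
Proof.
move=> /countable_enum[e eP] aeP.
have := @ae_foralln _ _ _ nu (fun n => P (e n)) (fun n => aeP (e n)).
by apply: filterS => y Py g; have [n <-] := eP g.
Qed.

Lemma ae_countType (I : countType) (R : realType) (d : measure_display)
    (Y : measurableType d) (nu : probability Y R) (P : I -> Y -> Prop) :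
  (forall i, {ae nu, forall y, P i y}) -> {ae nu, forall y, forall i, P i y}.
Proof.
move=> aeP; pose Q n y := forall i, unpickle n = Some i -> P i y.
have aeQ n : {ae nu, forall y, Q n y}.
  rewrite /Q; case: (unpickle n) => [i|]; last by apply: aeW.
  by apply: filterS (aeP i) => y Py j [<-].
by apply: filterS (ae_foralln aeQ) => y Qy i; apply: (Qy (pickle i)); exact: pickleK.
Qed.

Lemma bigcup_countType_measurable (I : countType) (d : measure_display)
    (Y : measurableType d) (D : set I) (F : I -> set Y) :
  (forall i, measurable (F i)) -> measurable (\bigcup_(i in D) F i).
Proof.
move=> mF; pose H n := if unpickle n is Some i then
  if i \in D then F i else set0 else set0.
rewrite (_ : \bigcup_(i in D) F i = \bigcup_n H n).
  by apply: bigcupT_measurable => n; rewrite /H; case: unpickle => // i; case: ifP.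
apply/seteqP; split=> y [].
  by move=> i Di Fy; exists (pickle i) => //; rewrite /H pickleK mem_set.
move=> n _; rewrite /H; case: unpickle => // i; case: ifPn => //.
by rewrite inE => Di Fy; exists i.
Qed.

Lemma bigcap_countType_measurable (I : countType) (d : measure_display)
    (Y : measurableType d) (D : set I) (F : I -> set Y) :
  (forall i, measurable (F i)) -> measurable (\bigcap_(i in D) F i).
Proof.
move=> mF; rewrite -[X in measurable X]setCK setC_bigcap; apply: measurableC.
by apply: bigcup_countType_measurable => i; exact: measurableC.
Qed.

Lemma ae_conull (R : realType) (d : measure_display)
    (Y : measurableType d) (nu : probability Y R) (P : Y -> Prop) :
  {ae nu, forall y, P y} ->
  exists Z, [/\ measurable Z, pr nu Z = 1 & Z `<=` [set y | P y]].
Proof.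
move=> [N [mN N0 PN]]; exists (~` N); split.
- exact: measurableC.
- by rewrite pr_setC// /pr N0 subr0.
- by move=> y Ny; apply: contrapT => /PN.
Qed.

Lemma conull_ae (R : realType) (d : measure_display)
    (Y : measurableType d) (nu : probability Y R) (Z : set Y) :
  measurable Z -> pr nu Z = 1 -> {ae nu, forall y, Z y}.
Proof.
move=> mZ Z1; exists (~` Z); split => //; first exact: measurableC.
by rewrite prE; [rewrite pr_setC// Z1 subrr|exact: measurableC].
Qed.

(** The isomorphism restricts to a bijection between a conull set and an
    invariant conull set; the new action is the conjugate one on the former set
    and trivial elsewhere. *)
Lemma transported_action (G : groupType) (R : realType) (d1 d2 : measure_display)
    (Y1 : measurableType d1) (nu1 : probability Y1 R)
    (Y2 : measurableType d2) (nu2 : probability Y2 R) (b : mpaction G nu2) :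
  countable [set: G] -> isomorphic nu1 nu2 ->
  exists a : mpaction G nu1, transport a b.
Proof.
move=> hG [f [f' [mf mf' f'f ff']]].
have [W [mW W1 Wf]] := ae_conull f'f.
have [Z [mZ Z1 Zf]] := ae_conull ff'.
(* an invariant set on which f' takes values in W and is inverted by f *)
pose Z2 := \bigcap_(g : G) (b g @^-1` (Z `&` f' @^-1` W)).
have mZW : measurable (Z `&` f' @^-1` W).
  by apply: measurableI => //; exact: mp_preimage mf' mW.
have [e eP] := countable_enum hG.
have Z2E : Z2 = \bigcap_n (b (e n) @^-1` (Z `&` f' @^-1` W)).
  apply/seteqP; split=> y Zy; first by move=> n _; exact: Zy.
  by move=> g _; have [n <-] := eP g; exact: Zy.
have mZ2 : measurable Z2.
  by rewrite Z2E; apply: bigcapT_measurable => n; exact: measurable_act_preimage.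
have aeZ2 : {ae nu2, forall y, Z2 y}.
  have aeZ : {ae nu2, forall y, (Z `&` f' @^-1` W) y}.
    have := ae_comp mf' (conull_ae mW W1); apply: filterS2 (conull_ae mZ Z1).
    by move=> y Zy Wy.
  have := ae_countable hG (fun g => ae_comp (mpact_mp b g) aeZ).
  by apply: filterS => y Zy g _; exact: Zy.
have Z2b g y : Z2 y -> Z2 (b g y).
  by move=> Zy h _; have := Zy (h * g)%g I; rewrite /preimage/= mpactM.
have Z2Z y : Z2 y -> f (f' y) = y.
  by move=> /(_ 1%g I); rewrite /preimage/= mpact1 => -[/Zf].
have Z2W y : Z2 y -> W (f' y) by move=> /(_ 1%g I); rewrite /preimage/= mpact1 => -[].
pose X := W `&` f @^-1` Z2.
have mX : measurable X by apply: measurableI => //; exact: mp_preimage mf mZ2.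
have XZ y : Z2 y -> X (f' y).
  by move=> Zy; split; [exact: Z2W|rewrite /preimage/= Z2Z].
have aeX : {ae nu1, forall x, X x}.
  have := ae_comp mf aeZ2; apply: filterS2 (conull_ae mW W1).
  by move=> y Wy Zy.
pose act g x := if x \in X then f' (b g (f x)) else x.
have actX g x : X x -> act g x = f' (b g (f x)).
  by move=> Xx; rewrite /act mem_set.
have actNX g x : ~ X x -> act g x = x.
  by move=> Xx; rewrite /act memNset.
have act1 x : act 1%g x = x.
  have [Xx|Xx] := pselect (X x); last by rewrite actNX.
  by rewrite actX// mpact1; apply: Wf; exact: Xx.1.
have actM g h x : act (g * h)%g x = act g (act h x).
  have [Xx|Xx] := pselect (X x); last by rewrite !actNX.
  have Zbh : Z2 (b h (f x)) by apply: Z2b; exact: Xx.2.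
  by rewrite !actX// ?mpactM ?Z2Z//; exact: XZ.
have act_mp g : measure_preserving nu1 nu1 (act g).
  have actE A : act g @^-1` A = (X `&` (f' \o b g \o f) @^-1` A) `|` (~` X `&` A).
    apply/seteqP; split=> x; rewrite /preimage/=.
      by have [Xx|Xx] := pselect (X x); [rewrite actX//; left|rewrite actNX//; right].
    by move=> [[Xx]|[Xx]]; [rewrite actX|rewrite actNX].
  have mfbf : measure_preserving nu1 nu1 (f' \o b g \o f).
    exact: mp_comp mf (mp_comp (mpact_mp b g) mf').
  have mA A : measurable A -> measurable (act g @^-1` A).
    move=> mA; rewrite actE; apply: measurableU; apply: measurableI => //.
      exact: mp_preimage mfbf mA.
    exact: measurableC.
  split=> [_ A mA'|A mA']; first by rewrite setTI; exact: mA.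
  rewrite -(mfbf.2 A mA') (prE nu1 (mA A mA')) (prE nu1 (mp_preimage mfbf mA')).
  congr EFin; apply: pr_ae; [exact: mA|exact: mp_preimage mfbf mA'|].
  by apply: filterS aeX => x Xx; rewrite /preimage/= actX.
exists (MPAction act1 actM act_mp), f, f'; split => // g.
apply: filterS aeX => x Xx /=; rewrite actX// Z2Z//.
by apply: Z2b; exact: Xx.2.
Qed.

(** * The mean ergodic theorem for indicator functions *)

Section pointwise_limits.
Context (R : realType) (d : measure_display).
Context (Y : measurableType d) (nu : probability Y R).

Lemma ae_summable (u : nat -> Y -> R) (c : R) :
  (forall n, bmf (u n)) -> (forall n x, 0 <= u n x) ->
  (forall n, expect nu (u n) <= c / 2 ^+ n) ->
  {ae nu, forall x, cvgn (series (u ^~ x))}.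
Proof.
move=> bu u0 uc.
have mu n : measurable_fun setT (EFin \o u n) by apply/measurable_EFinP; exact: (bu n).1.
have intE n : (\int[nu]_x (u n x)%:E)%E = (expect nu (u n))%:E.
  rewrite /expect /Rintegral fineK//.
  exact/integrable_fin_num/bmf_integrable.
have int_fin : (\int[nu]_x (\sum_(0 <= n <oo) (u n x)%:E) < +oo)%E.
  rewrite integral_nneseries//; last by move=> n x _; rewrite lee_fin.
  apply: (@le_lt_trans _ _ (\sum_(0 <= n <oo) (c / 2 ^+ n)%:E)%E).
    apply: lee_nneseries => n _; first by rewrite integral_ge0// => x _; rewrite lee_fin.
    by rewrite intE lee_fin.
  have c0 : 0 <= c.
    have := uc 0%N; rewrite expr0 divr1; apply: le_trans.
    exact: expect_ge0.
  apply: (@le_lt_trans _ _ (2 * c)%:E); last exact: ltry.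
  apply: lime_le.
    by apply: is_cvg_nneseries => n _ _; rewrite lee_fin divr_ge0// exprn_ge0.
  apply: nearW => n; rewrite sumEFin lee_fin -mulr_sumr mulrC ler_wpM2r//.
  have -> : \sum_(0 <= i < n) (2 ^+ i : R)^-1 = 2 - 2 / 2 ^+ n.
    elim: n => [|n IH]; first by rewrite big_nil expr0; lra.
    by rewrite big_nat_recr//= IH exprS; field; rewrite gt_eqF// exprn_gt0.
  by rewrite gerBl divr_ge0// exprn_ge0.
have intS : nu.-integrable setT (fun x => \sum_(0 <= n <oo) (u n x)%:E)%E.
  apply/integrableP; split.
    apply: ge0_emeasurable_sum => [n x _ _|n _]; first by rewrite lee_fin.
    exact: mu.
  rewrite (eq_integral (fun x => \sum_(0 <= n <oo) (u n x)%:E)%E)// => x _.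
  by rewrite gee0_abs// nneseries_ge0// => n _ _; rewrite lee_fin.
apply: filterS (integrable_ae measurableT intS) => x /(_ I) Sfin.
apply: nondecreasing_is_cvgn.
  by apply/nondecreasing_seqP => n; rewrite seriesSr lerDl.
exists (fine (\sum_(0 <= n <oo) (u n x)%:E)%E) => _ [n _ <-].
rewrite -lee_fin fineK// /series/= -sumEFin.
by apply: nneseries_lim_ge => k _; rewrite lee_fin.
Qed.

Lemma expect_cvg (f : nat -> Y -> R) (g : Y -> R) (M : R) :
  (forall n, measurable_fun setT (f n)) -> measurable_fun setT g ->
  (forall n x, `|f n x| <= M) ->
  {ae nu, forall x, f n x @[n --> \oo] --> g x} ->
  expect nu (f n) @[n --> \oo] --> expect nu g.
Proof.
move=> mf mg fM fg.
have [|||||ig _ cv] := @dominated_convergence _ _ _ nu setT measurableT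
  (fun n => EFin \o f n) (EFin \o g) (cst M%:E).
- by move=> n; apply/measurable_EFinP; exact: mf.
- exact/measurable_EFinP.
- by apply: filterS fg => x fgx _; apply: cvg_EFin; [exact: nearW|exact: fgx].
- exact: finite_measure_integrable_cst.
- by apply: aeW => x n _ /=; rewrite lee_fin fM.
apply: fine_cvg; rewrite fineK; first exact: cv.
exact: integrable_fin_num ig.
Qed.

End pointwise_limits.

Section mean_ergodic.
Context (G : groupType) (R : realType) (d : measure_display).
Context (Y : measurableType d) (nu : probability Y R) (a : mpaction G nu).
Implicit Types (B C : set Y) (l : seq (R * G)) (f u : Y -> R).

Lemma expect_act g f : bmf f -> expect nu (f \o a g) = expect nu f.
Proof.
move=> bf; rewrite /expect /Rintegral; congr fine.
rewrite -[LHS](@integral_pushforward _ _ _ _ _ _ (measurable_act a g) nu setT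
  (EFin \o f))//.
- apply: eq_measure_integral => [|mg A mA _]; first exact: measurable_act.
  exact: ((mpact_mp a g).2 A mA).
- exact/measurable_EFinP/bf.1.
- apply: bmf_integrable; split.
    by apply: measurableT_comp; [exact: bf.1|exact: measurable_act].
  by have [_ [M fM]] := bf; exists M => x; exact: fM.
Qed.

Lemma bmf_act g f : bmf f -> bmf (f \o a g).
Proof.
move=> [mf [M fM]]; split; last by exists M => x; exact: fM.
by apply: measurableT_comp => //; exact: measurable_act.
Qed.

(** A weighted list of group elements, read as the average of the translates
    of the indicator function of B with these weights. *)
Definition average l B (x : Y) : R := \sum_(p <- l) p.1 * \1_(a p.2 @` B) x.

Definition convex_weights l := (forall p, p \in l -> 0 <= p.1) /\ \sum_(p <- l) p.1 = 1.

Lemma bmf_average l B : measurable B -> bmf (average l B).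
Proof.
move=> mB; apply: bmf_sum => p; apply: bmfZ; apply: bmf_indic.
exact: measurable_act_image.
Qed.

Lemma average_itv l B x : convex_weights l -> 0 <= average l B x <= 1.
Proof.
move=> [l0 l1]; apply/andP; split.
  rewrite /average big_seq; apply: sumr_ge0 => p pl.
  by rewrite mulr_ge0 ?l0// indicE.
rewrite /average -l1 big_seq [leRHS]big_seq; apply: ler_sum => p pl.
by rewrite ler_piMr ?l0// indicE lern1 leq_b1.
Qed.

Definition midpoint l l' := [seq (p.1 / 2, p.2) | p <- l ++ l'].

Definition translate g l := [seq (p.1, (g * p.2)%g) | p <- l].

Lemma convex_midpoint l l' : convex_weights l -> convex_weights l' ->
  convex_weights (midpoint l l').
Proof.
move=> [l0 l1] [l'0 l'1]; split.
  move=> _ /mapP[p + ->] /=; rewrite mem_cat => /orP[/l0|/l'0] ?; lra.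
by rewrite big_map big_cat/= -!mulr_suml l1 l'1; lra.
Qed.

Lemma average_midpoint l l' B x :
  average (midpoint l l') B x = (average l B x + average l' B x) / 2.
Proof.
rewrite /average big_map big_cat/= mulrDl !mulr_suml.
by congr (_ + _); apply: eq_bigr => p _; ring.
Qed.

Lemma convex_translate g l : convex_weights l -> convex_weights (translate g l).
Proof.
move=> [l0 l1]; split; first by move=> _ /mapP[p /l0 + ->].
by rewrite big_map.
Qed.

Lemma average_translate g l B x :
  average (translate g l) B x = average l B (a g^-1%g x).
Proof.
rewrite /average big_map; apply: eq_bigr => p _ /=; congr (_ * _).
rewrite !indicE !act_imageE; congr (nat_of_bool _)%:R.
by apply/idP/idP; rewrite !inE /preimage/= invgM mpactM.
Qed.

Let energy l B := expect nu (fun x => average l B x ^+ 2).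

Lemma parallelogram l l' B : measurable B ->
  expect nu (fun x => (average l B x - average l' B x) ^+ 2) =
  2 * energy l B + 2 * energy l' B - 4 * energy (midpoint l l') B.
Proof.
move=> mB; have bA l'' : bmf (fun x => average l'' B x ^+ 2).
  by apply: bmfX2; exact: bmf_average.
rewrite /energy -!expectZ// -expectD; [|exact: bmfZ|exact: bmfZ].
rewrite -expectB; [|by apply: bmfD; exact: bmfZ|exact: bmfZ].
by apply: eq_expect => x; rewrite average_midpoint; field.
Qed.

Lemma energy_translate g l B : measurable B -> energy (translate g l) B = energy l B.
Proof.
move=> mB; rewrite /energy -(expect_act g); last exact/bmfX2/bmf_average.
by apply: eq_expect => x /=; rewrite average_translate mpactK.
Qed.

Lemma expect_norm_le f e : bmf f -> 0 <= e ->
  expect nu (fun x => f x ^+ 2) <= e ^+ 2 -> expect nu (fun x => `|f x|) <= e.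
Proof.
move=> bf e0 fe; rewrite -(ler_pXn2r (n := 2))// ?nnegrE ?expect_ge0//.
apply: le_trans (expect_sqr_ge nu (bmf_norm bf)) _.
by rewrite (eq_expect nu (g := fun x => f x ^+ 2))// => x; rewrite -normrX ger0_norm ?sqr_ge0.
Qed.

Definition invariant_fun (f : Y -> R) := forall g x, f (a g x) = f x.

Definition invariant_set C := forall g x, C (a g x) <-> C x.

Lemma expect_average_inv l B u : convex_weights l -> measurable B -> bmf u ->
  invariant_fun u ->
  expect nu (fun x => average l B x * u x) = expect nu (fun x => \1_B x * u x).
Proof.
move=> [l0 l1] mB bu iu.
have bAu g : bmf (fun x => \1_(a g @` B) x * u x).
  by apply: bmfM => //; apply: bmf_indic; exact: measurable_act_image.
rewrite (@eq_expect _ _ _ _ _ (fun x => \sum_(p <- l) p.1 * (\1_(a p.2 @` B) x * u x))).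
  rewrite expect_sum; last by move=> p; exact: bmfZ.
  rewrite -[RHS]mul1r -l1 mulr_suml; apply: eq_bigr => p _.
  rewrite expectZ//; congr (_ * _); rewrite -(expect_act p.2)//.
  apply: eq_expect => x /=; rewrite iu !indicE; congr (_%:R * _); congr nat_of_bool.
  by apply/idP/idP; rewrite !inE act_imageE /preimage/= mpactK.
by move=> x; rewrite /average mulr_suml; apply: eq_bigr => p _; rewrite mulrA.
Qed.

(** The convex combinations of translates of the indicator of B that nearly
    minimize the L2 norm form, by the parallelogram law, a Cauchy sequence
    which is asymptotically invariant; its limit plays the role of the
    conditional expectation of B on the invariant sets. The limit is taken
    pointwise, and made invariant everywhere by a supremum over the group. *)
Lemma mean_ergodic B : countable [set: G] -> measurable B ->
  exists f : Y -> R,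
    [/\ measurable_fun setT f, forall x, 0 <= f x <= 1, invariant_fun f,
        forall u, bmf u -> invariant_fun u ->
          expect nu (fun x => \1_B x * u x) = expect nu (fun x => f x * u x)
      & forall e, 0 < e -> exists2 l, convex_weights l &
          expect nu (fun x => (average l B x - f x) ^+ 2) <= e].
Proof.
move=> hG mB.
pose S := [set energy l B | l in convex_weights].
have S0 : S !=set0.
  exists (energy [:: (1, 1%g)] B), [:: (1, 1%g)] => //; split.
    by move=> p; rewrite inE => /eqP ->.
  by rewrite big_seq1.
have energy_ge0 l : 0 <= energy l B by apply: expect_ge0 => x; exact: sqr_ge0.
have infS : has_inf S by split => //; exists 0 => _ [l _ <-].
have le_inf l : convex_weights l -> inf S <= energy l B.
  by move=> cl; apply: ge_inf; [exact: infS.2|exists l].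
have near_inf n : exists l, convex_weights l /\ energy l B < inf S + 16 ^- n / 16.
  have e0 : 0 < 16 ^- n / 16 :> R by rewrite divr_gt0// invr_gt0 exprn_gt0.
  by have [_ [l cl <-] ?] := inf_adherent e0 infS; exists l.
(* by the parallelogram law the squared L2 distance is at most twice the sum
   of the two excesses over the infimum; they are chosen so that its square
   root is summable over n *)
have [l /all_and2[cl lS]] := choice near_inf.
have bA l' : bmf (average l' B) by exact: bmf_average.
have close n l' : convex_weights l' -> energy l' B < inf S + 16 ^- n / 16 ->
    expect nu (fun x => `|average (l n) B x - average l' B x|) <= 1 / 2 ^+ n.
  move=> cl' l'S; apply: expect_norm_le; first exact: bmfB.
    by rewrite divr_ge0// exprn_ge0.
  rewrite parallelogram//; have := lS n.
  have := le_inf _ (convex_midpoint (cl n) cl').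
  have : 16 ^- n <= (1 / 2 ^+ n) ^+ 2 :> R.
    rewrite mul1r exprVn -exprM mulnC exprM lef_pV2 ?posrE ?exprn_gt0//.
    by rewrite lerXn2r ?nnegrE//; lra.
  have : 0 <= 16 ^- n :> R by rewrite invr_ge0 exprn_ge0.
  lra.
pose f n := average (l n) B.
have cauchy_ae : {ae nu, forall x, cvgn (series (fun n => `|f n x - f n.+1 x|))}.
  apply: (@ae_summable _ _ _ _ (fun n x => `|f n x - f n.+1 x|) 1).
  - by move=> n; exact: (bmf_norm (bmfB (bA _) (bA _))).
  - by [].
  - move=> n; apply: close => //; apply: lt_le_trans (lS _) _.
    rewrite lerD2l ler_wpM2r// lef_pV2 ?posrE ?exprn_gt0//.
    by rewrite ler_weXn2l//; lra.
have inv_ae : {ae nu, forall x, forall g,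
    cvgn (series (fun n => `|f n x - f n (a g x)|))}.
  apply: ae_countable => // g.
  apply: (@ae_summable _ _ _ _ (fun n x => `|f n x - f n (a g x)|) 1).
  - by move=> n; exact: (bmf_norm (bmfB (bA _) (bmf_act g (bA _)))).
  - by [].
  - move=> n; rewrite (@eq_expect _ _ _ _ _
      (fun x => `|average (l n) B x - average (translate g^-1%g (l n)) B x|)).
      apply: close; first exact: convex_translate.
      by rewrite energy_translate.
    by move=> x; rewrite average_translate invgK.
have f01 n x : 0 <= f n x <= 1 by apply: average_itv.
have ub_f x : has_ubound (range (f ^~ x)).
  by exists 1 => _ [n _ <-]; have /andP[] := f01 n x.
have lb_f x : has_lbound (range (f ^~ x)).
  by exists 0 => _ [n _ <-]; have /andP[] := f01 n x.
have bd_f x : bounded_fun (f ^~ x).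
  exists 1; split => // r /ltW r1 n _ /=; apply: le_trans r1.
  by rewrite ger0_norm; have /andP[] := f01 n x.
(* the limit, where it exists; it is invariant almost everywhere *)
pose L x := limn_sup (f ^~ x).
have sups0 x : sups (f ^~ x) 0%N <= 1.
  apply: ge_sup; first by exists (f 0%N x), 0%N.
  by move=> _ [k _ <-]; have /andP[] := f01 k x.
have sups_ge0 x n : 0 <= sups (f ^~ x) n.
  apply: (@le_trans _ _ (f n x)); first by have /andP[] := f01 n x.
  by apply: ub_le_sup; [exact: has_ubound_sdrop|exists n => /=].
have L01 x : 0 <= L x <= 1.
  rewrite /L limn_supE//; apply/andP; split.
    apply: lb_le_inf; first by exists (sups (f ^~ x) 0%N), 0%N.
    by move=> _ [n _ <-].
  apply: le_trans (sups0 x); apply: ge_inf; last by exists 0%N.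
  by exists 0 => _ [n _ <-].
have mL : measurable_fun setT L.
  by apply: measurable_fun_limn_sup => // n; exact: (bA (l n)).1.
have ubL x : has_ubound (range (fun g => L (a g x))).
  by exists 1 => _ [g _ <-]; have /andP[] := L01 (a g x).
pose F x := sup (range (fun g => L (a g x))).
have [en enP] := countable_enum hG.
have FE : F = (fun x => sups (fun n => L (a (en n) x)) 0%N).
  apply/funext => x; rewrite /F /sups /=; congr sup; apply/seteqP; split.
    by move=> _ [g _ <-]; have [n <-] := enP g; exists n.
  by move=> _ [n _ <-]; exists (en n).
have mF : measurable_fun setT F.
  rewrite FE; apply: (@measurable_fun_sups _ _ _ _ (fun n x => L (a (en n) x))).
    by move=> x _; exists 1 => _ [n _ <-]; have /andP[] := L01 (a (en n) x).
  by move=> n; apply: measurableT_comp => //; exact: measurable_act.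
have F01 x : 0 <= F x <= 1.
  apply/andP; split.
    apply: (@le_trans _ _ (L (a 1%g x))); first by have /andP[] := L01 (a 1%g x).
    by apply: ub_le_sup => //; exists 1%g.
  apply: ge_sup; first by exists (L (a 1%g x)), 1%g.
  by move=> _ [g _ <-]; have /andP[] := L01 (a g x).
have iF : invariant_fun F.
  move=> g x; rewrite /F; congr sup; apply/seteqP; split => _ [h _ <-].
    by exists (h * g)%g; rewrite ?mpactM.
  by exists (h * g^-1)%g; rewrite // -mpactM -mulgA mulVg mulg1.
have fF : {ae nu, forall x, f n x @[n --> \oo] --> F x}.
  apply: filterS2 cauchy_ae inv_ae => x cx ix.
  have cf : cvgn (f ^~ x).
    have : cvgn (series (fun n => f n.+1 x - f n x)).
      apply: normed_cvg.
      have eq_cx : (fun n => `|f n x - f n.+1 x|) = (fun n => `|f n.+1 x - f n x|).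
        by apply/funext => n; rewrite distrC.
      by rewrite eq_cx in cx.
    move=> cs; have : cvgn (fun n => f 0%N x + series (fun n => f n.+1 x - f n x) n).
      by apply: is_cvgD => //; exact: is_cvg_cst.
    set v := (X in cvgn X); suff -> : v = f ^~ x by [].
    apply/funext => n; rewrite /v.
    by rewrite /series/= telescope_sumr// addrC subrK.
  have Lg g : L (a g x) = limn (f ^~ x).
    have cg : f n (a g x) @[n --> \oo] --> limn (f ^~ x).
      have := cvg_series_cvg_0 (ix g); move/norm_cvg0P => d0.
      rewrite (_ : (fun n => _) = (fun n => f n x - (f n x - f n (a g x)))).
        by rewrite -[limn _]subr0; exact: cvgB.
      by apply/funext => n; ring.
    by rewrite /L (cvg_limn_inf_sup cg).2.
  suff -> : F x = limn (f ^~ x) by [].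
  rewrite -[RHS]sup1; congr sup.
  by apply/seteqP; split=> [_ [g _ <-]|_ ->]; [exact: Lg|exists 1%g].
have bF : bmf F by split => //; exists 1 => x; rewrite ger0_norm; have /andP[] := F01 x.
have err n x : `|f n x - F x| <= 1.
  by have := F01 x; have := f01 n x; rewrite ler_norml; lra.
exists F; split => // [u bu iu|e e0].
  have [_ [M uM]] := bu.
  have cv : expect nu (fun x => f n x * u x) @[n --> \oo] --> expect nu (fun x => F x * u x).
    apply: (@expect_cvg _ _ _ _ (fun n x => f n x * u x) _ M).
    - by move=> n; exact: (bmfM (bA _) bu).1.
    - exact: (bmfM bF bu).1.
    - move=> n x; rewrite normrM -[leRHS]mul1r ler_pM//.
      by rewrite ger0_norm; have /andP[] := f01 n x.
    - by apply: filterS fF => x fx; apply: cvgM => //; exact: cvg_cst.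
  have : expect nu (fun x => f n x * u x) @[n --> \oo] --> expect nu (fun x => \1_B x * u x).
    rewrite (_ : (fun n => _) = cst (expect nu (fun x => \1_B x * u x))); first exact: cvg_cst.
    by apply/funext => n; rewrite /f expect_average_inv.
  by move=> cv'; rewrite -(cvg_lim (@Rhausdorff R) cv) -(cvg_lim (@Rhausdorff R) cv').
have cv : expect nu (fun x => (f n x - F x) ^+ 2) @[n --> \oo] --> expect nu (fun=> 0).
  apply: (@expect_cvg _ _ _ _ (fun n x => (f n x - F x) ^+ 2) _ 1).
  - by move=> n; exact: (bmfX2 (bmfB (bA _) bF)).1.
  - by [].
  - by move=> n x; rewrite normrX expr_le1.
  - apply: filterS fF => x fx.
    have -> : 0 = (F x - F x) ^+ 2 by rewrite subrr expr0n.
    by apply: cvgM; apply: cvgB => //; exact: cvg_cst.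
rewrite expect_cst in cv.
have [n _ /(_ n (leqnn n))/= ne] := (cvgr_le _ cv) e e0.
by exists (l n).
Qed.

End mean_ergodic.

(** * Classes of ergodic actions are extreme *)

Section quadratic_form.
Context (G : groupType) (R : realType) (d : measure_display).
Context (Y : measurableType d) (nu : probability Y R) (a : mpaction G nu).
Implicit Types (B C : set Y) (l : seq (R * G)) (f u : Y -> R).

(** The mean square distance of the average from the constant r, as [dispersionE]
    shows; this form in terms of correlations can be compared between actions. *)
Definition dispersion l (r : R) B : R :=
  \sum_(p <- l) \sum_(q <- l) p.1 * q.1 * corr a (q.2^-1 * p.2)%g B B
  - 2 * r * corr a 1%g B B + r ^+ 2.

Lemma corr_translates g h B B' : measurable B -> measurable B' ->
  pr nu (a g @` B `&` a h @` B') = corr a (h^-1 * g)%g B B'.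
Proof.
move=> mB mB'; rewrite /corr -(pr_act_preimage a h); last first.
  by apply: measurableI; exact: measurable_act_image.
congr (pr nu _); rewrite !act_imageE; apply/seteqP; split => x;
  by rewrite /preimage/= mpactK invgM invgK mpactM.
Qed.

Lemma dispersionE l r B : convex_weights l -> measurable B ->
  expect nu (fun x => (average a l B x - r) ^+ 2) = dispersion l r B.
Proof.
move=> [l0 l1] mB.
have bg g : bmf (\1_(a g @` B) : Y -> R) by apply/bmf_indic/measurable_act_image.
have bA := bmf_average a l mB.
rewrite (@eq_expect _ _ _ _ _ (fun x => (\sum_(p <- l) \sum_(q <- l)
    p.1 * q.1 * \1_(a p.2 @` B `&` a q.2 @` B) x - 2 * r * average a l B x)
    + r ^+ 2)); last first.
  move=> x.
  have -> : \sum_(p <- l) \sum_(q <- l) p.1 * q.1 * \1_(a p.2 @` B `&` a q.2 @` B) x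
     = average a l B x * average a l B x.
    rewrite /average mulr_suml; apply: eq_bigr => p _.
    rewrite mulr_sumr; apply: eq_bigr => q _.
    by rewrite indicI/=; ring.
  by ring.
have bI g h : bmf (\1_(a g @` B `&` a h @` B) : Y -> R).
  by apply: bmf_indic; apply: measurableI; exact: measurable_act_image.
have bS p : bmf (fun x => \sum_(q <- l) p.1 * q.1 * \1_(a p.2 @` B `&` a q.2 @` B) x).
  by apply: bmf_sum => q; exact: bmfZ.
rewrite expectD ?expect_cst; [|by apply: bmfB (bmfZ _ bA); exact: bmf_sum|exact: bmf_cst].
rewrite expectB; [|exact: bmf_sum|exact: bmfZ].
rewrite expectZ// expect_sum// /dispersion; congr (_ - _ * _ + _).
  apply: eq_bigr => p _; rewrite expect_sum; last by move=> q; exact: bmfZ.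
  apply: eq_bigr => q _; rewrite expectZ// expect_indic; last first.
    by apply: measurableI; exact: measurable_act_image.
  by rewrite corr_translates.
rewrite corr1 expect_sum; last by move=> p; exact: bmfZ.
rewrite -[RHS]mul1r -l1 mulr_suml; apply: eq_bigr => p _.
by rewrite expectZ// expect_indic ?pr_act_image//; exact: measurable_act_image.
Qed.

Lemma dispersion_ge l r B : convex_weights l -> measurable B ->
  (pr nu B - r) ^+ 2 <= dispersion l r B.
Proof.
move=> cl mB; rewrite -dispersionE//.
have bA := bmf_average a l mB.
have -> : pr nu B - r = expect nu (fun x => average a l B x - r).
  rewrite expectB//; last exact: bmf_cst.
  rewrite expect_cst; congr (_ - _).
  have h := @expect_average_inv _ _ _ _ nu a l B _ cl mB (bmf_cst Y 1) (fun g x => erefl).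
  rewrite -expect_indic//; transitivity (expect nu (fun x => \1_B x * 1)).
    by apply: eq_expect => x; rewrite mulr1.
  by rewrite -h; apply: eq_expect => x; rewrite mulr1.
by apply: expect_sqr_ge; apply: bmfB => //; exact: bmf_cst.
Qed.

Lemma dispersion_ge0 l r B : convex_weights l -> measurable B -> 0 <= dispersion l r B.
Proof. by move=> cl mB; apply: le_trans (dispersion_ge r cl mB); exact: sqr_ge0. Qed.

Lemma invariant_image C : invariant_set a C ->
  forall g, a g @` C = C.
Proof.
by move=> iC g; rewrite act_imageE; apply/seteqP; split=> x /=; rewrite /preimage/= iC.
Qed.

(** For an ergodic action the limit in the mean ergodic theorem is constant:
    its upper and lower level sets are invariant. *)
Lemma ergodic_dispersion B e : countable [set: G] -> ergodic a -> measurable B ->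
  0 < e -> exists2 l, convex_weights l & dispersion l (pr nu B) B <= e.
Proof.
move=> hG erg mB e0; set r := pr nu B.
have [f [mf f01 iF fu fl]] := mean_ergodic a hG mB.
have bf : bmf f by split => //; exists 1 => x; rewrite ger0_norm; have /andP[] := f01 x.
have Ef : expect nu f = r.
  have h := fu _ (bmf_cst Y 1) (fun g x => erefl).
  rewrite /r -expect_indic//; transitivity (expect nu (fun x => f x * 1)).
    by apply: eq_expect => x; rewrite mulr1.
  by rewrite -h; apply: eq_expect => x; rewrite mulr1.
have /andP[r0 r1] : 0 <= r <= 1 by rewrite pr_ge0 pr_le1.
pose s := Num.min 1 (e / 8).
have s0 : 0 < s by rewrite /s lt_min ltr01 divr_gt0.
have s1 : s <= 1 by rewrite /s ge_min lexx.
have se : s <= e / 8 by rewrite /s ge_min lexx orbT.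
pose C1 := [set x | r + s <= f x].
pose C2 := [set x | f x <= r - s].
have mC1 : measurable C1 by exact: measurable_ge.
have mC2 : measurable C2 by exact: measurable_le.
have bC1 : bmf (\1_C1 : Y -> R) := bmf_indic _ mC1.
have bC2 : bmf (\1_C2 : Y -> R) := bmf_indic _ mC2.
have C1null : pr nu C1 = 0.
  have [|C10|C11] := erg C1 mC1; last 2 first.
  - by rewrite /pr C10.
  - have : expect nu (fun x => (r + s) * \1_C1 x) <= expect nu f.
      apply: le_expect => // [|x]; first exact: bmfZ.
      rewrite indicE; have [|_] := boolP (x \in C1); first by rewrite inE mulr1.
      by rewrite mulr0; have /andP[] := f01 x.
    by rewrite expectZ// expect_indic// Ef /pr C11/=; lra.
  - by apply: invariant_image => g x; rewrite /C1/= iF.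
have C2null : pr nu C2 = 0.
  have [|C20|C21] := erg C2 mC2; last 2 first.
  - by rewrite /pr C20.
  - have : expect nu f <= expect nu (fun x => 1 - (1 - (r - s)) * \1_C2 x).
      apply: le_expect => // [|x]; first by apply: bmfB (bmf_cst _ _) (bmfZ _ bC2).
      rewrite indicE; have [|_] := boolP (x \in C2); first by rewrite inE /C2/=; lra.
      by rewrite mulr0 subr0; have /andP[] := f01 x.
    rewrite expectB; [|exact: bmf_cst|exact: bmfZ].
    by rewrite expectZ// expect_indic// expect_cst Ef /pr C21/=; lra.
  - by apply: invariant_image => g x; rewrite /C2/= iF.
have e80 : 0 < e / 8 by rewrite divr_gt0.
have [l cl le] := fl _ e80.
exists l => //; rewrite -dispersionE//.
have bA := bmf_average a l mB.
have bAf : bmf (fun x => (average a l B x - f x) ^+ 2) by apply/bmfX2/bmfB.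
apply: (@le_trans _ _ (expect nu (fun x => 2 * (average a l B x - f x) ^+ 2 +
    (2 * s ^+ 2 + (2 * \1_C1 x + 2 * \1_C2 x))))).
  apply: le_expect.
  - by apply: bmfX2; apply: bmfB => //; exact: bmf_cst.
  - apply: bmfD; first exact: bmfZ.
    by apply: bmfD; [exact: bmf_cst|apply: bmfD; exact: bmfZ].
  - move=> x; set y := average a l B x; rewrite -/y.
    have h : (f x - r) ^+ 2 <= s ^+ 2 + (\1_C1 x + \1_C2 x).
      have /andP[f0 f1] := f01 x; rewrite !indicE.
      case: (boolP (x \in C1)) => [_|nC1].
        by case: (boolP (x \in C2)) => [_|_]; rewrite /= ?addr0 ?add0r; nra.
      case: (boolP (x \in C2)) => [_|nC2]; first by rewrite /= add0r; nra.
      move: nC1 nC2; rewrite !notin_setE /C1 /C2/= => /negP + /negP.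
      by rewrite -!ltNge !addr0 => h1 h2; nra.
    have : (y - r) ^+ 2 <= 2 * (y - f x) ^+ 2 + 2 * (f x - r) ^+ 2.
      rewrite -subr_ge0.
      have -> : 2 * (y - f x) ^+ 2 + 2 * (f x - r) ^+ 2 - (y - r) ^+ 2 =
        ((y - f x) - (f x - r)) ^+ 2 by ring.
      exact: sqr_ge0.
    by lra.
rewrite expectD; [|exact: bmfZ|by apply: bmfD; [exact: bmf_cst|apply: bmfD; exact: bmfZ]].
rewrite expectD; [|exact: bmf_cst|by apply: bmfD; exact: bmfZ].
rewrite expectD; [|exact: bmfZ|exact: bmfZ].
rewrite (expectZ nu 2 bAf) (expectZ nu 2 bC1) (expectZ nu 2 bC2).
rewrite !expect_indic// C1null C2null expect_cst.
have : s ^+ 2 <= e / 8 by rewrite expr2; nra.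
by lra.
Qed.

End quadratic_form.

Section dispersion_of_sums.
Context (G : groupType) (R : realType) (n : nat) (d : measure_display).
Context (Y : 'I_n.+1 -> measurableType d) (nu : forall i, probability (Y i) R).
Context (w : weights R n) (a : forall i, mpaction G (nu i)).

Lemma dispersion_sum l r B : measurable B ->
  dispersion (sum_action w a) l r B = \sum_i w i * dispersion (a i) l r (slice i B).
Proof.
move=> mB; rewrite /dispersion.
under [RHS]eq_bigr do rewrite mulrDr mulrBr.
rewrite big_split/= sumrB -mulr_suml weight_sum1 mul1r; congr (_ - _ + _).
  under eq_bigr do under eq_bigr do rewrite corr_sum// mulr_sumr.
  under eq_bigr do rewrite exchange_big/=.
  rewrite exchange_big/=; apply: eq_bigr => i _; rewrite mulr_sumr.
  apply: eq_bigr => p _; rewrite mulr_sumr; apply: eq_bigr => q _; ring.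
by rewrite corr_sum// mulr_sumr; apply: eq_bigr => i _; ring.
Qed.

End dispersion_of_sums.

(** The sets [U & V] and Q nearly agree as soon as the measures of these two sets
    and of [U & Q] and [V & Q] are all nearly r: this is visible in correlations,
    although [U & V] is not itself one of the sets correlated. *)
Lemma symdiff_meet (R : realType) (d : measure_display) (Y : measurableType d)
    (nu : probability Y R) (U V Q : set Y) (r eta : R) :
  measurable U -> measurable V -> measurable Q ->
  pr nu (U `&` V) <= r + eta -> pr nu Q <= r + eta -> r - eta <= pr nu Q ->
  r - eta <= pr nu (U `&` Q) -> r - eta <= pr nu (V `&` Q) ->
  pr nu ((U `&` V) `\` Q) + pr nu (Q `\` (U `&` V)) <= 8 * eta.
Proof.
move=> mU mV mQ hP hQ hQ' hU hV; have mUV := measurableI _ _ mU mV.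
have eU := pr_setID nu mQ mU; rewrite setIC in eU.
have eV := pr_setID nu mQ mV; rewrite setIC in eV.
have e1 := pr_setID nu mUV mQ.
have e2 := pr_setID nu mQ mUV; rewrite setIC in e2.
have : pr nu (Q `\` (U `&` V)) <= pr nu (Q `\` U) + pr nu (Q `\` V).
  have m1 := measurableD mQ mUV; have m2 := measurableD mQ mU.
  rewrite (pr_setID nu m1 m2); apply: lerD; apply: le_pr => //.
  - exact: measurableI.
  - exact: measurableD.
  - exact: measurableD.
  - move=> x [[Qx nUV] nQU]; split => // Vx; apply: nUV; split => //.
    by apply: contrapT => nU; apply: nQU.
by lra.
Qed.

(** Some sets in copies of the sum have nearly the correlations of the sets A_i
    together with the sets D = gA_i & A_j. Their traces in the copies of the
    summand at i0 have nearly the correlations of the A_i as well, provided that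
    the trace of the set coming from D has nearly the measure of D, and nearly
    agrees with the trace of the set gA_i & A_j formed from those coming from the
    A_i. For the first, some average of translates of D is nearly constant by
    [ergodic_dispersion], and the dispersion in the summand is at most the one
    in the sum divided by the weight. The second is [symdiff_meet]. *)
Lemma ergodic_supp_le (G : groupType) (R : realType) (d d' : measure_display)
    (n : nat) (Y : 'I_n.+1 -> measurableType d) (nu : forall i, probability (Y i) R)
    (w : weights R n) (a : forall i, mpaction G (nu i)) (i0 : 'I_n.+1)
    (Z : measurableType d') (zeta : probability Z R) (e : mpaction G zeta) :
  countable [set: G] -> ergodic e -> 0 < w i0 ->
  stable_weak_contained e (sum_action w a) ->
  forall k (phi : test G R k), supp e phi <= supp (a i0) phi.
Proof.
move=> hG erg w0 esum k phi; apply: supp_le => A mA.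
apply/ler_addgt0Pr => eps eps0.
(* delta bounds the errors of correlations in the summand, and eta those in the
   sum; eta carries the weight of the summand, because errors in the sum are
   divided by it, and delta squared, because dispersions are squares *)
pose delta := eps / (test_norm phi + 1).
have N0 : 0 < test_norm phi + 1 by rewrite ltr_wpDl// test_norm_ge0.
have delta0 : 0 < delta by rewrite divr_gt0.
pose eta := w i0 * Num.min (delta ^+ 2 / 16) (delta / 16).
have eta0 : 0 < eta.
  by rewrite mulr_gt0// lt_min !divr_gt0// exprn_gt0.
have eta1 : eta <= w i0 * (delta ^+ 2 / 16).
  by apply: ler_wpM2l; [exact: ltW|rewrite ge_min lexx].
have eta2 : eta <= w i0 * (delta / 16).
  by apply: ler_wpM2l; [exact: ltW|rewrite ge_min lexx orbT].
pose p j := tnth (in_tuple phi) j.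
pose D j := e (p j).1.1.2 @` A (p j).1.2 `&` A (p j).2.
have mD j : measurable (D j) by exact: measurable_corr.
have /choice[l lP] : forall j, exists l,
    convex_weights l /\ dispersion e l (pr zeta (D j)) (D j) <= eta.
  by move=> j; have [l ? ?] := ergodic_dispersion hG erg (mD j) eta0; exists l.
have cl j := (lP j).1; have lD j := (lP j).2.
(* the sets A_i, followed by the sets D_j *)
pose T (s : 'I_(k + size phi)) :=
  match fintype.split s with inl i => A i | inr j => D j end.
have mT s : measurable (T s) by rewrite /T; case: fintype.split.
have TA i : T (lshift _ i) = A i by rewrite /T (unsplitK (inl i)).
have TD j : T (rshift _ j) = D j by rewrite /T (unsplitK (inr j)).
pose Fs := 1%g :: [seq q.1.1.2 | q <- phi] ++
  flatten [seq [seq (q.2^-1 * q'.2)%g | q' <- l j, q <- l j] | j <- enum 'I_(size phi)].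
have [m [v [B [v0 mB TB]]]] := esum _ T [set` Fs] eta mT (finite_seq _) eta0.
pose c := sum_action v (fun=> sum_action w a).
have {}TB g s s' : g \in Fs -> `|corr e g (T s) (T s') - corr c g (B s) (B s')| < eta.
  by move=> gF; exact: (TB g s s' gF).
pose b := sum_action v (fun=> a i0).
(* the trace of S on the copies of the summand at i0 *)
pose comp (S : set (dunion (fun _ : 'I_m.+1 => dunion Y))) : set (dunion (fun _ : 'I_m.+1 => Y i0)) :=
  [set x | S (existT _ (projT1 x) (existT Y i0 (projT2 x)))].
have mcomp S : measurable S -> measurable (comp S).
  by move=> mS; apply/measurable_dunionP => i; exact: mS.
have comp_corr g S S' : comp (c g @` S `&` S') = b g @` comp S `&` comp S'.
  by rewrite !act_imageE.
have pr_comp S : measurable S ->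
    w i0 * pr (dunion_measure (fun=> nu i0) v) (comp S) <=
    pr (dunion_measure (fun=> dunion_measure nu w) v) S.
  move=> mS; rewrite !pr_sum//; last exact: mcomp.
  rewrite mulr_sumr; apply: ler_sum => i _.
  rewrite pr_sum; last exact: mS.
  rewrite mulrCA ler_wpM2l ?weight_ge0// (bigD1 i0)//= lerDl.
  by apply: sumr_ge0 => i' _; rewrite mulr_ge0 ?weight_ge0// pr_ge0.
have var_comp j S : measurable S ->
    w i0 * dispersion b (l j) (pr zeta (D j)) (comp S) <=
    dispersion c (l j) (pr zeta (D j)) S.
  move=> mS; rewrite !dispersion_sum//; last exact: mcomp.
  rewrite mulr_sumr; apply: ler_sum => i _.
  rewrite dispersion_sum; last exact: mS.
  rewrite mulrCA ler_wpM2l ?weight_ge0// (bigD1 i0)//= lerDl.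
  apply: sumr_ge0 => i' _; rewrite mulr_ge0 ?weight_ge0// dispersion_ge0//.
  exact: mS.
have F1 : 1%g \in Fs by rewrite inE eqxx.
have Fp j : (p j).1.1.2 \in Fs.
  rewrite inE mem_cat; apply/orP; right; apply/orP; left.
  by apply/mapP; exists (p j) => //; exact: mem_tnth.
have Fl j q q' : q \in l j -> q' \in l j -> (q'.2^-1 * q.2)%g \in Fs.
  move=> ql q'l; rewrite inE mem_cat; apply/orP; right; apply/orP; right.
  apply/flattenP; exists [seq (q.2^-1 * q'.2)%g | q' <- l j, q <- l j].
    by apply/mapP; exists j; rewrite ?mem_enum.
  by apply/allpairsP; exists (q, q').
pose r j := pr zeta (D j).
have r01 j : 0 <= r j <= 1 by rewrite pr_ge0 pr_le1.
pose BA i := B (lshift _ i); pose BD j := B (rshift _ j).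
have mBA i : measurable (BA i) by exact: mB.
have mBD j : measurable (BD j) by exact: mB.
pose nuc := dunion_measure (fun _ : 'I_m.+1 => dunion_measure nu w) v.
pose nub := dunion_measure (fun _ : 'I_m.+1 => nu i0) v.
have varBD j : dispersion c (l j) (r j) (BD j) <= 4 * eta.
  have [l0 l1] := cl j.
  suff : dispersion c (l j) (r j) (BD j) - dispersion e (l j) (r j) (D j) <= 3 * eta.
    by have := lD j; rewrite -/(r j); lra.
  have -> : dispersion c (l j) (r j) (BD j) - dispersion e (l j) (r j) (D j) =
     \sum_(p <- l j) \sum_(q <- l j) p.1 * q.1 *
       (corr c (q.2^-1 * p.2)%g (BD j) (BD j) - corr e (q.2^-1 * p.2)%g (D j) (D j))
     + 2 * r j * (corr e 1%g (D j) (D j) - corr c 1%g (BD j) (BD j)).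
    rewrite /dispersion.
    under [X in _ = X + _]eq_bigr do under eq_bigr do rewrite mulrBr.
    under [X in _ = X + _]eq_bigr do rewrite sumrB.
    by rewrite sumrB; ring.
  have h1 := TB 1%g (rshift _ j) (rshift _ j) F1.
  rewrite TD -/(BD j) in h1.
  have h2 : \sum_(p <- l j) \sum_(q <- l j) p.1 * q.1 *
       (corr c (q.2^-1 * p.2)%g (BD j) (BD j) - corr e (q.2^-1 * p.2)%g (D j) (D j))
     <= \sum_(p <- l j) \sum_(q <- l j) p.1 * q.1 * eta.
    rewrite big_seq [leRHS]big_seq; apply: ler_sum => q ql.
    rewrite big_seq [leRHS]big_seq; apply: ler_sum => q' q'l.
    apply: ler_wpM2l; first by rewrite mulr_ge0 ?l0.
    have := TB _ (rshift _ j) (rshift _ j) (Fl _ _ _ ql q'l).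
    by rewrite TD -/(BD j) distrC => /ltW; apply: le_trans; exact: ler_norm.
  have h3 : \sum_(p <- l j) \sum_(q <- l j) p.1 * q.1 * eta = eta.
    under eq_bigr do under eq_bigr do rewrite -mulrA.
    under eq_bigr do rewrite -mulr_sumr -mulr_suml l1 mul1r.
    by rewrite -mulr_suml l1 mul1r.
  rewrite h3 in h2; have /andP[r0 r1] := r01 j.
  by move: h1; rewrite ltr_norml => /andP[h11 h12]; nra.
have prBD j : `|pr nub (comp (BD j)) - r j| <= delta / 2.
  have d20 : 0 <= delta / 2 by rewrite divr_ge0// ltW.
  rewrite -(ler_pXn2r (n := 2))// -normrX ger0_norm ?sqr_ge0//.
  apply: le_trans (dispersion_ge b (r j) (cl j) (mcomp _ (mBD j))) _.
  rewrite -(ler_pM2l w0); apply: le_trans (var_comp j _ (mBD j)) _.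
  by apply: le_trans (varBD j) _; lra.
pose P j := c (p j).1.1.2 @` BA (p j).1.2 `&` BA (p j).2.
have mP j : measurable (P j) by exact: measurable_corr.
have symdiff j : pr nuc (P j `\` BD j) + pr nuc (BD j `\` P j) <= 8 * eta.
  have hP : pr nuc (P j) <= r j + eta.
    have := TB _ (lshift _ (p j).1.2) (lshift _ (p j).2) (Fp j).
    rewrite !TA -/(BA _) -/(BA _) distrC => /ltW /(le_trans (ler_norm _)).
    by rewrite lerBlDr addrC.
  have hD : pr nuc (BD j) <= r j + eta.
    have := TB _ (rshift _ j) (rshift _ j) F1.
    by rewrite TD -/(BD j) !corr1 distrC => /ltW /(le_trans (ler_norm _)); rewrite lerBlDr addrC.
  have hD' : r j - eta <= pr nuc (BD j).
    have := TB _ (rshift _ j) (rshift _ j) F1.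
    by rewrite TD -/(BD j) !corr1 => /ltW /(le_trans (ler_norm _)); rewrite lerBlDl -lerBlDr.
  pose g := (p j).1.1.2.
  have h1 : r j - eta <= pr nuc (c g @` BA (p j).1.2 `&` BD j).
    have := TB _ (lshift _ (p j).1.2) (rshift _ j) (Fp j).
    rewrite TA TD -/(BA _) -/(BD _) => /ltW /(le_trans (ler_norm _)).
    rewrite /corr (_ : _ `&` D j = D j); first by rewrite lerBlDl -lerBlDr.
    by apply/seteqP; split=> x; rewrite /D => -[]//; split.
  have h2 : r j - eta <= pr nuc (BA (p j).2 `&` BD j).
    have := TB _ (lshift _ (p j).2) (rshift _ j) F1.
    rewrite TA TD -/(BA _) -/(BD _) => /ltW /(le_trans (ler_norm _)).
    rewrite /corr !act_image1 (_ : _ `&` D j = D j); last first.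
      by apply/seteqP; split=> x; rewrite /D => -[]//; split.
    by rewrite lerBlDl -lerBlDr.
  apply: (symdiff_meet _ _ _ hP hD hD' h1 h2) => //; exact: measurable_act_image.
have corr_b j : `|corr b (p j).1.1.2 (comp (BA (p j).1.2)) (comp (BA (p j).2)) - r j| <= delta.
  rewrite /corr -comp_corr -/(P j) -/nub.
  have h1 : `|pr nub (comp (P j)) - pr nub (comp (BD j))| <= delta / 2.
    apply: le_trans (pr_diff_le _ (mcomp _ (mP j)) (mcomp _ (mBD j))) _.
    rewrite -(ler_pM2l w0) mulrDr.
    have m1 : measurable (P j `\` BD j) by exact: measurableD.
    have m2 : measurable (BD j `\` P j) by exact: measurableD.
    apply: le_trans (lerD (pr_comp _ m1) (pr_comp _ m2)) _.
    by apply: le_trans (symdiff j) _; lra.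
  have := prBD j; have := ler_normD (pr nub (comp (P j)) - pr nub (comp (BD j)))
    (pr nub (comp (BD j)) - r j).
  by rewrite addrA subrK; lra.
have leb : pairing b phi (fun i => comp (BA i)) <= supp (a i0) phi.
  rewrite pairing_sum; last by move=> i; exact: mcomp.
  rewrite -[leRHS]mul1r -(weight_sum1 v) mulr_suml.
  apply: ler_sum => i _; apply: ler_wpM2l; first exact: weight_ge0.
  by apply: pairing_le_supp => j; exact: (mcomp _ (mBA j) i).
apply: (@le_trans _ _ (pairing b phi (fun i => comp (BA i)) + delta * test_norm phi)).
  apply: pairing_close => q /seq_tnthP[j ->]; rewrite distrC.
  exact: corr_b.
apply: lerD => //; rewrite /delta mulrAC ler_pdivrMr//.
by rewrite ler_wpM2l ?lerDl// ltW.
Qed.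

(** * Isomorphism of standard probability spaces *)

Lemma image_probability (R : realType) (d1 d2 : measure_display)
    (Y1 : measurableType d1) (nu1 : probability Y1 R) (Y2 : measurableType d2)
    (f : Y1 -> Y2) : measurable_fun setT f ->
  exists m : probability Y2 R, measure_preserving nu1 m f.
Proof.
move=> mf; pose X : {mfun Y1 >-> Y2} := HB.pack f (isMeasurableFun.Build _ _ _ _ f mf).
by exists (distribution nu1 X); split.
Qed.

(** The ternary digits of the function, 0 or 2, are given by the indicators of the
    sets. As z |-> 3z or 3z - 2 shifts the digits of z, each digit is a Borel
    function of z. *)
Lemma ternary_code (R : realType) (d : measure_display) (X : measurableType d)
    (V : nat -> set X) : (forall k, measurable (V k)) ->
  exists2 i : X -> R, measurable_fun setT i &
    forall k, exists2 S : set R, measurable S & V k = i @^-1` S.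
Proof.
move=> mV.
pose u k j x : R := 2 * \1_(V (k + j)%N) x / 3 ^+ j.+1.
have u0 k j x : 0 <= u k j x.
  by rewrite /u divr_ge0 ?exprn_ge0// mulr_ge0// indicE.
have ule k j x : u k j x <= 2 / 3 ^+ j.+1.
  rewrite /u ler_wpM2r ?invr_ge0 ?exprn_ge0// ler_piMr// indicE lern1 leq_b1//.
have sum_le k n x : series (fun j => u k j x) n <= 1 - 1 / 3 ^+ n.
  elim: n => [|n IH]; first by rewrite /series/= big_geq// expr0; lra.
  rewrite seriesSr; apply: (le_trans (lerD IH (ule k n x))).
  have h : 3 ^+ n != 0 :> R by rewrite expf_neq0//; lra.
  suff -> : (1 : R) - 1 / 3 ^+ n + 2 / 3 ^+ n.+1 = 1 - 1 / 3 ^+ n.+1 by [].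
  by rewrite exprS; field.
have sum_le1 k n x : series (fun j => u k j x) n <= 1.
  by apply: le_trans (sum_le k n x) _; rewrite gerBl divr_ge0// exprn_ge0.
have cvg_u k x : cvgn (series (fun j => u k j x)).
  apply: nondecreasing_is_cvgn.
    by apply/nondecreasing_seqP => n; rewrite seriesSr lerDl.
  by exists 1 => _ [n _ <-].
pose code k x : R := limn (series (fun j => u k j x)).
have code0 k x : 0 <= code k x.
  by apply: limr_ge => //; apply: nearW => n; apply: sumr_ge0.
have code1 k x : code k x <= 1.
  by apply: limr_le => //; apply: nearW => n.
have codeS k x : code k x = (2 * \1_(V k) x + code k.+1 x) / 3.
  rewrite /code; apply/cvg_lim => //.
  rewrite -(cvg_shiftS (series _)).
  have -> : (fun n => series (fun j => u k j x) n.+1) =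
     (fun n => (2 * \1_(V k) x + series (fun j => u k.+1 j x) n) / 3).
    apply/funext => n; rewrite /series/= big_nat_recl// /u addn0 expr1.
    rewrite [RHS]mulrDl; congr (_ + _); rewrite mulr_suml; apply: eq_bigr => j _.
    rewrite addnS addSn exprS invfM; ring.
  apply: cvgM; last exact: cvg_cst.
  by apply: cvgD; [exact: cvg_cst|exact: cvg_u].
have mcode : measurable_fun setT (code 0%N).
  apply: (@measurable_fun_cvg _ _ _ _ (fun n x => series (fun j => u 0%N j x) n)).
    move=> n; rewrite /series/=; apply: measurable_sum => j.
    have := bmf_indic R (mV (0 + j)%N) => -[mi _].
    by apply: measurable_funM => //; apply: measurable_funM.
  by move=> x _; exact: cvg_u.
pose shift (z : R) := if 2 / 3 <= z then 3 * z - 2 else 3 * z.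
have codeV k x : (2 / 3 <= code k x) = (x \in V k).
  rewrite codeS indicE; have := code0 k.+1 x; have := code1 k.+1 x.
  by case: (x \in V k) => c1 c0; apply/idP/idP => //=; lra.
have shift_code k x : shift (code k x) = code k.+1 x.
  rewrite /shift codeV codeS indicE.
  by case: (x \in V k) => /=; field.
have iter_code k x : iter k shift (code 0%N x) = code k x.
  by elim: k => //= k ->.
have mshift : measurable_fun setT shift.
  apply: measurable_fun_if => //.
  - exact: measurable_fun_ler.
  - by apply: measurable_funTS; apply: measurable_funB.
have miter k : measurable_fun setT (iter k shift).
  elim: k => [|k IH]; first exact: measurable_id.
  by apply: (measurableT_comp mshift IH).
exists (code 0%N) => // k; exists (iter k shift @^-1` `[2 / 3, +oo[).
  by rewrite -[X in measurable X]setTI; exact: miter.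
apply/seteqP; split=> x; rewrite /preimage/= iter_code in_itv/= andbT codeV inE//.
Qed.

Section rays.
Context (R : realType).

Definition rays : set (set R) := [set `]-oo, x]%classic | x in [set: R]].

Lemma measurable_raysE (A : set R) : measurable A <-> <<s rays >> A.
Proof.
have sr : sigma_algebra setT <<s rays >> by exact: smallest_sigma_algebra.
split.
  suff : <<s @RGenOInfty.G R >> `<=` <<s rays >>.
    move=> h mA; apply: h; suff : (@RGenOInfty.G R).-sigma.-measurable A by [].
    by rewrite -RGenOInfty.measurableE; exact: mA.
  apply: smallest_sub => // _ [c ->].
  rewrite (_ : `]c, +oo[%classic = setT `\` `]-oo, c]%classic).
    by have [_ PC _] := sr; apply: PC; apply: sub_sigma_algebra; exists c.
  by rewrite setTD setCitvl.
move: A; apply: smallest_sub; first exact: sigma_algebra_measurable.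
by move=> _ [c _ <-]; exact: measurable_itv.
Qed.

Lemma setI_closed_rays : setI_closed rays.
Proof.
move=> _ _ [x _ <-] [y _ <-]; exists (Num.min x y) => //.
by apply/seteqP; split=> z; rewrite /= !in_itv/= le_min; [move/andP|move=> /andP].
Qed.

Lemma bigcup_rays : \bigcup_n `]-oo, n%:R : R]%classic = setT.
Proof.
apply/seteqP; split=> // x _; exists (Num.truncn `|x|).+1 => //.
rewrite /= in_itv/= (le_trans (ler_norm x))// ltW//.
by have /andP[] := truncn_itv (normr_ge0 x).
Qed.

Lemma bigcap_raysN : \bigcap_n `]-oo, - n%:R : R]%classic = set0.
Proof.
apply/seteqP; split=> // x /(_ (Num.truncn `|x|).+1 I); rewrite /= in_itv/=.
have /andP[_ h] := truncn_itv (normr_ge0 x).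
by have := ler_norm (- x); rewrite normrN; lra.
Qed.

Lemma bigcap_rays (r : R) :
  \bigcap_n `]-oo, r + n.+1%:R^-1]%classic = `]-oo, r]%classic.
Proof.
apply/seteqP; split=> z; rewrite /= ?in_itv/= => h; last first.
  by move=> n _; rewrite /= in_itv/= (le_trans h)// lerDl invr_ge0.
rewrite leNgt; apply/negP => rz.
have [n hn] := @small_inv R (z - r) ltac:(by rewrite subr_gt0).
have := h n I; rewrite /= in_itv/=.
by apply/negP; rewrite -ltNge -ltrBrDl.
Qed.

Lemma probability_rays_unique (m1 m2 : probability R R) :
  (forall s, pr m1 `]-oo, s] = pr m2 `]-oo, s]) ->
  forall A, measurable A -> m1 A = m2 A.
Proof.
move=> m12 A mA; apply: (measure_unique rays (fun n => `]-oo, n%:R]%classic)) => //.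
- by apply/seteqP; split => B; rewrite -measurable_raysE.
- exact: setI_closed_rays.
- by move=> n; exists n%:R.
- exact: bigcup_rays.
- move=> _ [x _ <-]; have mx : measurable (`]-oo, x]%classic : set R) by exact: measurable_itv.
  by apply: etrans (prE m1 mx) _; rewrite m12; exact/esym/(prE m2 mx).
- move=> n; have mx : measurable (`]-oo, n%:R]%classic : set R) by exact: measurable_itv.
  exact: (eq_ind_r (fun z => (z < +oo)%E) (ltry _) (prE m1 mx)).
Qed.

Lemma standard_borel_real : standard_borel R R.
Proof.
exists R, idfun; split.
- exact: Rhausdorff.
- exists (range (@ratr R)); last exact: dense_rat.
  exact: card_le_trans (card_image_le _ _) (countableP _).
- by exists idfun.
- move=> A; rewrite image_id; split.
    suff : <<s @RGenOInfty.G R >> `<=` <<s open >>.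
      move=> h mA; apply: h; suff : (@RGenOInfty.G R).-sigma.-measurable A by [].
      by rewrite -RGenOInfty.measurableE; exact: mA.
    apply: smallest_sub => [|_ [c ->]]; first exact: smallest_sigma_algebra.
    by apply: sub_sigma_algebra; exact: interval_open.
  move: A; apply: smallest_sub; first exact: sigma_algebra_measurable.
  by move=> O oO; exact: open_measurable.
Qed.

End rays.

Section distribution_function.
Context (R : realType) (m : probability R R).
Hypothesis m0 : forall c : R, pr m [set c] = 0.

Definition cdfr (z : R) : R := pr m `]-oo, z].

Lemma cdfr_nd : {homo cdfr : x y / x <= y}.
Proof.
by move=> x y xy; apply: le_pr => //; [exact: measurable_itv..|exact: subset_itvl].
Qed.

Lemma measurable_cdfr : measurable_fun setT cdfr.
Proof. exact: nondecreasing_measurable cdfr_nd. Qed.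

Lemma cdfr_setT_lt (s : R) : s < 1 -> exists z, s < cdfr z.
Proof.
move=> s1; pose F n := `]-oo, n%:R : R]%classic.
have [n|n||n sn] := @pr_bigcup_gt _ _ _ m F s; last by exists n%:R.
- exact: measurable_itv.
- by apply: subset_itvl; rewrite bnd_simp ler_nat.
by rewrite bigcup_rays pr_setT.
Qed.

Lemma cdfr_gt0 (s : R) : 0 < s -> exists z, cdfr z < s.
Proof.
move=> s1; pose F n := `]-oo, - n%:R : R]%classic.
have [n|n||n sn] := @pr_bigcap_lt _ _ _ m F s; last by exists (- n%:R).
- exact: measurable_itv.
- by apply: subset_itvl; rewrite bnd_simp lerN2 ler_nat.
by rewrite bigcap_raysN pr_set0.
Qed.

Lemma cdfr_right (z s : R) : (forall n, s <= cdfr (z + n.+1%:R^-1)) -> s <= cdfr z.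
Proof.
move=> h; rewrite leNgt; apply/negP => zs.
pose F n := `]-oo, z + n.+1%:R^-1 : R]%classic.
have [n|n||n sn] := @pr_bigcap_lt _ _ _ m F s; last first.
- by have := h n; rewrite leNgt /cdfr => /negP; apply.
- by rewrite bigcap_rays.
- by apply: subset_itvl; rewrite bnd_simp lerD2l; exact: inv_le.
- exact: measurable_itv.
Qed.

Lemma cdfr_left (z s : R) : (forall n, cdfr (z - n.+1%:R^-1) <= s) -> cdfr z <= s.
Proof.
move=> h; rewrite leNgt; apply/negP => zs.
pose F n := `]-oo, z - n.+1%:R^-1 : R]%classic.
have [n|n||n sn] := @pr_bigcup_gt _ _ _ m F s; last first.
- by have := h n; rewrite leNgt /cdfr => /negP; apply.
- suff -> : pr m (\bigcup_n F n) = cdfr z by [].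
  rewrite (_ : \bigcup_n _ = `]-oo, z[%classic); last first.
    apply/seteqP; split=> x /=.
      move=> [n _]; rewrite /F/= !in_itv/= => /le_lt_trans; apply.
      by rewrite ltrBlDr ltrDl.
    rewrite in_itv/= => /ltr_add_invr[n xn]; exists n => //.
    by rewrite /F/= in_itv/= lerBrDr ltW.
  have mz : measurable [set z] by [].
  rewrite /cdfr (pr_setID m (measurable_itv `]-oo, z]) mz).
  rewrite (_ : _ `&` _ = [set z]) ?m0 ?add0r; last first.
    by apply/seteqP; split=> x => [[]//|->]; split => //=; rewrite in_itv/=.
  congr pr; apply/seteqP; split=> x; rewrite /= !in_itv/=.
    by move=> xz; split; [exact: ltW|move=> xz'; rewrite xz' ltxx in xz].
  by move=> [xz /eqP nxz]; rewrite lt_neqAle nxz.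
- by apply: subset_itvl; rewrite bnd_simp lerD2l lerN2; exact: inv_le.
- exact: measurable_itv.
Qed.

(** The sublevel set at s in (0, 1) is a half-line, closed by left continuity, at
    the end point of which right continuity forces the value s. *)
Lemma cdfr_uniform (s : R) :
  pr m (cdfr @^-1` `]-oo, s]) = Num.min (Num.max s 0) 1.
Proof.
have cdf0 z : 0 <= cdfr z by exact: pr_ge0.
have cdf1 z : cdfr z <= 1 by apply: pr_le1; exact: measurable_itv.
have [s1|s1] := leP 1 s.
  rewrite (_ : _ @^-1` _ = setT) ?pr_setT; last first.
    by apply/seteqP; split=> // z _; rewrite /preimage/= in_itv/= (le_trans (cdf1 z)).
  by rewrite (max_idPl _) ?(min_idPr _)//; lra.
pose S := [set z | cdfr z <= s].
have -> : cdfr @^-1` `]-oo, s] = S.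
  by apply/seteqP; split=> z; rewrite /preimage/S/= in_itv.
have [z1 sz1] := cdfr_setT_lt s1.
have [[z2 Sz2]|S0] := pselect (S !=set0); last first.
  rewrite (_ : S = set0) ?pr_set0; last first.
    by apply/seteqP; split=> // z Sz; apply: S0; exists z.
  have s0 : s <= 0.
    rewrite leNgt; apply/negP => /cdfr_gt0[z zs]; apply: S0; exists z.
    by rewrite /S/= ltW.
  by rewrite (max_idPr _) ?(min_idPl _)//; lra.
have s0 : 0 <= s by apply: le_trans Sz2.
have supS : has_sup S.
  split; first by exists z2.
  exists z1 => z; rewrite /S/= => zs; rewrite leNgt; apply/negP => z1z.
  by have := cdfr_nd (ltW z1z); lra.
pose z0 := sup S.
have cz0 : cdfr z0 <= s.
  apply: cdfr_left => n.
  have n0 : 0 < n.+1%:R^-1 :> R by rewrite invr_gt0.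
  have [z Sz zz0] := sup_adherent n0 supS.
  by apply: le_trans Sz; apply: cdfr_nd; exact: ltW.
have cz0' : s <= cdfr z0.
  apply: cdfr_right => n; rewrite leNgt; apply/negP => h.
  have : z0 + n.+1%:R^-1 <= z0 by apply: ub_le_sup; [exact: supS.2|exact: ltW].
  by rewrite gerDl leNgt invr_gt0 ltr0n.
rewrite (_ : S = `]-oo, z0]%classic); last first.
  apply/seteqP; split=> z; rewrite /= in_itv/=.
    by move=> Sz; apply: ub_le_sup => //; exact: supS.2.
  by move=> /cdfr_nd zz0; rewrite /S/=; exact: le_trans cz0.
rewrite -/(cdfr z0) (max_idPl _)// (min_idPl _) ?ltW//.
by apply/eqP; rewrite eq_le cz0.
Qed.

(** The half-lines up to c and up to [cdfr c] correspond, except that the preimage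
    of the latter may exceed the former by an interval where the function is
    constant, that is, by a null set; half-lines generate the Borel sets. *)
Lemma cdfr_code (S : set R) : measurable S ->
  exists2 S' : set R, measurable S' & {ae m, forall z, S z <-> S' (cdfr z)}.
Proof.
pose P := [set S : set R | exists2 S' : set R, measurable S' &
  {ae m, forall z, S z <-> S' (cdfr z)}].
suff : <<s @rays R >> `<=` P by move=> h /measurable_raysE /h.
have sP : sigma_algebra setT P.
  split.
  - by exists set0 => //; apply: aeW.
  - move=> A [A' mA' AA']; exists (~` A'); first exact: measurableC.
    by apply: filterS AA' => z AA'; rewrite setTD/=; split; apply: contra_not => /AA'.
  - move=> F PF; have /choice[F' FF'] : forall n, exists S' : set R, measurable S' /\
      {ae m, forall z, F n z <-> S' (cdfr z)}.
      by move=> n; have [S' ? ?] := PF n; exists S'.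
    exists (\bigcup_n F' n); first by apply: bigcup_measurable => n _; exact: (FF' n).1.
    have := ae_foralln (fun n => (FF' n).2); apply: filterS => z FF.
    by split=> -[n _ /FF ?]; exists n.
have rayP c : P `]-oo, c]%classic.
  exists `]-oo, cdfr c]%classic; first exact: measurable_itv.
  have mF : measurable (cdfr @^-1` `]-oo, cdfr c]%classic).
    by rewrite -[X in measurable X]setTI; apply: measurable_cdfr => //; exact: measurable_itv.
  have mc : measurable (`]-oo, c]%classic : set R).
    exact: measurable_itv.
  exists (cdfr @^-1` `]-oo, cdfr c] `\` `]-oo, c]%classic); split.
  - exact: measurableD.
  - rewrite prE; last exact: measurableD.
    congr EFin; have := pr_setID m mF mc.
    rewrite cdfr_uniform (max_idPl _) ?pr_ge0// (min_idPl _); last exact: pr_le1.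
    rewrite setIidr; last by move=> z /=; rewrite /preimage/= !in_itv/= => /cdfr_nd.
    by rewrite -/(cdfr c); lra.
  - move=> z /= h; split.
      apply: contrapT => nz; apply: h; split => [/=|zc].
        by rewrite !in_itv/= => /cdfr_nd.
      by exfalso; apply: nz.
    by move=> zc; apply: h; split=> // _; move: zc; rewrite !in_itv/= => /cdfr_nd.
by apply: smallest_sub => // _ [c _ <-]; exact: rayP.
Qed.

End distribution_function.

Section point_realization.
Context (R : realType) (d : measure_display) (X : measurableType d).
Context (mu : probability X R).

(** The data through which standardness is used: countable covers [V n] of X
    by sets of diameter at most 2 / (n + 1), generating the measurable sets,
    whose centres f^-1 (q i) have the limits guaranteed by completeness. *)
Lemma standard_borel_covers : standard_borel R X ->
  exists (P : completePseudoMetricType R) (f : X -> P) (g : P -> X) (q : nat -> P),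
    let V n i := f @^-1` (ball (q i) n.+1%:R^-1)^° in
    [/\ hausdorff_space P, cancel f g, cancel g f,
        forall n i, measurable (V n i) &
        [/\ forall n x, exists i, V n i x,
            forall O : set P, open O -> O = \bigcup_(p in
              [set p : nat * nat | ball (q p.2) p.1.+1%:R^-1 `<=` O])
              (ball (q p.2) p.1.+1%:R^-1)^°
          & forall A : set X, measurable A ->
              <<s [set V p.1 p.2 | p in [set: nat * nat]] >> A]].
Proof.
move=> [P [f [hP [D cD dD] [g fg gf] mE]]].
have /countable_injP[h hinj] := cD.
pose q n := xget (f point) [set x | D x /\ h x = n].
have qP x : D x -> exists n, q n = x.
  move=> Dx; exists (h x); rewrite /q; case: xgetP => [y _ [Dy hy]|/(_ x)[]//].
  by apply: hinj; rewrite ?inE.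
have close x (e : R) : 0 < e -> exists n, ball x e (q n).
  move=> e0; have : (ball x e)^° !=set0.
    by exists x; rewrite /interior/=; exact: nbhsx_ballx.
  move=> /dD/(_ (open_interior _))[y [/interior_subset xy /qP[n qn]]].
  by exists n; rewrite qn.
have centre x (e : R) n : 0 < e -> ball x (e / 2) (q n) -> (ball (q n) e)^° x.
  move=> e0 xq; rewrite /interior/=.
  have : nbhs x (ball x (e / 2)) by apply: nbhsx_ballx; rewrite divr_gt0.
  apply: filterS => y xy; rewrite [e]splitr.
  exact: ball_triangle (ball_sym xq) xy.
have openE (O : set P) : open O -> O = \bigcup_(p in
    [set p : nat * nat | ball (q p.2) p.1.+1%:R^-1 `<=` O])
    (ball (q p.2) p.1.+1%:R^-1)^°.
  move=> oO; apply/seteqP; split=> [x Ox|x [p pO /interior_subset]]; last exact: pO.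
  have /nbhs_ballP[e /= e0 eO] := open_nbhs_nbhs (conj oO Ox).
  have [n n0] := small_inv (divr_gt0 e0 (ltr0Sn R 1)).
  have n1 : 0 < n.+1%:R^-1 :> R by rewrite invr_gt0.
  have n2 : 0 < n.+1%:R^-1 / 2 :> R by rewrite divr_gt0.
  have [i xi] := close x _ n2.
  exists (n, i) => /=; last exact: centre.
  move=> y qy; apply: eO; apply: (@le_ball _ _ _ (n.+1%:R^-1 / 2 + n.+1%:R^-1)); last first.
    exact: ball_triangle xi qy.
  by move: n0 n1; move: (n.+1%:R^-1 : R) => s; lra.
have mO (O : set P) : open O -> measurable (f @^-1` O).
  move=> oO; apply/mE; rewrite (_ : f @` _ = O); first exact: sub_sigma_algebra.
  apply/seteqP; split=> [_ [x Ox <-]//|y Oy].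
  by exists (g y); rewrite /preimage/= ?gf.
exists P, f, g, q; split => //.
  by move=> n i; apply: mO; exact: open_interior.
split => // [n x|A /mE sA].
  have n1 : 0 < n.+1%:R^-1 :> R by rewrite invr_gt0.
  have n2 : 0 < n.+1%:R^-1 / 2 :> R by rewrite divr_gt0.
  by have [i xi] := close (f x) _ n2; exists i; exact: centre.
set V := (X in <<s X >>).
have sV : sigma_algebra setT <<s V >> by exact: smallest_sigma_algebra.
pose Q := [set B : set P | <<s V >> (f @^-1` B)].
suff : <<s open >> `<=` Q.
  move=> /(_ _ sA); rewrite /Q/=; congr (<<s V >> _).
  apply/seteqP; split=> x; rewrite /preimage/=; last by exists x.
  by move=> [y Ay /(can_inj fg) <-].
apply: smallest_sub.
  have [V0 VC VU] := sV; split; rewrite /Q/=.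
  - by rewrite preimage_set0.
  - by move=> B VB; rewrite setTD preimage_setC -setTD; exact: VC.
  - by move=> F VF; rewrite preimage_bigcup; exact: VU.
move=> O oO; rewrite /Q/= (openE O oO) preimage_bigcup.
rewrite bigcup_mkcond; have [V0 VC VU] := sV.
pose F (n : nat) := if unpickle n is Some p then
   if p \in [set p : nat * nat | ball (q p.2) p.1.+1%:R^-1 `<=` O]
   then f @^-1` (ball (q p.2) p.1.+1%:R^-1)^° else set0 else set0.
rewrite (_ : \bigcup_i _ = \bigcup_n F n).
  apply: VU => n; rewrite /F; case: unpickle => // p; case: ifPn => // _.
  by apply: sub_sigma_algebra; exists p.
apply/seteqP; split=> x [].
  by move=> p _ px; exists (pickle p) => //; rewrite /F pickleK.
by move=> n _; rewrite /F; case: unpickle => // p px; exists p.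
Qed.

(** A countable family generating the measurable sets is coded in one real
    function by [ternary_code], through which every measurable set then factors.
    A fibre of it contains no smaller nonempty measurable set, hence is null, so
    that the distribution function makes the code uniform. *)
Lemma nonatomic_code : standard_borel R X -> nonatomic mu ->
  exists phi : X -> R, [/\ measurable_fun setT phi,
    forall s, pr mu (phi @^-1` `]-oo, s]) = Num.min (Num.max s 0) 1 &
    forall A, measurable A -> exists2 A' : set R, measurable A' &
      {ae mu, forall x, A x <-> A' (phi x)}].
Proof.
move=> /standard_borel_covers[P [f [g [q [hP fg gf mV [cV oV gV]]]]]] na.
pose V n i := f @^-1` (ball (q i) n.+1%:R^-1)^°.
pose W n := if unpickle n is Some p then V p.1 p.2 else set0.
have mW n : measurable (W n).
  by rewrite /W; case: unpickle => // p; exact: mV.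
have [i mi iW] := ternary_code R mW.
have iA A : measurable A -> exists2 S : set R, measurable S & A = i @^-1` S.
  move=> /gV; move: A; apply: smallest_sub.
    split.
    - by exists set0 => //; rewrite preimage_set0.
    - by move=> _ [S mS ->]; exists (~` S); [exact: measurableC|rewrite setTD].
    - move=> F FS; have /choice[S SF] : forall n, exists S : set R,
        measurable S /\ F n = i @^-1` S by move=> n; have [S ? ?] := FS n; exists S.
      exists (\bigcup_n S n); first by apply: bigcupT_measurable => n; exact: (SF n).1.
      by rewrite preimage_bigcup; apply: eq_bigcupr => n _; exact: (SF n).2.
  move=> _ [p _ <-]; have [S mS WS] := iW (pickle p).
  by exists S => //; rewrite -WS /W pickleK.
have [m im] := image_probability mu mi.
have m0 c : pr m [set c] = 0.
  rewrite -(mp_pr im)//; set C := i @^-1` [set c].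
  have mC : measurable C by exact: mp_preimage im _.
  apply/eqP/negP => /negP C0.
  have muC : (0 < mu C)%E by rewrite prE// lte_fin lt_neqAle eq_sym C0 pr_ge0.
  have [B [mB BC B0 BltC]] := na C mC muC.
  have [S mS BS] := iA B mB.
  have [Sc|nSc] := pselect (S c).
    suff CB : C `<=` B by move: BltC; rewrite ltNge le_measure ?inE.
    by move=> x; rewrite BS /C /preimage/= => ->.
  have B00 : B = set0.
    apply/seteqP; split=> [x Bx|x//]; apply: nSc; rewrite -(BC x Bx : i x = c).
    by rewrite BS in Bx.
  by move: B0; rewrite B00 measure0 ltxx.
exists (cdfr m \o i); split.
- by apply: measurableT_comp => //; exact: measurable_cdfr.
- move=> s; rewrite comp_preimage (mp_pr im); first exact: cdfr_uniform.
  rewrite -[X in measurable X]setTI; apply: measurable_cdfr => //.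
- move=> A /iA[S mS ->]; have [S' mS' SS'] := cdfr_code m0 mS.
  by exists S' => //; exact: ae_comp im SS'.
Qed.

(** The point of X over a real y is the limit of the centres of small sets whose
    codes contain y: for almost every y two such sets always meet, so that the
    centres form a Cauchy sequence, which converges by completeness. *)
Lemma point_realization (phi : X -> R) (m : probability R R) :
  standard_borel R X -> measure_preserving mu m phi ->
  (forall A, measurable A -> exists2 A' : set R, measurable A' &
      {ae mu, forall x, A x <-> A' (phi x)}) ->
  exists psi, iso_mod0 mu m phi psi.
Proof.
move=> /standard_borel_covers[P [f [g [q [hP fg gf mV [cV oV gV]]]]]] mphi code.
pose V n i := f @^-1` (ball (q i) n.+1%:R^-1)^°.
have /choice[A AP] : forall p : nat * nat, exists A' : set R, measurable A' /\
    {ae mu, forall x, V p.1 p.2 x <-> A' (phi x)}.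
  by move=> p; have [A' ? ?] := code _ (mV p.1 p.2); exists A'.
have mA p : measurable (A p) := (AP p).1.
have aeA : {ae mu, forall x, forall p, V p.1 p.2 x <-> A p (phi x)}.
  by apply: ae_countType => p; exact: (AP p).2.
pose good := (\bigcap_n \bigcup_i A (n, i)) `&`
  \bigcap_(r in [set r : (nat * nat) * (nat * nat) |
    V r.1.1 r.1.2 `&` V r.2.1 r.2.2 = set0]) ~` (A r.1 `&` A r.2).
have good_phi x : (forall p, V p.1 p.2 x <-> A p (phi x)) -> good (phi x).
  move=> xA; split.
    by move=> n _; have [i Vx] := cV n x; exists i => //; apply/(xA (n, i)).
  by move=> r /= rV [/xA Vr1 /xA Vr2]; have : set0 x by rewrite -rV.
have mgood : measurable good.
  apply: measurableI.
    by apply: bigcapT_measurable => n; apply: bigcupT_measurable.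
  apply: bigcap_countType_measurable => r.
  by apply: measurableC; exact: measurableI.
(* two covering sets of levels n and n' which meet have centres at distance at
   most 1 / (n + 1) + 1 / (n' + 1); 3 leaves room for the passage to the limit *)
have lim_ex y : good y -> exists p, forall n i, A (n, i) y -> ball (q i) (3 / n.+1%:R) p.
  move=> [yA yV].
  have /choice[ix ixP] : forall n, exists i, A (n, i) y.
    by move=> n; have [i _ Ai] := yA n I; exists i.
  have meet n i n' i' : A (n, i) y -> A (n', i') y ->
      ball (q i) (n.+1%:R^-1 + n'.+1%:R^-1) (q i').
    move=> Ay Ay'; have /eqP/set0P[z [/= Vz Vz']] : V n i `&` V n' i' <> set0.
      by move=> /(yV ((n, i), (n', i'))); apply.
    apply: (ball_triangle (interior_subset Vz)).
    exact/ball_sym/(interior_subset Vz').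
  pose u n := q (ix n).
  have cu : cvgn u.
    apply: cauchy_cvg; apply/cauchy_ballP => e e0.
    have [N eN] := small_inv (divr_gt0 e0 (ltr0Sn R 1)).
    pose T := [set x | exists2 n, (N <= n)%N & u n = x].
    exists (T, T) => /=; first by split; exists N => // n Nn; exists n.
    move=> [z z'] [/= [n Nn <-] [n' Nn' <-]].
    apply: le_ball (meet _ _ _ _ (ixP n) (ixP n')).
    move: (inv_le R Nn) (inv_le R Nn') eN; move: (N.+1%:R^-1 : R) => s.
    by move: (n.+1%:R^-1 : R) (n'.+1%:R^-1 : R) => s' s''; lra.
  exists (lim (u @ \oo)) => n i Ay.
  have n0 : 0 < n.+1%:R^-1 :> R by rewrite invr_gt0.
  have [N _ HN] := cvg_ball cu n0.
  have := HN (maxn N n) (leq_maxl _ _) => /= /ball_sym hk.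
  have := ball_triangle (meet _ _ _ _ Ay (ixP (maxn N n))) hk.
  apply: le_ball; move: (inv_le R (leq_maxr N n)).
  by move: (n.+1%:R^-1 : R) ((maxn N n).+1%:R^-1 : R) => s s'; lra.
pose lp y := if pselect (good y) is left gy then projT1 (cid (lim_ex y gy)) else q 0%N.
have lpP y : good y -> forall n i, A (n, i) y -> ball (q i) (3 / n.+1%:R) (lp y).
  by rewrite /lp; case: pselect => // gy _; case: cid.
have lpN y : ~ good y -> lp y = q 0%N by rewrite /lp; case: pselect.
have mlp (O : set P) : open O -> measurable (lp @^-1` O).
  move=> oO.
  pose B := \bigcup_(p in [set p : nat * nat | ball (q p.2) (3 / p.1.+1%:R) `<=` O]) A p.
  have mB : measurable B.
    exact: bigcup_countType_measurable.
  have -> : lp @^-1` O = (good `&` B) `|` (~` good `&` [set _ | O (q 0%N)]).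
    apply/seteqP; split=> y; rewrite /preimage/=.
      have [gy Oy|gy] := pselect (good y); last by rewrite lpN//; right.
      left; split => //.
      have /nbhs_ballP[e /= e0 eO] := open_nbhs_nbhs (conj oO Oy).
      have [n ne] := small_inv (divr_gt0 e0 (ltr0Sn R 5)).
      have [i _ Ay] := gy.1 n I; exists (n, i) => //= z qz; apply: eO.
      have := ball_triangle (ball_sym (lpP y gy n i Ay)) qz.
      by apply: le_ball; move: ne; move: (n.+1%:R^-1 : R) => s; lra.
    move=> [[gy [p pO Ay]]|[gy Oq]]; last by rewrite lpN.
    by apply: pO; apply: lpP => //; rewrite -surjective_pairing.
  apply: measurableU; first exact: measurableI.
  apply: measurableI; first exact: measurableC.
  have [Oq|Oq] := pselect (O (q 0%N)).
    by rewrite (_ : [set _ | _] = setT)//; apply/seteqP; split.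
  by rewrite (_ : [set _ | _] = set0)//; apply/seteqP; split.
pose psi y := g (lp y).
have mpsi : measurable_fun setT psi.
  move=> _ B mB; rewrite setTI; have := gV B mB; move: B {mB}.
  apply: smallest_sub.
    split.
    - by rewrite preimage_set0.
    - by move=> B mB; rewrite setTD preimage_setC; exact: measurableC.
    - by move=> F mF; rewrite preimage_bigcup; exact: bigcupT_measurable.
  move=> _ [p _ <-].
  rewrite (_ : psi @^-1` _ = lp @^-1` (ball (q p.2) p.1.+1%:R^-1)^°).
    by apply: mlp; exact: open_interior.
  by apply/seteqP; split=> y; rewrite /preimage/= /psi gf.
have psi_phi : {ae mu, forall x, psi (phi x) = x}.
  apply: filterS aeA => x xA; rewrite /psi.
  suff -> : lp (phi x) = f x by rewrite fg.
  apply: (close_eq hP); rewrite ball_close => e.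
  have [n ne] := small_inv (divr_gt0 (gt0 e) (ltr0Sn R 3)).
  have [i Vx] := cV n x.
  have := ball_triangle (ball_sym (lpP _ (good_phi x xA) n i ((xA (n, i)).1 Vx)))
    (interior_subset Vx).
  by apply: le_ball; move: ne; move: (n.+1%:R^-1 : R) => s; lra.
have mp_psi : measure_preserving m mu psi.
  split=> // B mB; have mpB : measurable (psi @^-1` B).
    by rewrite -[X in measurable X]setTI; exact: mpsi.
  rewrite -mphi.2// (prE mu (mp_preimage mphi mpB)) (prE mu mB); congr EFin.
  apply: pr_ae => //; first exact: mp_preimage mphi mpB.
  by apply: filterS psi_phi => x; rewrite /preimage/= => ->.
exists psi; split => //.
(* h vanishes on the image of phi, which is conull *)
pose h y := phi (psi y) - y.
have mh : measurable_fun setT h.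
  apply: measurable_funB => //; apply: measurableT_comp mpsi; exact: mphi.1.
have mN : measurable (h @^-1` [set 0]).
  by rewrite -[X in measurable X]setTI; exact: mh.
have /conull_ae : pr m (h @^-1` [set 0]) = 1.
  rewrite -(mp_pr mphi)// -(pr_setT mu); apply: pr_ae => //.
    exact: mp_preimage mphi mN.
  by apply: filterS psi_phi => x psix; rewrite /preimage/= /h psix subrr.
by move=> /(_ mN); apply: filterS => y /eqP; rewrite subr_eq0 => /eqP.
Qed.

End point_realization.

(** Both spaces are coded by uniformly distributed functions, hence both are
    isomorphic to the unit interval. *)
Lemma standard_isomorphic (R : realType) (d1 d2 : measure_display)
    (X : measurableType d1) (mu : probability X R)
    (Y : measurableType d2) (nu : probability Y R) :
  standard_probability_space mu -> standard_probability_space nu ->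
  isomorphic mu nu.
Proof.
move=> [sX naX] [sY naY].
have [phi [mphi uphi cphi]] := nonatomic_code sX naX.
have [chi [mchi uchi cchi]] := nonatomic_code sY naY.
have [m phim] := image_probability mu mphi.
have [m' chim'] := image_probability nu mchi.
have mm' A : measurable A -> m' A = m A.
  apply: probability_rays_unique => s.
  by rewrite -(mp_pr chim') -?(mp_pr phim) ?uphi ?uchi//; exact: measurable_itv.
have chim : measure_preserving nu m chi.
  by split=> // A mA; rewrite chim'.2// mm'.
have [psi iX] := point_realization sX phim cphi.
have [omega iY] := point_realization sY chim cchi.
by exists (omega \o phi), (psi \o chi); exact: iso_mod0_comp iX (iso_mod0_sym iY).
Qed.

Lemma nonatomic_iso (R : realType) (d1 d2 : measure_display)
    (X : measurableType d1) (mu : probability X R)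
    (Y : measurableType d2) (nu : probability Y R) :
  isomorphic mu nu -> nonatomic mu -> nonatomic nu.
Proof.
move=> [f [g [mf mg gf fg]]] na A mA A0.
have mfA : measurable (f @^-1` A) by exact: mp_preimage mf mA.
have [|B [mB BA B0 BltA]] := na _ mfA; first by rewrite mf.2.
have mgB : measurable (g @^-1` B) by exact: mp_preimage mg mB.
have gBA : nu (A `&` g @^-1` B) = mu B.
  have mAB : measurable (A `&` g @^-1` B) by exact: measurableI.
  rewrite -mg.2// !prE//; congr EFin; apply: pr_ae => //.
  apply: filterS fg => y fgy; rewrite /preimage/=; split=> [[]//|Bgy].
  by split=> //; rewrite -fgy; exact: BA.
exists (A `&` g @^-1` B); rewrite gBA; split => //; first exact: measurableI.
by rewrite -mf.2.
Qed.

(** * Conditional actions of an extreme class *)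

Section conditional_action.
Context (G : groupType) (R : realType) (d : measure_display).
Context (Y : measurableType d) (nu : probability Y R).

Lemma conditional_probability (C : set Y) : measurable C -> 0 < pr nu C ->
  exists nuC : probability Y R, forall A, measurable A ->
    pr nuC A = pr nu (A `&` C) / pr nu C.
Proof.
move=> mC C0; exists (mnormalize (mrestr nu mC) nu) => A mA.
have CT : mrestr nu mC setT = (pr nu C)%:E by rewrite /mrestr setTI prE.
change (fine (mnormalize (mrestr nu mC) nu A) = pr nu (A `&` C) / pr nu C).
rewrite /mnormalize/=.
rewrite CT.
rewrite eqe gt_eqF//= /mrestr prE//; exact: measurableI.
Qed.

Lemma conditional_action (a : mpaction G nu) (C : set Y) (nuC : probability Y R) :
  measurable C -> 0 < pr nu C -> invariant_set a C ->
  (forall A, measurable A -> pr nuC A = pr nu (A `&` C) / pr nu C) ->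
  exists aC : mpaction G nuC, forall g, aC g = a g :> (Y -> Y).
Proof.
move=> mC C0 iC nuCE.
have mp g : measure_preserving nuC nuC (a g).
  split; first exact: measurable_act.
  move=> A mA; have maA := measurable_act_preimage a g mA.
  rewrite !prE//; congr EFin; rewrite !nuCE//; congr (_ / _).
  rewrite -(pr_act_preimage a g (measurableI _ _ mA mC)); congr pr.
  by apply/seteqP; split=> x; rewrite /preimage/= iC.
by exists (MPAction (mpact1 a) (mpactM a) mp).
Qed.

End conditional_action.

Lemma ae_sum (R : realType) (n : nat) (d : measure_display)
    (Y : 'I_n.+1 -> measurableType d) (nu : forall i, probability (Y i) R)
    (w : weights R n) (P : dunion Y -> Prop) :
  (forall i, {ae nu i, forall y, P (existT _ i y)}) ->
  {ae dunion_measure nu w, forall y, P y}.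
Proof.
move=> aeP; have N' i := cid (aeP i).
exists [set x | projT1 (N' (projT1 x)) (projT2 x)]; split.
- by apply/measurable_dunionP => i; have [] := projT2 (N' i).
- rewrite /= /dunion_measure big1// => i _.
  by have [_ N0 _] := projT2 (N' i); rewrite [X in (_ * X)%E](_ : _ = 0%E) ?mule0.
- by move=> [i y] /= nP; have [_ _] := projT2 (N' i); apply.
Qed.

(** The isomorphisms of mu with the conditional measures on C and on its
    complement are glued along this partition. *)
Lemma conv_transport (G : groupType) (R : realType) (d d' : measure_display)
    (X : measurableType d) (mu : probability X R)
    (Y : measurableType d') (nu : probability Y R) (C : set Y)
    (nuC nuD : probability Y R) (a : mpaction G nu)
    (aC : mpaction G nuC) (aD : mpaction G nuD) (b c : mpaction G mu) (t : {i01 R}) :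
  measurable C -> 0 < pr nu C -> pr nu C < 1 -> t%:num = pr nu C ->
  invariant_set a C ->
  (forall A, measurable A -> pr nuC A = pr nu (A `&` C) / pr nu C) ->
  (forall A, measurable A -> pr nuD A = pr nu (A `&` ~` C) / pr nu (~` C)) ->
  (forall g, aC g = a g :> (Y -> Y)) -> (forall g, aD g = a g :> (Y -> Y)) ->
  transport b aC -> transport c aD ->
  transport (conv_action t b c) a.
Proof.
move=> mC C0 C1 tC iC nuCE nuDE aCE aDE
  [f1 [g1 [mf1 mg1 gf1 fg1 fb1]]] [f2 [g2 [mf2 mg2 gf2 fg2 fb2]]].
have mD : measurable (~` C) by exact: measurableC.
have D0 : 0 < pr nu (~` C) by rewrite pr_setC// subr_gt0.
have aeC : {ae nuC, forall y, C y}.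
  by apply: conull_ae => //; rewrite nuCE// setIid divff// gt_eqF.
have aeD : {ae nuD, forall y, ~ C y}.
  by apply: (conull_ae mD); rewrite nuDE// setIid divff// gt_eqF.
have aeC_nu (P : Y -> Prop) : {ae nuC, forall y, P y} -> {ae nuD, forall y, P y} ->
    {ae nu, forall y, P y}.
  move=> [N [mN N0 PN]] [M [mM M0 PM]]; exists (N `&` M); split.
  - exact: measurableI.
  - have mNM : measurable (N `&` M) by exact: measurableI.
    have null (n1 : probability Y R) K : n1 K = 0%E -> measurable K ->
        N `&` M `<=` K -> pr n1 (N `&` M) = 0.
      move=> K0 mK NK; apply/eqP; rewrite eq_le pr_ge0 andbT.
      by apply: le_trans (le_pr n1 mNM mK NK) _; rewrite /pr K0.
    rewrite prE//; congr EFin; rewrite (pr_setID nu mNM mC).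
    have := null nuC N N0 mN (@subIsetl _ _ _); rewrite nuCE//.
    have := null nuD M M0 mM (@subIsetr _ _ _); rewrite nuDE// -setDE.
    move=> /eqP; rewrite mulf_eq0 invr_eq0 (gt_eqF D0) orbF => /eqP ->.
    by move=> /eqP; rewrite mulf_eq0 invr_eq0 (gt_eqF C0) orbF => /eqP ->; rewrite addr0.
  - by move=> y /= nP; split; [exact: PN|exact: PM].
pose U (i : 'I_2) := X.
pose i1 : 'I_2 := lift ord0 ord0.
pose f (x : dunion (fun _ : 'I_2 => X)) := if projT1 x == ord0 then f1 (projT2 x) else f2 (projT2 x).
pose g y : dunion (fun _ : 'I_2 => X) :=
  if y \in C then existT _ ord0 (g1 y) else existT _ i1 (g2 y).
have gC y : C y -> g y = existT _ ord0 (g1 y) by move=> Cy; rewrite /g mem_set.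
have gD y : ~ C y -> g y = existT _ i1 (g2 y) by move=> Cy; rewrite /g memNset.
have splitnu A : measurable A -> pr nu A = t%:num * pr nuC A + (1 - t%:num) * pr nuD A.
  move=> mA; rewrite (pr_setID nu mA mC) setDE tC -pr_setC// nuCE// nuDE//.
  by rewrite !mulrA ![_ * _ / _]mulrAC !divff ?gt_eqF// !mul1r.
have ord2 (i : 'I_2) : i = ord0 \/ i = i1.
  by case: i => [[|[|]]]//= ?; [left|right]; exact: val_inj.
have mf A : measurable A -> measurable (f @^-1` A).
  move=> mA; apply/measurable_dunionP => i.
  have [->|->] := ord2 i; rewrite /preimage/f/=.
    exact: mp_preimage mf1 mA.
  exact: mp_preimage mf2 mA.
have mg (S : set (dunion (fun _ : 'I_2 => X))) : measurable S -> measurable (g @^-1` S).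
  move=> mS; rewrite (_ : g @^-1` S =
      (C `&` g1 @^-1` slice ord0 S) `|` (~` C `&` g2 @^-1` slice i1 S)).
    apply: measurableU; apply: measurableI => //.
      by apply: mp_preimage mg1 _; exact: mS.
    by apply: mp_preimage mg2 _; exact: mS.
  apply/seteqP; split=> y; rewrite /preimage/=.
    by have [Cy|Cy] := pselect (C y); [rewrite gC//; left|rewrite gD//; right].
  by move=> [[Cy]|[Cy]]; [rewrite gC|rewrite gD].
have prg (S : set (dunion (fun _ : 'I_2 => X))) : measurable S ->
    pr nu (g @^-1` S) = pr (dunion_measure (fun _ : 'I_2 => mu) (pair_weights t)) S.
  move=> mS; rewrite (splitnu _ (mg _ mS)).
  rewrite (@pr_sum R 1 d (fun=> X) (fun=> mu) (pair_weights t) S mS) big_ord_recl big_ord1.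
  congr (_ * _ + _ * _).
    rewrite -(mp_pr mg1); last exact: mS.
    apply: pr_ae; [exact: mg|by apply: mp_preimage mg1 _; exact: mS|].
    by apply: filterS aeC => y Cy; rewrite /preimage/= gC.
  rewrite -(mp_pr mg2); last exact: mS.
  apply: pr_ae; [exact: mg|by apply: mp_preimage mg2 _; exact: mS|].
  by apply: filterS aeD => y Cy; rewrite /preimage/= gD.
have prf A : measurable A ->
    pr (dunion_measure (fun _ : 'I_2 => mu) (pair_weights t)) (f @^-1` A) = pr nu A.
  move=> mA; rewrite splitnu//.
  rewrite (@pr_sum R 1 d (fun=> X) (fun=> mu) (pair_weights t) _ (mf _ mA)) big_ord_recl big_ord1.
  by rewrite -(mp_pr mf1 mA) -(mp_pr mf2 mA).
exists f, g; split.
- split=> [_ A mA|A mA]; first by rewrite setTI; exact: mf.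
  by apply: etrans (prE _ (mf A mA)) _; rewrite prf// -prE.
- split=> [_ A mA|A mA]; first by rewrite setTI; exact: mg.
  by rewrite (prE nu (mg A mA)) prg//; apply/esym/prE.
- apply: ae_sum => i; have [->|->] := ord2 i.
    have := ae_comp mf1 aeC; apply: filterS2 gf1 => x /= gfx Cfx.
    by rewrite /f/= gC// gfx.
  have := ae_comp mf2 aeD; apply: filterS2 gf2 => x /= gfx Cfx.
  by rewrite /f/= gD// gfx.
- apply: aeC_nu.
    by apply: filterS2 aeC fg1 => y Cy fgy; rewrite gC.
  by apply: filterS2 aeD fg2 => y Cy fgy; rewrite gD.
- move=> h; apply: ae_sum => i; have [->|->] := ord2 i.
    by apply: filterS (fb1 h) => x /=; rewrite aCE.
  by apply: filterS (fb2 h) => x /=; rewrite aDE.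
Qed.

Lemma conditional_nonatomic (R : realType) (d : measure_display)
    (Y : measurableType d) (nu nuC : probability Y R) (C : set Y) :
  measurable C -> 0 < pr nu C ->
  (forall A, measurable A -> pr nuC A = pr nu (A `&` C) / pr nu C) ->
  nonatomic nu -> nonatomic nuC.
Proof.
move=> mC C0 nuCE na A mA; rewrite prE// lte_fin nuCE// => A0.
have mAC : measurable (A `&` C) by exact: measurableI.
have [|B [mB BA]] := na _ mAC.
  by rewrite prE// lte_fin; move: A0; rewrite pmulr_lgt0// invr_gt0.
have BC : B `&` C = B by apply/setIidPl => x /BA[].
rewrite !prE// !lte_fin => B0 BltA; exists B; split => //.
- by move=> x /BA[].
- by rewrite prE// lte_fin nuCE// BC divr_gt0.
- by rewrite prE// nuCE// BC lte_fin ltr_pM2r// invr_gt0.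
Qed.

(** The conditional actions on C and on its complement are the ends of a segment
    through the class, in which the class lies with weight [pr nu C]; an extreme
    class coincides with both ends. *)
Lemma extreme_conditional (G : groupType) (R : realType) (d d' : measure_display)
    (X : measurableType d) (mu : probability X R)
    (Y : measurableType d') (nu : probability Y R)
    (a : mpaction G mu) (a' : mpaction G nu) (C : set Y)
    (nuC : probability Y R) (aC : mpaction G nuC) :
  countable [set: G] ->
  standard_probability_space mu -> standard_probability_space nu ->
  extreme_point (stable_class a) -> transport a a' ->
  measurable C -> 0 < pr nu C -> invariant_set a' C ->
  (forall A, measurable A -> pr nuC A = pr nu (A `&` C) / pr nu C) ->
  (forall g, aC g = a' g :> (Y -> Y)) ->
  supp_eq aC a'.
Proof.
move=> hG smu snu [_ ext] taa' mC C0 iC nuCE aCE.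
have [C1|C1] := ltP (pr nu C) 1; last first.
  (* if C is conull, there is no segment, but the measures agree *)
  have {}C1 : pr nu C = 1 by apply/eqP; rewrite eq_le C1 pr_le1.
  have nuC_nu A : measurable A -> pr nuC A = pr nu A.
    move=> mA; rewrite nuCE// C1 divr1 [RHS](pr_setID nu mA mC).
    rewrite [X in _ = _ + X](_ : _ = 0) ?addr0//; apply/eqP.
    rewrite eq_le pr_ge0 andbT; have mD := measurableD mA mC.
    apply: le_trans (le_pr nu mD (measurableC mC) _) _; first by move=> x [].
    by rewrite pr_setC// C1 subrr.
  move=> k phi; have pairE B : (forall i, measurable (B i)) ->
      pairing aC phi B = pairing a' phi B.
    move=> mB; apply: eq_bigr => p _; congr (_ * _).
    by rewrite /corr nuC_nu !act_imageE ?aCE//; rewrite -act_imageE; exact: measurable_corr.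
  rewrite /supp; congr sup; apply/seteqP; split=> _ [B mB <-]; exists B => //.
    by rewrite pairE.
  by rewrite pairE.
pose D := ~` C; have mD : measurable D by exact: measurableC.
have D0 : 0 < pr nu D by rewrite pr_setC// subr_gt0.
have iD : invariant_set a' D.
  by move=> g x; split; apply: contra_not => /iC.
have [nuD nuDE] := conditional_probability mD D0.
have [aD aDE] := conditional_action mD D0 iD nuDE.
have sC : standard_probability_space nuC.
  by split; [exact: snu.1|exact: conditional_nonatomic mC C0 nuCE snu.2].
have sD : standard_probability_space nuD.
  by split; [exact: snu.1|exact: conditional_nonatomic mD D0 nuDE snu.2].
have [b tb] := transported_action aC hG (standard_isomorphic smu sC).
have [c tc] := transported_action aD hG (standard_isomorphic smu sD).
pose t : {i01 R} := Itv01 (ltW C0) (ltW C1).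
have tconv : transport (conv_action t b c) a.
  apply: transport_trans (transport_sym taa').
  exact: (conv_transport mC C0 C1 _ iC nuCE nuDE aCE aDE tb tc).
have suppa := transport_supp_eq tconv.
have ab : stable_class b = stable_class a.
  apply: (ext t (stable_class b) (stable_class c) _ _ _ _).1.
  - by rewrite /t/= C0 C1.
  - by exists b.
  - by exists c.
  apply/seteqP; split=> [a'' aa''|a'' [b1 [c1 [a1 [bb1 cc1 t1 a1a'']]]]].
    by exists b, c, a; split=> //; apply/swe_suppP.
  apply/swe_suppP => k phi.
  rewrite -((swe_suppP _ _).1 a1a'') -(transport_supp_eq t1) supp_conv.
  rewrite -((swe_suppP _ _).1 bb1) -((swe_suppP _ _).1 cc1).
  by rewrite -(suppa k phi) supp_conv.
have : stable_class b a by rewrite ab; apply/swe_suppP.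
move=> /swe_suppP ba k phi.
by rewrite -(transport_supp_eq tb) ba (transport_supp_eq taa').
Qed.

(** * Conditional expectations on the invariant sets *)

Section invariant_sets.
Context (G : groupType) (R : realType) (d : measure_display).
Context (Y : measurableType d) (nu : probability Y R) (a : mpaction G nu).

Lemma indic_invariant C : invariant_set a C -> invariant_fun a (\1_C : Y -> R).
Proof.
move=> iC g x; rewrite !indicE; congr (_%:R); congr nat_of_bool.
by apply/idP/idP; rewrite !inE iC.
Qed.

(** The sublevel sets of u are themselves invariant, and those at negative levels
    are null by the hypothesis applied to them. *)
Lemma ae_ge0_invariant (u : Y -> R) : bmf u -> invariant_fun a u ->
  (forall C, measurable C -> invariant_set a C ->
    0 <= expect nu (fun x => u x * \1_C x)) ->
  {ae nu, forall x, 0 <= u x}.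
Proof.
move=> bu iu uC; pose C n := [set x | u x <= - n.+1%:R^-1].
have mC n : measurable (C n) by apply: measurable_le; exact: bu.1.
have C0 n : pr nu (C n) = 0.
  have n0 : 0 < n.+1%:R^-1 :> R by rewrite invr_gt0.
  have iC : invariant_set a (C n) by move=> g x; rewrite /C/= iu.
  have : expect nu (fun x => u x * \1_(C n) x) <=
      expect nu (fun x => - n.+1%:R^-1 * \1_(C n) x).
    apply: le_expect => [||x]; [exact: bmfM bu (bmf_indic _ _)|exact: bmfZ (bmf_indic _ _)|].
    by rewrite indicE; case: (boolP (x \in C n)); rewrite ?mulr0// inE !mulr1.
  rewrite expectZ ?expect_indic//; last exact: bmf_indic.
  move=> /(le_trans (uC _ (mC n) iC)); rewrite mulNr oppr_ge0 pmulr_rle0// => h.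
  by apply/eqP; rewrite eq_le h pr_ge0.
have aeC n : {ae nu, forall x, ~ C n x}.
  by apply: conull_ae; [exact: measurableC|rewrite pr_setC// C0 subr0].
apply: filterS (ae_foralln aeC) => x Cx; rewrite leNgt; apply/negP => ux.
have [n nu'] := @small_inv R (- u x) ltac:(by rewrite oppr_gt0).
by apply: (Cx n); rewrite /C/= lerNr ltW.
Qed.

Lemma ae_not_invariant (C : set Y) : measurable C -> invariant_set a C ->
  ~ (0 < pr nu C) -> {ae nu, forall x, ~ C x}.
Proof.
move=> mC _ C0; apply: conull_ae; first exact: measurableC.
rewrite pr_setC// (_ : pr nu C = 0) ?subr0//.
by apply/eqP; rewrite eq_le pr_ge0 andbT leNgt; exact/negP.
Qed.

(** A family of conditional expectations of the indicator functions on the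
    invariant sets, as provided by [mean_ergodic]. *)
Definition conditional_on_invariant (fh : set Y -> Y -> R) := forall B, measurable B ->
  [/\ measurable_fun setT (fh B), forall x, 0 <= fh B x <= 1, invariant_fun a (fh B),
      forall u, bmf u -> invariant_fun a u ->
        expect nu (fun x => \1_B x * u x) = expect nu (fun x => fh B x * u x)
    & forall e, 0 < e -> exists2 l, convex_weights l &
        expect nu (fun x => (average a l B x - fh B x) ^+ 2) <= e].

Lemma conditional_on_invariant_exists : countable [set: G] ->
  exists fh, conditional_on_invariant fh.
Proof.
move=> hG; have /choice[fh fhP] : forall B, exists f : Y -> R, measurable B ->
  [/\ measurable_fun setT f, forall x, 0 <= f x <= 1, invariant_fun a f,
      forall u, bmf u -> invariant_fun a u ->
        expect nu (fun x => \1_B x * u x) = expect nu (fun x => f x * u x)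
    & forall e, 0 < e -> exists2 l, convex_weights l &
        expect nu (fun x => (average a l B x - f x) ^+ 2) <= e].
  move=> B; have [mB|nB] := pselect (measurable B); last by exists (fun=> 0).
  by have [f fP] := mean_ergodic a hG mB; exists f.
by exists fh.
Qed.

Context (fh : set Y -> Y -> R).
Hypothesis fhP : conditional_on_invariant fh.

Lemma fh_bmf B : measurable B -> bmf (fh B).
Proof.
move=> /fhP[mf f01 _ _ _]; split => //; exists 1 => x.
by rewrite ger0_norm; have /andP[] := f01 x.
Qed.

Lemma fh_inv B : measurable B -> invariant_fun a (fh B).
Proof. by move=> /fhP[]. Qed.

Lemma fh_itv B x : measurable B -> 0 <= fh B x <= 1.
Proof. by move=> /fhP[]. Qed.

Lemma expect_fh B C : measurable B -> measurable C -> invariant_set a C ->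
  expect nu (fun x => fh B x * \1_C x) = pr nu (B `&` C).
Proof.
move=> mB mC iC; have [_ _ _ fhE _] := fhP mB.
rewrite -fhE; [|exact: bmf_indic|exact: indic_invariant].
rewrite -expect_indic; last exact: measurableI.
by apply: eq_expect => x; rewrite indicI.
Qed.

Lemma expect_fh_sum (I : Type) (s : seq I) (c : I -> R) (B : I -> set Y) C :
  (forall i, measurable (B i)) -> measurable C -> invariant_set a C ->
  expect nu (fun x => (\sum_(i <- s) c i * fh (B i) x) * \1_C x) =
  \sum_(i <- s) c i * pr nu (B i `&` C).
Proof.
move=> mB mC iC.
have bF i : bmf (fun x => c i * (fh (B i) x * \1_C x)).
  by apply: bmfZ; apply: bmfM (bmf_indic _ _) => //; exact: fh_bmf.
rewrite (@eq_expect _ _ _ _ _ (fun x => \sum_(i <- s) c i * (fh (B i) x * \1_C x))).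
  rewrite expect_sum//; apply: eq_bigr => i _.
  by rewrite expectZ ?expect_fh//; apply: bmfM (bmf_indic _ _) => //; exact: fh_bmf.
by move=> x; rewrite mulr_suml; apply: eq_bigr => i _; rewrite mulrA.
Qed.

(** The sum of conditional expectations is an invariant function, whose integral
    over an invariant set C is the sum in the hypothesis. So [fh]
    inherits linear relations and inequalities between measures. *)
Lemma fh_linear_ge0 (I : Type) (s : seq I) (c : I -> R) (B : I -> set Y) :
  (forall i, measurable (B i)) ->
  (forall C, measurable C -> invariant_set a C ->
    0 <= \sum_(i <- s) c i * pr nu (B i `&` C)) ->
  {ae nu, forall x, 0 <= \sum_(i <- s) c i * fh (B i) x}.
Proof.
move=> mB hC; apply: ae_ge0_invariant.
- by apply: bmf_sum => i; apply: bmfZ; exact: fh_bmf.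
- by move=> g x; apply: eq_bigr => i _; rewrite fh_inv.
- by move=> C mC iC; rewrite expect_fh_sum// hC.
Qed.

Lemma fh_mono B B' : measurable B -> measurable B' -> B `<=` B' ->
  {ae nu, forall x, fh B x <= fh B' x}.
Proof.
move=> mB mB' BB'.
have := @fh_linear_ge0 bool [:: true; false] (fun i => if i then 1 else -1)
  (fun i => if i then B' else B).
have h1 : forall i : bool, measurable (if i then B' else B) by case.
move=> /(_ h1) h.
have {}h : {ae nu, forall x, 0 <= \sum_(i <- [:: true; false])
    (if i then 1 else -1) * fh (if i then B' else B) x}.
  apply: h => C mC iC; rewrite !big_cons big_nil/= mul1r mulN1r addr0 subr_ge0.
  by apply: le_pr; [exact: measurableI|exact: measurableI|exact: setSI].
apply: filterS h => x; rewrite !big_cons big_nil/=; lra.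
Qed.

Lemma fh_setU B B' : measurable B -> measurable B' -> B `&` B' = set0 ->
  {ae nu, forall x, fh (B `|` B') x = fh B x + fh B' x}.
Proof.
move=> mB mB' BB'; have mU := measurableU _ _ mB mB'.
pose S (i : 'I_3) := if i == 0 then B `|` B' else if i == 1 then B else B'.
have mS i : measurable (S i) by rewrite /S; do 2 case: ifP => _ //.
have prS C : measurable C -> pr nu ((B `|` B') `&` C) = pr nu (B `&` C) + pr nu (B' `&` C).
  move=> mC; rewrite setIUl prU//; [exact: measurableI|exact: measurableI|].
  by rewrite setIACA BB' set0I.
have h (e : R) : {ae nu, forall x, 0 <= \sum_(i <- [:: 0; 1; 2] : seq 'I_3)
    (if i == 0 then e else - e) * fh (S i) x}.
  apply: fh_linear_ge0 => // C mC iC; rewrite !big_cons big_nil/= /S/=.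
  by rewrite prS//; lra.
apply: filterS2 (h 1) (h (-1)) => x; rewrite !big_cons !big_nil/= /S/=; lra.
Qed.

Lemma fh_setT : {ae nu, forall x, fh setT x = 1}.
Proof.
have : {ae nu, forall x, 0 <= fh setT x - 1}.
  apply: ae_ge0_invariant.
  - by apply: bmfB (bmf_cst _ _); exact: fh_bmf.
  - by move=> g x; rewrite fh_inv.
  - move=> C mC iC; have bC : bmf (\1_C : Y -> R) by exact: bmf_indic.
    rewrite (@eq_expect _ _ _ _ _ (fun x => fh setT x * \1_C x - \1_C x)).
      rewrite expectB//; last by apply: bmfM bC; exact: fh_bmf.
      by rewrite expect_fh// setTI expect_indic// subrr.
    by move=> x; rewrite mulrBl mul1r.
apply: filterS => x h; have /andP[_ h'] := fh_itv x measurableT.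
by apply/eqP; rewrite eq_le h'; rewrite subr_ge0 in h.
Qed.

Lemma fh_setC B : measurable B -> {ae nu, forall x, fh (~` B) x = 1 - fh B x}.
Proof.
move=> mB; apply: filterS2 fh_setT (fh_setU mB (measurableC mB) (setICr B)) => x.
by rewrite setUCr => -> ->; rewrite addrAC subrr add0r.
Qed.

Lemma fh_act g B : measurable B -> {ae nu, forall x, fh (a g @` B) x = fh B x}.
Proof.
move=> mB; have mgB := measurable_act_image a g mB.
have prg C : measurable C -> invariant_set a C -> pr nu (a g @` B `&` C) = pr nu (B `&` C).
  move=> mC iC; rewrite -(pr_act_preimage a g (measurableI _ _ mgB mC)).
  congr pr; rewrite act_imageE; apply/seteqP.
  by split=> x; rewrite /preimage/= mpactK iC.
pose S (i : bool) := if i then a g @` B else B.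
have mS i : measurable (S i) by case: i.
have h (e : R) : {ae nu, forall x, 0 <= \sum_(i <- [:: true; false])
    (if i then e else - e) * fh (S i) x}.
  apply: fh_linear_ge0 => // C mC iC; rewrite !big_cons big_nil/= prg//; lra.
apply: filterS2 (h 1) (h (-1)) => x; rewrite !big_cons !big_nil/= /S; lra.
Qed.

(** The points where every [fh (F n)] stays below [fh] of the union by a definite
    amount form an invariant set C. By continuity of the measure, F n and the
    union have nearly the same trace on C for large n, so that C is null. *)
Lemma fh_bigcup (F : nat -> set Y) : (forall n, measurable (F n)) ->
  (forall n, F n `<=` F n.+1) ->
  {ae nu, forall x, forall k, exists n, fh (\bigcup_n F n) x <= fh (F n) x + k.+1%:R^-1}.
Proof.
move=> mF ndF; apply: ae_foralln => k.
have mU : measurable (\bigcup_n F n) by exact: bigcupT_measurable.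
have k0 : 0 < k.+1%:R^-1 :> R by rewrite invr_gt0.
pose D n := [set x | k.+1%:R^-1 <= fh (\bigcup_n F n) x - fh (F n) x].
pose C := \bigcap_n D n.
have bD n : bmf (fun x => fh (\bigcup_n F n) x - fh (F n) x).
  by apply: bmfB; exact: fh_bmf.
have mC : measurable C.
  by apply: bigcapT_measurable => n; apply: measurable_ge; exact: (bD n).1.
have iC : invariant_set a C.
  by move=> g x; split=> Cx n _; have := Cx n I; rewrite /D/= !fh_inv.
have bC : bmf (\1_C : Y -> R) by exact: bmf_indic.
suff : ~ 0 < pr nu C.
  move=> /(ae_not_invariant mC iC); apply: filterS => x nCx.
  apply: contrapT => /forallNP h; apply: nCx => n _; rewrite /D/=.
  by have /negP := h n; rewrite -ltNge lerBrDr addrC; exact: ltW.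
move=> C0.
have [n|n||n Fn] := @pr_bigcup_gt _ _ _ nu (fun n => F n `&` C)
  (pr nu ((\bigcup_n F n) `&` C) - k.+1%:R^-1 * pr nu C).
- exact: measurableI.
- exact: setSI.
- by rewrite -setI_bigcupl ltrBlDr ltrDl mulr_gt0.
have : expect nu (fun x => k.+1%:R^-1 * \1_C x) <=
    expect nu (fun x => fh (\bigcup_n F n) x * \1_C x - fh (F n) x * \1_C x).
  apply: le_expect; first exact: bmfZ.
    by apply: bmfB; apply: bmfM => //; exact: fh_bmf.
  move=> x; rewrite -mulrBl indicE; case: (boolP (x \in C)); last by rewrite !mulr0.
  by rewrite inE !mulr1 => /(_ n I).
rewrite expectZ// expectB; [|by apply: bmfM => //; exact: fh_bmf..].
rewrite expect_indic// !expect_fh//; move: Fn.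
by move: (k.+1%:R^-1 * pr nu C) => s; lra.
Qed.

Lemma fh_bigcap (F : nat -> set Y) : (forall n, measurable (F n)) ->
  (forall n, F n.+1 `<=` F n) ->
  {ae nu, forall x, forall k, exists n, fh (F n) x <= fh (\bigcap_n F n) x + k.+1%:R^-1}.
Proof.
move=> mF niF; have mCF n : measurable (~` F n) by exact: measurableC.
have CF : \bigcup_n ~` F n = ~` \bigcap_n F n by rewrite setC_bigcap.
have := fh_bigcup mCF (fun n => subsetC (@niF n)); rewrite CF.
move=> h1; have h2 := fh_setC (bigcapT_measurable mF).
have h3 := ae_foralln (fun n => fh_setC (mF n)).
apply: filterS3 h1 h2 h3 => x h1 h2 h3 k; have [n hn] := h1 k; exists n.
move: hn; rewrite h2 h3; move: (k.+1%:R^-1 : R) => s; lra.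
Qed.

End invariant_sets.

Lemma ae_nonempty (R : realType) (d : measure_display)
    (Y : measurableType d) (nu : probability Y R) (P : Y -> Prop) :
  {ae nu, forall y, P y} -> exists y, P y.
Proof.
move=> /ae_conull[Z [mZ Z1 ZP]]; apply: contrapT => /forallNP nP.
have Z0 : Z = set0 by apply/seteqP; split=> // y /ZP /nP.
by move: Z1; rewrite Z0 pr_set0 => /esym/eqP; rewrite oner_eq0.
Qed.

(** * Probability measures on the line from conditional distribution functions *)

Lemma probability_of_cdf (R : realType) (F : R -> R) :
  {homo F : x y / x <= y} -> (forall x e, 0 < e -> exists2 y, x < y & F y <= F x + e) ->
  (forall x, 0 <= F x <= 1) ->
  (forall e, 0 < e -> exists x, F x <= e) -> (forall e, 0 < e -> exists x, 1 - e <= F x) ->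
  exists nu : probability R R, forall x, pr nu `]-oo, x] = F x.
Proof.
move=> ndF rcF F01 FNy Fy.
have rc : right_continuous F.
  move=> x; apply/cvgrPdist_le => e e0; have [y xy yF] := rcF x e e0.
  near=> z; rewrite distrC ger0_norm ?subr_ge0.
    rewrite lerBlDl (le_trans _ yF)//; apply: ndF.
    by near: z; exact: nbhs_right_le.
  by apply: ndF; near: z; exact: nbhs_right_ge.
have cNy : F @ -oo --> (0 : R).
  apply/cvgrPdist_le => e e0; have [x Fx] := FNy e e0.
  near=> z; rewrite sub0r normrN ger0_norm; last by have /andP[] := F01 z.
  apply: le_trans Fx; apply: ndF; near: z; apply: nbhs_ninfty_le; exact: num_real.
have cy : F @ +oo --> (1 : R).
  apply/cvgrPdist_le => e e0; have [x Fx] := Fy e e0.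
  near=> z; rewrite ger0_norm ?subr_ge0; last by have /andP[] := F01 z.
  rewrite lerBlDr -lerBlDl (le_trans Fx)//; apply: ndF; near: z; apply: nbhs_pinfty_ge; exact: num_real.
pose f : cumulativeBounded (0 : R) (1 : R) := HB.pack F
  (isCumulative.Build R _ R F ndF rc) (isCumulativeBounded.Build R 0 1 F cNy cy).
pose m := lebesgue_stieltjes_measure f.
have mid : measurable_fun setT (idfun : measurableTypeR R -> R) by move=> _ A mA; rewrite setTI.
have [nu nuP] := image_probability m mid.
exists nu => x; have := cdf_lebesgue_stieltjes_id f x.
rewrite -(mp_pr nuP); last exact: measurable_itv.
by rewrite /cdf /distribution /pushforward => e; rewrite /pr e.
Unshelve. all: by end_near. Qed.

Section disintegration.
Context (G : groupType) (R : realType) (m : probability R R) (a : mpaction G m).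
Context (fh : set R -> R -> R).
Hypothesis fhP : conditional_on_invariant a fh.

Let ray (r : R) : set R := `]-oo, r]%classic.
Let mray r : measurable (ray r). Proof. exact: measurable_itv. Qed.

Let good (x : R) := [/\
  forall q q' : rat, q <= q' -> fh (ray (ratr q)) x <= fh (ray (ratr q')) x,
  forall k, exists n : nat, 1 <= fh (ray n%:R) x + k.+1%:R^-1
  & forall k, exists n : nat, fh (ray (- n%:R)) x <= k.+1%:R^-1].

Let ae_good : {ae m, forall x, good x}.
Proof.
have h1 : {ae m, forall x, forall p : rat * rat, p.1 <= p.2 ->
    fh (ray (ratr p.1)) x <= fh (ray (ratr p.2)) x}.
  apply: ae_countType => -[q q'] /=; have [qq'|_] := boolP (q <= q').
    have : ray (ratr q) `<=` ray (ratr q').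
      by move=> z; rewrite /ray/= !in_itv/= => /le_trans; apply; rewrite ler_rat.
    by move/(fh_mono fhP (mray _) (mray _)); apply: filterS.
  by apply: aeW.
have h2 : {ae m, forall x, forall k, exists n : nat,
    fh (\bigcup_n ray n%:R) x <= fh (ray n%:R) x + k.+1%:R^-1}.
  apply: (fh_bigcup fhP) => // n z; rewrite /ray/= !in_itv/= => /le_trans; apply.
  by rewrite ler_nat.
have h3 : {ae m, forall x, forall k, exists n : nat,
    fh (ray (- n%:R)) x <= fh (\bigcap_n ray (- n%:R)) x + k.+1%:R^-1}.
  apply: (fh_bigcap fhP) => // n z; rewrite /ray/= !in_itv/= => /le_trans; apply.
  by rewrite lerN2 ler_nat.
have U : \bigcup_n ray n%:R = setT := bigcup_rays R.
have I0 : \bigcap_n ray (- n%:R) = ~` setT by rewrite setCT; exact: bigcap_raysN.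
rewrite U in h2; rewrite I0 in h3.
have h4 := fh_setT fhP; have h5 := fh_setC fhP measurableT.
apply: filterS3 (filterI h1 h2) h3 (filterI h4 h5) => x [h1x h2x] h3x [h4x h5x].
split.
- by move=> q q' qq'; exact: (h1x (q, q')).
- by move=> k; have [n] := h2x k; rewrite h4x; exists n.
- by move=> k; have [n] := h3x k; rewrite h5x h4x subrr add0r; exists n.
Qed.

Let values (x r : R) := [set fh (ray (ratr q)) x | q in [set q : rat | r < ratr q]].
Let F (x r : R) := inf (values x r).

Let F_inf x r : has_inf (values x r).
Proof.
split; last by exists 0 => _ [q _ <-]; have /andP[] := fh_itv fhP x (mray (ratr q)).
have [q /itvP hq] := @rat_in_itvoo _ r (r + 1) ltac:(by rewrite ltrDl).
by exists (fh (ray (ratr q)) x); exists q => //=; rewrite hq.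
Qed.

Let F_le x r q : r < ratr q -> F x r <= fh (ray (ratr q)) x.
Proof.
move=> rq; apply: ge_inf; last by exists q.
exact: (F_inf x r).2.
Qed.

Let F_ge x r s : (forall q : rat, r < ratr q -> s <= fh (ray (ratr q)) x) -> s <= F x r.
Proof.
by move=> h; apply: lb_le_inf; [exact: (F_inf x r).1|move=> _ [q /= rq <-]; exact: h].
Qed.

Let good_probability x : good x ->
  exists nu : probability R R, forall r, pr nu (ray r) = F x r.
Proof.
move=> [mono hy hNy]; apply: probability_of_cdf.
- move=> r s rs; apply: F_ge => q sq; apply: F_le; exact: le_lt_trans sq.
- move=> r e e0; have [_ [q /= rq <-] hq] := inf_adherent e0 (F_inf x r).
  exists ((r + ratr q) / 2); first lra.
  apply: le_trans (ltW hq); apply: F_le; lra.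
- move=> r; apply/andP; split.
    by apply: F_ge => q _; have /andP[] := fh_itv fhP x (mray (ratr q)).
  have [q /itvP hq] := @rat_in_itvoo _ r (r + 1) ltac:(by rewrite ltrDl).
  apply: le_trans (F_le x (_ : r < ratr q)) _; first by rewrite hq.
  by have /andP[] := fh_itv fhP x (mray (ratr q)).
- move=> e /small_inv[k ke]; have [n hn] := hNy k; exists (- n%:R - 1).
  have hq : - n%:R - 1 < ratr (- n%:R) :> R by rewrite rmorphN/= ratr_nat ltrBlDr ltrDl.
  apply: le_trans (F_le x hq) _; rewrite rmorphN/= ratr_nat.
  exact: le_trans hn (ltW ke).
- move=> e /small_inv[k ke]; have [n hn] := hy k; exists n%:R; apply: F_ge => q nq.
  have : fh (ray (ratr n%:R)) x <= fh (ray (ratr q)) x.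
    by apply: mono; rewrite -(ler_rat R) ratr_nat ltW.
  rewrite ratr_nat; move: hn ke; move: (k.+1%:R^-1 : R) => s; lra.
Qed.

Let F_ray r : {ae m, forall x, F x r = fh (ray r) x}.
Proof.
have up : {ae m, forall x, forall q : rat, r < ratr q -> fh (ray r) x <= fh (ray (ratr q)) x}.
  apply: ae_countType => q; have [rq|_] := boolP (r < ratr q); last exact: aeW.
  have : ray r `<=` ray (ratr q).
    by move=> z; rewrite /ray/= !in_itv/= => /le_trans; apply; exact: ltW.
  by move/(fh_mono fhP (mray _) (mray _)); apply: filterS.
pose s n : R := r + n.+1%:R^-1.
have lo : {ae m, forall x, forall p : nat * rat, ratr p.2 <= s p.1 ->
    fh (ray (ratr p.2)) x <= fh (ray (s p.1)) x}.
  apply: ae_countType => -[n q] /=; have [rq|_] := boolP (ratr q <= s n); last exact: aeW.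
  have : ray (ratr q) `<=` ray (s n).
    by move=> z; rewrite /ray/= !in_itv/= => /le_trans; apply.
  by move/(fh_mono fhP (mray _) (mray _)); apply: filterS.
have I : \bigcap_n ray (s n) = ray r := bigcap_rays r.
have : {ae m, forall x, forall k, exists n : nat,
    fh (ray (s n)) x <= fh (\bigcap_n ray (s n)) x + k.+1%:R^-1}.
  apply: (fh_bigcap fhP) => // n z; rewrite /ray/= !in_itv/= => /le_trans; apply.
  by rewrite lerD2l inv_le.
rewrite I; apply: filterS3 up lo => x upx lox capx.
apply/eqP; rewrite eq_le; apply/andP; split; last exact: F_ge.
apply/ler_addgt0Pr => e /small_inv[k ke]; have [n hn] := capx k.
have [q /itvP hq] := @rat_in_itvoo _ r (s n) ltac:(by rewrite ltrDl invr_gt0).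
have h1 := F_le x (_ : r < ratr q).
have h2 := lox (n, q) (_ : ratr q <= s n).
apply: le_trans (h1 _) _; first by rewrite hq.
apply: le_trans (h2 _) _; first by rewrite hq.
by apply: le_trans hn _; rewrite lerD2l ltW.
Qed.

(** The conditional distribution functions, defined at the rationals and
    extended to the right, define probability measures; that these compute the
    conditional expectations of all Borel sets follows by a Dynkin argument. *)
Lemma disintegration : exists Nu : R -> probability R R,
  forall B, measurable B -> {ae m, forall x, pr (Nu x) B = fh B x}.
Proof.
have /choice[Nu NuP] : forall x, exists nu : probability R R,
    good x -> forall r, pr nu (ray r) = F x r.
  move=> x; have [/good_probability[nu nuP]|ng] := pselect (good x).
    by exists nu.
  by exists m.
exists Nu => B /measurable_raysE; move: B.
apply: (@dynkin_induction _ _ (@rays R)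
  (fun B => {ae m, forall x, pr (Nu x) B = fh B x})).
- by apply/seteqP; split => B; rewrite -measurable_raysE.
- exact: setI_closed_rays.
- by apply: filterS (fh_setT fhP) => x ->; rewrite pr_setT.
- move=> _ [r _ <-]; apply: filterS2 ae_good (F_ray r) => x /NuP h <-; exact: h.
- move=> S mS; apply: filterS2 (fh_setC fhP mS) => x -> <-; exact: pr_setC.
move=> D mD tD aeD.
pose U n := \big[setU/set0]_(i < n) D i.
have mU n : measurable (U n) by apply: bigsetU_measurable.
have ndU n : U n `<=` U n.+1 by rewrite /U big_ord_recr; exact: subsetUl.
have UD : \bigcup_n U n = \bigcup_n D n.
  apply/seteqP; split=> z [n _].
    by rewrite /U -bigcup_mkord => -[i _ Dz]; exists i.
  by move=> Dz; exists n.+1 => //; rewrite /U -bigcup_mkord; exists n => /=.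
have U0 n : U n `&` D n = set0.
  rewrite /U -bigcup_mkord setI_bigcupl; apply/bigcup0P => i /= ni.
  by move/trivIsetP : tD; apply => //; rewrite ltn_eqF.
have aeU n : {ae m, forall x, pr (Nu x) (U n) = fh (U n) x}.
  elim: n => [|n IH].
    rewrite /U big_ord0 -setCT.
    apply: filterS2 (fh_setT fhP) (fh_setC fhP measurableT) => x h ->.
    by rewrite h subrr setCT pr_set0.
  have -> : U n.+1 = U n `|` D n by rewrite /U big_ord_recr.
  apply: filterS3 IH (aeD n) (fh_setU fhP (mU n) (mD n) (U0 n)) => x h1 h2 ->.
  by rewrite prU// h1 h2.
rewrite -UD; have mUU : measurable (\bigcup_n U n) by exact: bigcupT_measurable.
apply: filterS3 (ae_foralln aeU) (fh_bigcup fhP mU ndU)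
  (ae_foralln (fun n => fh_mono fhP (mU n) mUU (bigcup_sup I))) => x h1 h2 h3.
apply/eqP; rewrite eq_le; apply/andP; split.
  rewrite leNgt; apply/negP => /(pr_bigcup_gt mU ndU)[n]; rewrite h1.
  by apply/negP; rewrite -leNgt.
apply/ler_addgt0Pr => e /small_inv[k ke]; have [n hn] := h2 k.
apply: le_trans hn _; rewrite -h1; apply: lerD; last exact: ltW.
by apply: le_pr => //; exact: bigcup_sup.
Qed.

End disintegration.

(** * Approximating families *)

Definition approximating (R : realType) (d : measure_display) (Y : measurableType d)
    (nu : probability Y R) (I : Type) (b : I -> set Y) :=
  forall E e, measurable E -> 0 < e ->
    exists i, pr nu (E `\` b i) + pr nu (b i `\` E) <= e.

Section approximation.
Context (G : groupType) (R : realType) (d : measure_display).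
Context (Y : measurableType d) (nu : probability Y R) (a : mpaction G nu).

Lemma corr_close g (A A' B B' : set Y) : measurable A -> measurable A' ->
  measurable B -> measurable B' ->
  `|corr a g A B - corr a g A' B'| <=
  (pr nu (A `\` A') + pr nu (A' `\` A)) + (pr nu (B `\` B') + pr nu (B' `\` B)).
Proof.
move=> mA mA' mB mB'; apply: le_trans (pr_diff_le _ _ _) _; [exact: measurable_corr..|].
have half (A1 A2 B1 B2 : set Y) : measurable A1 -> measurable A2 ->
    measurable B1 -> measurable B2 ->
    pr nu ((a g @` A1 `&` B1) `\` (a g @` A2 `&` B2)) <=
    pr nu (A1 `\` A2) + pr nu (B1 `\` B2).
  move=> m1 m2 n1 n2; rewrite -(pr_act_image a g (measurableD m1 m2)).
  have mD := measurable_act_image a g (measurableD m1 m2).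
  apply: le_trans (prU_le _ _ _) => //; last exact: measurableD.
  apply: le_pr; [by apply: measurableD; exact: measurable_corr|
    by apply: measurableU => //; exact: measurableD|].
  move=> y; rewrite !act_imageE /preimage/= => -[[h1 h2] /not_andP[h3|h3]].
    by left.
  by right.
by have := half _ _ _ _ mA mA' mB mB'; have := half _ _ _ _ mA' mA mB' mB; lra.
Qed.

Context (I : Type) (b : I -> set Y).
Hypotheses (mb : forall i, measurable (b i)) (bP : approximating nu b).

Lemma pairing_approximating k (phi : test G R k) (B : 'I_k -> set Y) (e : R) :
  (forall j, measurable (B j)) -> 0 < e ->
  exists s : 'I_k -> I, pairing a phi B <= pairing a phi (b \o s) + e.
Proof.
move=> mB e0; pose N := test_norm phi; have N0 : 0 <= N := test_norm_ge0 phi.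
pose d0 := e / (2 * (N + 1)).
have d00 : 0 < d0 by rewrite divr_gt0// mulr_gt0// ltr_wpDl.
have /choice[s sP] : forall j, exists i,
    pr nu (B j `\` b i) + pr nu (b i `\` B j) <= d0.
  by move=> j; exact: bP.
exists s; apply: le_trans (@pairing_close _ _ _ _ _ _ _ _ a a k phi B (b \o s) (2 * d0) _) _.
  move=> p _; apply: le_trans (corr_close _ _ _ _ _) _ => //=.
  by have := sP p.1.2; have := sP p.2; lra.
rewrite lerD2l -/N; have -> : e = 2 * d0 * (N + 1).
  by rewrite /d0; field; rewrite gt_eqF// ltr_wpDl.
by apply: ler_wpM2l; lra.
Qed.

(** Dispersions depend continuously on the set, so that the averages of every
    measurable set can be made nearly constant. The averages of an invariant set D
    are all equal to its indicator, which is nearly constant only if D is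
    trivial: its dispersion is at least [s (1 - s)] where s is its measure. *)
Lemma ergodic_of_dispersion :
  (forall i e, 0 < e -> exists2 l, convex_weights l & dispersion a l (pr nu (b i)) (b i) <= e) ->
  ergodic a.
Proof.
move=> bV D mD iD; pose s := pr nu D.
have s01 : 0 <= s <= 1 by rewrite pr_ge0 pr_le1.
have sd (e : R) : 0 < e -> s * (1 - s) <= e.
  move=> e0; have e50 : 0 < e / 5 by rewrite divr_gt0.
  have [i hi] := bP mD e50; have [l lc lV] := bV i _ e50.
  pose r := pr nu (b i); have r01 : 0 <= r <= 1 by rewrite pr_ge0 pr_le1.
  have clo g : `|corr a g D D - corr a g (b i) (b i)| <= 2 * (e / 5).
    by apply: le_trans (corr_close _ _ _ _ _) _ => //; lra.
  have cD g : corr a g D D = s by rewrite /corr iD setIid.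
  have ll1 : \sum_(p <- l) \sum_(q <- l) p.1 * q.1 = 1.
    by rewrite -(mul1r 1) -{1}lc.2 -lc.2 mulr_suml; apply: eq_bigr => p _; rewrite mulr_sumr.
  have : dispersion a l r (b i) >= s - 2 * (e / 5) - 2 * r * corr a 1%g (b i) (b i) + r ^+ 2.
    rewrite /dispersion lerD2r lerD2r.
    have -> : s - 2 * (e / 5) = \sum_(p <- l) \sum_(q <- l) p.1 * q.1 * (s - 2 * (e / 5)).
      under eq_bigr do rewrite -mulr_suml.
      by rewrite -mulr_suml ll1 mul1r.
    rewrite big_seq [leRHS]big_seq; apply: ler_sum => p pl.
    rewrite big_seq [leRHS]big_seq; apply: ler_sum => q ql.
    apply: ler_wpM2l; first by rewrite mulr_ge0// lc.1.
    by have := clo (q.2^-1 * p.2)%g; rewrite cD ler_norml => /andP[]; lra.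
  rewrite corr1 -/r; have rs : `|r - s| <= e / 5.
    by rewrite distrC; apply: le_trans (pr_diff_le _ _ _) _.
  move: lV rs; rewrite -/r ler_norml => lV /andP[rs1 rs2] h.
  have : 0 <= (s - r) ^+ 2 by exact: sqr_ge0.
  by move: h lV; nra.
have : s * (1 - s) = 0.
  apply/eqP; rewrite eq_le mulr_ge0/=; [|lra..]; rewrite andbT.
  by apply/ler_addgt0Pr => e /sd; rewrite add0r.
move=> /eqP; rewrite mulf_eq0 prE// -/s subr_eq0 => /orP[/eqP->|/eqP<-]; by [left|right].
Qed.

End approximation.

(** * A countable algebra of Borel sets *)

Section rational_sets.
Context (R : realType).

Lemma rational_ray (nu : probability R R) (r e : R) : 0 < e ->
  exists2 q : rat, r < ratr q & pr nu `]-oo, ratr q] < pr nu `]-oo, r] + e.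
Proof.
move=> e0; have mray := @measurable_itv R.
pose F n : set R := `]-oo, r + n.+1%:R^-1]%classic.
have [n|n z||n hn] := @pr_bigcap_lt _ _ _ nu F (pr nu `]-oo, r] + e).
- exact: mray.
- rewrite /F/= !in_itv/= => /le_trans; apply; by rewrite lerD2l inv_le.
- by rewrite bigcap_rays ltrDl.
have [q /itvP hq] := @rat_in_itvoo _ r (r + n.+1%:R^-1) ltac:(by rewrite ltrDl invr_gt0).
exists q; first by rewrite hq.
apply: le_lt_trans hn; apply: le_pr; [exact: mray|exact: mray|].
by move=> z; rewrite /F/= !in_itv/= => /le_trans; apply; rewrite hq.
Qed.

(** The algebra generated by the rational half-lines. Its sets are named by terms,
    which form a countable type; one binary operation, the complement of the
    union, suffices to form complements and unions. *)
Fixpoint rational_set (t : GenTree.tree rat) : set R :=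
  match t with
  | GenTree.Leaf q => `]-oo, ratr q]
  | GenTree.Node _ (t1 :: t2 :: _) => ~` (rational_set t1 `|` rational_set t2)
  | _ => set0
  end.

Lemma measurable_rational_set t : measurable (rational_set t).
Proof.
move: t; fix IH 1; case=> [q|n [|t1 [|t2 s]]] /=.
- exact: measurable_itv.
- exact: measurable0.
- exact: measurable0.
- by apply: measurableC; apply: measurableU; exact: IH.
Qed.

Let compl t : rational_set (GenTree.Node 0 [:: t; t]) = ~` rational_set t.
Proof. by rewrite /= setUid. Qed.

Let union t u : exists v, rational_set v = rational_set t `|` rational_set u.
Proof.
pose w := GenTree.Node 0 [:: t; u]; exists (GenTree.Node 0 [:: w; w]).
by rewrite compl /= setCK.
Qed.

(** The sets that can be approximated form a sigma-algebra: a countable union is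
    approximated by finite ones. It contains the half-lines by [rational_ray]. *)
Lemma rational_set_approximating (nu : probability R R) :
  approximating nu rational_set.
Proof.
have mr := measurable_rational_set.
pose S : set (set R) := [set E | measurable E /\ forall e, 0 < e ->
  exists t, pr nu (E `\` rational_set t) + pr nu (rational_set t `\` E) <= e].
suff RS : <<s @rays R >> `<=` S by move=> E e /measurable_raysE /RS[_]; apply.
apply: smallest_sub.
  split.
  - split=> [|e e0]; first exact: measurable0.
    exists (GenTree.Node 0 [::]); rewrite /= setDv pr_set0 addr0; exact: ltW.
  - move=> A [mA hA]; split; first by rewrite setTD; exact: measurableC.
    move=> e /hA[t ht]; exists (GenTree.Node 0 [:: t; t]); rewrite compl setTD.
    by rewrite [X in X + _](_ : _ = pr nu (rational_set t `\` A)) 1?addrC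
      ?[X in X + _](_ : _ = pr nu (A `\` rational_set t))//;
      congr pr; rewrite !setDE setCK setIC.
  - move=> F hF; have mF n := (hF n).1; have mU := bigcupT_measurable F mF.
    split=> // e e0; have e20 : 0 < e / 2 by rewrite divr_gt0.
    pose U n := \big[setU/set0]_(i < n) F i.
    have mUn n : measurable (U n) by apply: bigsetU_measurable.
    have fin n d0 : 0 < d0 -> exists t,
        pr nu (U n `\` rational_set t) + pr nu (rational_set t `\` U n) <= d0.
      elim: n d0 => [|n IH] d0 d00.
        by exists (GenTree.Node 0 [::]); rewrite /U big_ord0 /= setDv pr_set0 addr0 ltW.
      have d20 : 0 < d0 / 2 by rewrite divr_gt0.
      have [t ht] := IH _ d20; have [u hu] := (hF n).2 _ d20.
      have [v hv] := union t u; exists v; rewrite hv /U big_ord_recr/= -/(U n).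
      have sub (A B A' B' : set R) : measurable A -> measurable B -> measurable A' ->
          measurable B' ->
          pr nu ((A `|` B) `\` (A' `|` B')) <= pr nu (A `\` A') + pr nu (B `\` B').
        move=> m1 m2 m3 m4; apply: le_trans (prU_le _ _ _); [|exact: measurableD..].
        apply: le_pr; [by apply: measurableD; exact: measurableU|
          by apply: measurableU; exact: measurableD|].
        by move=> y [[h1|h1] /not_orP[h2 h3]]; [left|right].
      have := sub _ _ _ _ (mUn n) (mF n) (mr t) (mr u).
      have := sub _ _ _ _ (mr t) (mr u) (mUn n) (mF n).
      by lra.
    have UF : \bigcup_n U n = \bigcup_n F n.
      apply/seteqP; split=> z [n _].
        by rewrite /U -bigcup_mkord => -[i _ Dz]; exists i.
      by move=> Dz; exists n.+1 => //; rewrite /U -bigcup_mkord; exists n => /=.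
    have ndU n : U n `<=` U n.+1 by rewrite /U big_ord_recr; exact: subsetUl.
    have [|n hn] := @pr_bigcup_gt _ _ _ nu U (pr nu (\bigcup_n F n) - e / 2) mUn ndU.
      by rewrite UF ltrBlDr ltrDl.
    have [t ht] := fin n _ e20; exists t.
    have UnF : U n `<=` \bigcup_n F n by rewrite -UF; exact: bigcup_sup.
    have h1 := pr_setID nu mU (mUn n).
    have h2 : (\bigcup_n F n) `&` U n = U n by apply/setIidPr.
    rewrite h2 in h1.
    have h3 : pr nu ((\bigcup_n F n) `\` rational_set t) <=
        pr nu (U n `\` rational_set t) + pr nu ((\bigcup_n F n) `\` U n).
      apply: le_trans (prU_le _ _ _); [|exact: measurableD..].
      apply: le_pr; [exact: measurableD|by apply: measurableU; exact: measurableD|].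
      by move=> z [Fz tz]; have [Uz|Uz] := pselect (U n z); [left|right].
    have h4 : pr nu (rational_set t `\` (\bigcup_n F n)) <= pr nu (rational_set t `\` U n).
      by apply: le_pr; [exact: measurableD|exact: measurableD|exact: setDS].
    by lra.
move=> _ [r _ <-]; have mray := @measurable_itv R; split; first exact: mray.
move=> e /(rational_ray nu r)[q rq hq]; exists (GenTree.Leaf q).
have sub : `]-oo, r] `<=` rational_set (GenTree.Leaf q).
  by move=> z; rewrite /= !in_itv/= => /le_trans; apply; exact: ltW.
have := pr_setID nu (mr (GenTree.Leaf q)) (mray (`]-oo, r])).
rewrite setIidr// => h; have -> : `]-oo, r]%classic `\` rational_set (GenTree.Leaf q) = set0.
  by rewrite -subset0 => z [/sub].
by rewrite pr_set0; move: hq h; rewrite /=; lra.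
Qed.

Lemma probability_rational_unique (m1 m2 : probability R R) :
  (forall q : rat, pr m1 `]-oo, ratr q] = pr m2 `]-oo, ratr q]) ->
  forall A, measurable A -> m1 A = m2 A.
Proof.
move=> m12; have mray := @measurable_itv R.
have le (n1 n2 : probability R R) r :
    (forall q : rat, pr n1 `]-oo, ratr q] = pr n2 `]-oo, ratr q]) ->
    pr n1 `]-oo, r] <= pr n2 `]-oo, r].
  move=> n12; apply/ler_addgt0Pr => e /(rational_ray n2 r)[q rq hq].
  apply: le_trans (ltW hq); rewrite -n12; apply: le_pr; [exact: mray|exact: mray|].
  by move=> z; rewrite /= !in_itv/= => /le_trans; apply; exact: ltW.
apply: probability_rays_unique => s; apply/eqP; rewrite eq_le.
by rewrite !le.
Qed.

End rational_sets.

(** * An ergodic component in the class of an extreme action *)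

Section ergodic_component.
Context (G : groupType) (R : realType) (m : probability R R) (a : mpaction G m).
Hypothesis hG : countable [set: G].
Context (fh : set R -> R -> R).
Hypothesis fhP : conditional_on_invariant a fh.

Let mact g B : measurable B -> measurable (a g @` B).
Proof. exact: measurable_act_image. Qed.

(** The value of phi at the sets B for the conditional measure at x. *)
Let fpair k (phi : test G R k) (B : 'I_k -> set R) (x : R) : R :=
  \sum_(p <- phi) p.1.1.1 * fh (a p.1.1.2 @` B p.1.2 `&` B p.2) x.

Let bmf_fpair k (phi : test G R k) (B : 'I_k -> set R) : (forall j, measurable (B j)) ->
  bmf (fpair phi B).
Proof.
by move=> mB; apply: bmf_sum => p; apply: bmfZ; apply: (fh_bmf fhP); exact: measurable_corr.
Qed.

Let fpair_inv k (phi : test G R k) (B : 'I_k -> set R) : (forall j, measurable (B j)) ->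
  invariant_fun a (fpair phi B).
Proof.
move=> mB g x; apply: eq_bigr => p _; congr (_ * _); apply: (fh_inv fhP).
exact: measurable_corr.
Qed.

Let expect_fpair k (phi : test G R k) (B : 'I_k -> set R) C :
  (forall j, measurable (B j)) -> measurable C -> invariant_set a C ->
  expect m (fun x => fpair phi B x * \1_C x) =
  \sum_(p <- phi) p.1.1.1 * pr m ((a p.1.1.2 @` B p.1.2 `&` B p.2) `&` C).
Proof. by move=> mB mC iC; apply: (expect_fh_sum fhP) => // p; exact: measurable_corr. Qed.

(** On an invariant set, averages of the translates of B are close to the
    conditional expectation of B in the mean; so they cannot all be far from it
    at all points of the set. *)
Lemma conditional_dispersion B e : measurable B -> 0 < e ->
  {ae m, forall x, exists2 l, convex_weights l &
    \sum_(p <- l) \sum_(q <- l) p.1 * q.1 * fh (a p.2 @` B `&` a q.2 @` B) x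
    - fh B x ^+ 2 <= e}.
Proof.
move=> mB e0; have [_ _ _ fhE apx] := fhP mB.
have /choice[l lP] : forall n : nat, exists l, convex_weights l /\
    expect m (fun x => (average a l B x - fh B x) ^+ 2) <= n.+1%:R^-1.
  by move=> n; have [l l1 l2] := apx n.+1%:R^-1 ltac:(by rewrite invr_gt0); exists l.
pose V l x := \sum_(p <- l) \sum_(q <- l)
  p.1 * q.1 * fh (a p.2 @` B `&` a q.2 @` B) x - fh B x ^+ 2.
have mI g h : measurable (a g @` B `&` a h @` B) by apply: measurableI; exact: mact.
have bI g h : bmf (fh (a g @` B `&` a h @` B)) by exact: (fh_bmf fhP).
have bB := fh_bmf fhP mB; have iB := fh_inv fhP mB.
have bV l' : bmf (V l').
  rewrite /V; apply: bmfB; last exact: bmfX2.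
  by apply: bmf_sum => p; apply: bmf_sum => q; apply: bmfZ.
have iV l' : invariant_fun a (V l').
  move=> g x; rewrite /V iB; congr (_ - _); apply: eq_bigr => p _.
  by apply: eq_bigr => q _; rewrite (fh_inv fhP).
pose C := \bigcap_n [set x | e <= V (l n) x].
have mC : measurable C.
  by apply: bigcapT_measurable => n; apply: measurable_ge; exact: (bV _).1.
have iC : invariant_set a C.
  by move=> g x; split=> Cx n _; have := Cx n I; rewrite /= iV.
have bC : bmf (\1_C : R -> R) by exact: bmf_indic.
have iiC := indic_invariant iC.
suff : ~ 0 < pr m C.
  move=> /(ae_not_invariant mC iC); apply: filterS => x nCx; apply: contrapT => h.
  apply: nCx => n _; rewrite /= leNgt; apply/negP => /ltW h'; apply: h.
  by exists (l n) => //; exact: (lP n).1.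
move=> C0; have [n hn] := @small_inv R (e * pr m C) ltac:(by rewrite mulr_gt0).
have [ln1 ln2] := lP n; have bA := bmf_average a (l n) mB.
(* [fh B] is the orthogonal projection of the average on the invariant functions *)
have EV : expect m (fun x => V (l n) x * \1_C x) =
    expect m (fun x => (average a (l n) B x - fh B x) ^+ 2 * \1_C x).
  have E1 : expect m (fun x => average a (l n) B x * (fh B x * \1_C x)) =
      expect m (fun x => fh B x * (fh B x * \1_C x)).
    have bu : bmf (fun x => fh B x * \1_C x) by exact: bmfM.
    have iu : invariant_fun a (fun x => fh B x * \1_C x).
      by move=> g x; rewrite iB iiC.
    by rewrite expect_average_inv// fhE.
  have E2 : expect m (fun x => (\sum_(p <- l n) \sum_(q <- l n)
        p.1 * q.1 * fh (a p.2 @` B `&` a q.2 @` B) x) * \1_C x) =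
      expect m (fun x => average a (l n) B x ^+ 2 * \1_C x).
    transitivity (\sum_(p <- l n) \sum_(q <- l n)
        p.1 * q.1 * pr m ((a p.2 @` B `&` a q.2 @` B) `&` C)).
      rewrite (@eq_expect _ _ _ _ _ (fun x => \sum_(p <- l n) \sum_(q <- l n)
          p.1 * q.1 * (fh (a p.2 @` B `&` a q.2 @` B) x * \1_C x))); last first.
        move=> x; rewrite mulr_suml; apply: eq_bigr => p _; rewrite mulr_suml.
        by apply: eq_bigr => q _; rewrite mulrA.
      rewrite expect_sum => [|p]; last first.
        by apply: bmf_sum => q; apply: bmfZ; apply: bmfM.
      apply: eq_bigr => p _; rewrite expect_sum => [|q]; last first.
        by apply: bmfZ; apply: bmfM.
      apply: eq_bigr => q _; rewrite expectZ; last exact: bmfM.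
      by rewrite (expect_fh fhP).
    rewrite (@eq_expect _ _ _ _ _ (fun x => \sum_(p <- l n) \sum_(q <- l n)
        p.1 * q.1 * \1_((a p.2 @` B `&` a q.2 @` B) `&` C) x)); last first.
      move=> x; rewrite expr2 {1}/average mulr_suml mulr_suml; apply: eq_bigr => p _.
      rewrite mulr_sumr mulr_suml; apply: eq_bigr => q _; rewrite !indicI /=; ring.
    have mIC p q : measurable ((a p @` B `&` a q @` B) `&` C) by exact: measurableI.
    rewrite expect_sum => [|p]; last first.
      by apply: bmf_sum => q; apply: bmfZ; exact: bmf_indic.
    apply: eq_bigr => p _; rewrite expect_sum => [|q]; last first.
      by apply: bmfZ; exact: bmf_indic.
    apply: eq_bigr => q _; rewrite expectZ ?expect_indic//; exact: bmf_indic.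
  have bS : bmf (fun x => (\sum_(p <- l n) \sum_(q <- l n)
        p.1 * q.1 * fh (a p.2 @` B `&` a q.2 @` B) x) * \1_C x).
    by apply: bmfM => //; apply: bmf_sum => p; apply: bmf_sum => q; apply: bmfZ.
  rewrite (@eq_expect _ _ _ _ _ (fun x => (\sum_(p <- l n) \sum_(q <- l n)
        p.1 * q.1 * fh (a p.2 @` B `&` a q.2 @` B) x) * \1_C x
        - fh B x * (fh B x * \1_C x))); last first.
    by move=> x; rewrite /V; ring.
  have bfC : bmf (fun x => fh B x * (fh B x * \1_C x)) by do 2 apply: bmfM => //.
  have bafC : bmf (fun x => average a (l n) B x * (fh B x * \1_C x)).
    by do 2 apply: bmfM => //.
  have baC : bmf (fun x => average a (l n) B x ^+ 2 * \1_C x).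
    by apply: bmfM => //; exact: bmfX2.
  rewrite expectB// E2 [RHS](@eq_expect _ _ _ _ _ (fun x =>
      average a (l n) B x ^+ 2 * \1_C x
      + (- 2) * (average a (l n) B x * (fh B x * \1_C x))
      + fh B x * (fh B x * \1_C x))); last by move=> x; ring.
  rewrite expectD//; last by apply: bmfD => //; exact: bmfZ.
  rewrite expectD//; last exact: bmfZ.
  by rewrite expectZ// E1; ring.
have : e * pr m C <= n.+1%:R^-1; last by rewrite leNgt hn.
apply: le_trans ln2; rewrite -expect_indic// -expectZ//.
apply: (@le_trans _ _ (expect m (fun x => V (l n) x * \1_C x))).
  apply: le_expect; [exact: bmfZ|exact: bmfM|move=> x].
  rewrite indicE; case: (boolP (x \in C)); last by rewrite !mulr0.
  by rewrite inE !mulr1 => /(_ n I).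
have b2 : bmf (fun x => (average a (l n) B x - fh B x) ^+ 2).
  by apply: bmfX2; exact: bmfB.
rewrite EV; apply: le_expect => // [|x]; first exact: bmfM.
rewrite indicE; case: (x \in C); rewrite ?mulr1 ?mulr0//; exact: sqr_ge0.
Qed.

Hypothesis cond : forall C, measurable C -> invariant_set a C -> 0 < pr m C ->
  exists (mC : probability R R) (aC : mpaction G mC),
    [/\ forall A, measurable A -> pr mC A = pr m (A `&` C) / pr m C,
        forall g, aC g = a g :> (R -> R) & supp_eq aC a].

Let pairing_cond k (phi : test G R k) (B : 'I_k -> set R) C
    (mC : probability R R) (aC : mpaction G mC) :
  (forall j, measurable (B j)) -> measurable C -> 0 < pr m C ->
  (forall A, measurable A -> pr mC A = pr m (A `&` C) / pr m C) ->
  (forall g, aC g = a g :> (R -> R)) ->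
  \sum_(p <- phi) p.1.1.1 * pr m ((a p.1.1.2 @` B p.1.2 `&` B p.2) `&` C) =
  pairing aC phi B * pr m C.
Proof.
move=> mB mC' C0 mCE aCE; rewrite /pairing mulr_suml; apply: eq_bigr => p _.
rewrite -mulrA; congr (_ * _); rewrite /corr aCE mCE; last exact: measurable_corr.
by rewrite divfK// gt_eqF.
Qed.

(** The integral of fpair over an invariant set is a multiple of the value of phi
    for the conditional action there, which is at most its support function,
    that of a. *)
Let fpair_le k (phi : test G R k) (B : 'I_k -> set R) : (forall j, measurable (B j)) ->
  {ae m, forall x, fpair phi B x <= supp a phi}.
Proof.
move=> mB; have : {ae m, forall x, 0 <= supp a phi - fpair phi B x}.
  apply: (@ae_ge0_invariant _ _ _ _ _ a).
  - by apply: bmfB; [exact: bmf_cst|exact: bmf_fpair].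
  - by move=> g x; rewrite fpair_inv.
  move=> C mC iC; have bC : bmf (\1_C : R -> R) by exact: bmf_indic.
  rewrite (@eq_expect _ _ _ _ _ (fun x => supp a phi * \1_C x - fpair phi B x * \1_C x)).
    rewrite expectB//; [|exact: bmfZ|by apply: bmfM => //; exact: bmf_fpair].
    rewrite expectZ// expect_indic// expect_fpair//.
    have [C0|C0] := ltP 0 (pr m C).
      have [nC [aC [nCE aCE aCs]]] := cond mC iC C0.
      rewrite (pairing_cond _ _ _ _ nCE aCE)// -mulrBl mulr_ge0 ?pr_ge0// subr_ge0.
      by rewrite -aCs; exact: pairing_le_supp.
    have {}C0 : pr m C = 0 by apply/eqP; rewrite eq_le C0 pr_ge0.
    rewrite C0 mulr0 big1 ?subr0// => p _.
    have mS : measurable (a p.1.1.2 @` B p.1.2 `&` B p.2) by exact: measurable_corr.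
    rewrite (_ : pr m _ = 0) ?mulr0//; apply/eqP; rewrite eq_le pr_ge0 andbT -C0.
    by apply: le_pr => //; exact: measurableI.
  by move=> x; rewrite mulrBl.
by apply: filterS => x; rewrite subr_ge0.
Qed.

(** The set of points at which the correlations of all tuples of rational sets
    miss the support function by e is invariant; the conditional action on it
    would have a smaller support function. *)
Let fpair_near k (phi : test G R k) (e : R) : 0 < e ->
  {ae m, forall x, exists s : 'I_k -> GenTree.tree rat,
    supp a phi - e <= fpair phi (fun j => rational_set (s j) : set R) x}.
Proof.
move=> e0; pose b (s : {ffun 'I_k -> GenTree.tree rat}) (j : 'I_k) : set R := rational_set (s j).
have mb s j : measurable (b s j) by exact: measurable_rational_set.
pose C := \bigcap_s [set x | fpair phi (b s) x <= supp a phi - e].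
have mC : measurable C.
  apply: bigcap_countType_measurable => s; apply: measurable_le.
  by apply: (bmf_fpair _ _).1.
have iC : invariant_set a C.
  by move=> g x; split=> Cx s _; have := Cx s I; rewrite /= fpair_inv.
have bC : bmf (\1_C : R -> R) by exact: bmf_indic.
suff : ~ 0 < pr m C.
  move=> /(ae_not_invariant mC iC); apply: filterS => x nCx; apply: contrapT => h.
  apply: nCx => s _; rewrite /= leNgt; apply/negP => /ltW h'; apply: h.
  by exists s.
move=> C0; have [nC [aC [nCE aCE aCs]]] := cond mC iC C0.
have e20 : 0 < e / 2 by rewrite divr_gt0.
have [B mB hB] := supp_adherent aC phi e20.
have [s hs] := pairing_approximating aC (@measurable_rational_set R)
  (rational_set_approximating nC) phi mB e20.
pose s' := [ffun j => s j].
have bs : b s' = (rational_set (R := R) \o s) by apply/funext => j; rewrite /b ffunE.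
have : expect m (fun x => fpair phi (b s') x * \1_C x) <=
    expect m (fun x => (supp a phi - e) * \1_C x).
  apply: le_expect; [by apply: bmfM => //; exact: bmf_fpair|exact: bmfZ|move=> x].
  rewrite indicE; case: (boolP (x \in C)); last by rewrite !mulr0.
  by rewrite inE !mulr1 => /(_ s' I).
rewrite expectZ// expect_indic// expect_fpair// (pairing_cond _ _ _ _ nCE aCE)//.
by rewrite ler_pM2r// bs; move: hB; rewrite aCs; lra.
Qed.

(** The action is a itself, with the measure [Nu x] at a point x where countably
    many almost sure properties hold. They are required of the rational sets and
    of integer coefficients only; the former approximate all Borel sets for
    every measure, and by [swc_of_supp] the latter suffice to determine the
    class. *)
Lemma ergodic_component : exists (nu : probability R R) (e : mpaction G nu),
  ergodic e /\ supp_eq e a.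
Proof.
have [Nu NuP] := disintegration fhP; have [en enP] := countable_enum hG.
pose T := GenTree.tree rat; pose b : T -> set R := @rational_set R.
have mb t : measurable (b t) by exact: measurable_rational_set.
pose decode k (phi : seq (int * nat * 'I_k * 'I_k)) : test G R k :=
  [seq (p.1.1.1%:~R, en p.1.1.2, p.1.2, p.2) | p <- phi].
have c1 : {ae m, forall x, forall t, pr (Nu x) (b t) = fh (b t) x}.
  by apply: ae_countType => t; exact: NuP.
have c2 : {ae m, forall x, forall g h t,
    pr (Nu x) (a g @` b t `&` a h @` b t) = fh (a g @` b t `&` a h @` b t) x}.
  apply: ae_countable => // g; apply: ae_countable => // h; apply: ae_countType => t.
  by apply: NuP; apply: measurableI; exact: mact.
have c3 : {ae m, forall x, forall g t u,
    pr (Nu x) (a g @` b t `&` b u) = fh (a g @` b t `&` b u) x}.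
  apply: ae_countable => // g; apply: ae_countType => t; apply: ae_countType => u.
  by apply: NuP; exact: measurable_corr.
have c4 : {ae m, forall x, forall g t, pr (Nu x) (a g @` b t) = fh (b t) x}.
  apply: ae_countable => // g; apply: ae_countType => t.
  by apply: filterS2 (NuP _ (mact g (mb t))) (fh_act fhP g (mb t)) => x ->.
have c5 : {ae m, forall x, forall t n, exists2 l, convex_weights l &
    \sum_(p <- l) \sum_(q <- l) p.1 * q.1 * fh (a p.2 @` b t `&` a q.2 @` b t) x
    - fh (b t) x ^+ 2 <= n.+1%:R^-1}.
  apply: ae_countType => t; apply: ae_foralln => n.
  by apply: conditional_dispersion => //; rewrite invr_gt0.
have c6 : {ae m, forall x, forall (w : {k : nat & seq (int * nat * 'I_k * 'I_k)})
    (s : {ffun 'I_(tag w) -> T}),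
    fpair (decode (tag w) (tagged w)) (fun j => b (s j)) x <=
    supp a (decode (tag w) (tagged w))}.
  apply: ae_countType => w; apply: ae_countType => s; exact: fpair_le.
have c7 : {ae m, forall x, forall (w : {k : nat & seq (int * nat * 'I_k * 'I_k)}) n,
    exists s : 'I_(tag w) -> T, supp a (decode (tag w) (tagged w)) - n.+1%:R^-1 <=
      fpair (decode (tag w) (tagged w)) (fun j => b (s j)) x}.
  apply: ae_countType => w; apply: ae_foralln => n.
  by apply: fpair_near; rewrite invr_gt0.
have [x [[[h1 h2] [h3 h4]] [h5 [h6 h7]]]] := ae_nonempty
  (filterI (filterI (filterI c1 c2) (filterI c3 c4)) (filterI c5 (filterI c6 c7))).
pose nu := Nu x.
have mp g : measure_preserving nu nu (a g).
  split=> [|A mA]; first exact: measurable_act.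
  have [m' m'P] := image_probability nu (measurable_act a g).
  rewrite (m'P.2 _ mA); apply: (probability_rational_unique _ mA) => q.
  rewrite -(mp_pr m'P); last exact: measurable_itv.
  have -> : a g @^-1` `]-oo, ratr q] = a g^-1%g @` b (GenTree.Leaf q).
    by rewrite act_imageE invgK.
  by rewrite h4 -h1.
pose e := MPAction (mpact1 a) (mpactM a) mp.
have apx := rational_set_approximating nu.
have fpairE k (phi : test G R k) (s : 'I_k -> T) :
    fpair phi (fun j => b (s j)) x = pairing e phi (fun j => b (s j)).
  by apply: eq_bigr => p _; congr (_ * _); rewrite -h3.
have sE k (phi : seq (int * G * 'I_k * 'I_k)) :
    supp e (int_test R phi) = supp a (int_test R phi).
  have /choice[co coP] : forall g, exists n, en n = g by [].
  pose w : {k : nat & seq (int * nat * 'I_k * 'I_k)} :=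
    Tagged (fun k => seq (int * nat * 'I_k * 'I_k))
      [seq (p.1.1.1, co p.1.1.2, p.1.2, p.2) | p <- phi].
  have wE : decode (tag w) (tagged w) = int_test R phi.
    by rewrite /decode /= -map_comp; apply: eq_map => p /=; rewrite coP.
  have {}h6 := h6 w; have {}h7 := h7 w; rewrite wE /= in h6 h7.
  apply/eqP; rewrite eq_le; apply/andP; split.
    apply: supp_le => B mB; apply/ler_addgt0Pr => eps eps0.
    have [s hs] := pairing_approximating e mb apx (int_test R phi) mB eps0.
    apply: le_trans hs _; rewrite lerD2r; have := h6 [ffun j => s j].
    by rewrite (_ : (fun j => _) = (fun j => b (s j))) ?fpairE//; apply/funext => j; rewrite ffunE.
  apply/ler_addgt0Pr => eps /small_inv[n hn]; have [s] := h7 n.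
  rewrite fpairE lerBlDr => /le_trans; apply; apply: lerD; last exact: ltW.
  by apply: pairing_le_supp => j; exact: mb.
exists nu, e; split.
  apply: (ergodic_of_dispersion mb apx) => t eps /small_inv[n hn].
  have [l l1 l2] := h5 t n; exists l => //; apply: le_trans (ltW hn); apply: le_trans l2.
  rewrite /dispersion corr1 -/nu.
  have -> : \sum_(p <- l) \sum_(q <- l) p.1 * q.1 * corr e (q.2^-1 * p.2)%g (b t) (b t) =
      \sum_(p <- l) \sum_(q <- l) p.1 * q.1 * fh (a p.2 @` b t `&` a q.2 @` b t) x.
    apply: eq_bigr => p _; apply: eq_bigr => q _; congr (_ * _).
    by rewrite -corr_translates// -h2.
  by rewrite h1; lra.
apply/swe_suppP; split; apply: swc_of_supp => k phi; by rewrite sE.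
Qed.

End ergodic_component.

(** * Extreme points *)

Section classes.
Context (G : groupType) (R : realType) (d : measure_display).
Context (X : measurableType d) (mu : probability X R).

Lemma stable_class_eq (a b : mpaction G mu) : supp_eq a b ->
  stable_class a = stable_class b.
Proof.
move=> ab; apply/seteqP; split=> c; rewrite /stable_class/= => /swe_suppP h;
  by apply/swe_suppP => k phi; rewrite -h ab.
Qed.

Lemma supp_eq_stable_class (a b c : mpaction G mu) :
  stable_class a b -> supp_eq b c -> stable_class a = stable_class c.
Proof.
move=> /swe_suppP ab bc; apply: stable_class_eq => k phi; by rewrite ab bc.
Qed.

(** An ergodic action of the class of [t b + (1 - t) c] is below b and below c, by
    [ergodic_supp_le]; as its support function is the average of those of b
    and c, the three are equal. *)
Lemma extreme_of_ergodic (a : mpaction G mu) (d' : measure_display)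
    (Y : measurableType d') (nu : probability Y R) (e : mpaction G nu) :
  countable [set: G] -> ergodic e -> stable_weak_equiv a e ->
  extreme_point (stable_class a).
Proof.
move=> hG erge /swe_suppP ae; split; first by exists a.
move=> t y z /andP[t0 t1] [b' _ <-] [c' _ <-] xE.
have : stable_class a a by apply/swe_suppP.
rewrite {1}xE => -[b [c [c0 [b'b c'c tc0 /swe_suppP c0a]]]].
have tc := transport_supp_eq tc0.
have ec : supp_eq e (conv_action t b c).
  by move=> k phi; rewrite tc c0a ae.
have ewc : stable_weak_contained e (conv_action t b c) by case/swe_suppP : ec.
have leb k (phi : test G R k) : supp e phi <= supp b phi.
  exact: (@ergodic_supp_le _ _ _ _ _ _ _ _ _ ord0 _ _ _ hG erge _ ewc).
have lec k (phi : test G R k) : supp e phi <= supp c phi.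
  by apply: (@ergodic_supp_le _ _ _ _ _ _ _ _ _ ord_max _ _ _ hG erge _ ewc);
    rewrite /= /pair_weight/= subr_gt0.
have eE k (phi : test G R k) : supp b phi = supp a phi /\ supp c phi = supp a phi.
  have := ec k phi; rewrite supp_conv -ae; have := leb k phi; have := lec k phi.
  by rewrite -ae; move: t0 t1; move: (t%:num) => s; split; nra.
split.
  by apply: (supp_eq_stable_class b'b) => k phi; have [] := eE k phi.
by apply: (supp_eq_stable_class c'c) => k phi; have [] := eE k phi.
Qed.

(** The action is moved to the line, where conditional measures are available, by
    the code of the space; there the hypothesis of [ergodic_component] is
    [extreme_conditional]. *)
Lemma ergodic_of_extreme (a : mpaction G mu) :
  countable [set: G] -> standard_probability_space mu ->
  extreme_point (stable_class a) ->
  exists (nu : probability R R) (e : mpaction G nu),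
    ergodic e /\ stable_weak_equiv a e.
Proof.
move=> hG hX ext; have [phi [mphi _ code]] := nonatomic_code hX.1 hX.2.
have [m mP] := image_probability mu mphi.
have [psi iso] := point_realization hX.1 mP code.
have iXm : isomorphic mu m by exists phi, psi.
have hm : standard_probability_space m.
  by split; [exact: standard_borel_real|exact: nonatomic_iso iXm hX.2].
have [||a' a'a] := @transported_action _ _ _ _ _ m _ mu a => //.
  by exists psi, phi; exact: iso_mod0_sym.
have aa' := transport_sym a'a.
have [fh fhP] := conditional_on_invariant_exists a' hG.
have [C mC iC C0|nu [e [erge ea']]] := ergodic_component hG fhP.
  have [mC' mCE] := conditional_probability mC C0.
  have [aC aCE] := conditional_action mC C0 iC mCE.
  exists mC', aC; split => //.
  exact: (extreme_conditional hG hX hm ext aa' mC C0 iC mCE aCE).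
exists nu, e; split=> //; apply/swe_suppP => k psi'.
by rewrite ea'; exact: transport_supp_eq.
Qed.

End classes.

Theorem proposition7p3 (R : realType)
    (G : groupType) (hG : countable [set: G]%classic)
    (d : measure_display) (X : measurableType d) (mu : probability X R)
    (hX : standard_probability_space mu) (a : mpaction G mu) :
  extreme_point (stable_class a) <->
  exists (d' : measure_display) (Y : measurableType d')
         (nu : probability Y R) (e : mpaction G nu),
    [/\ standard_borel R Y, ergodic e & stable_weak_equiv a e].
Proof.
split=> [/(ergodic_of_extreme hG hX)[nu [e [erge ae]]]|[d' [Y [nu [e [_ erge ae]]]]]].
  by exists _, R, nu, e; split=> //; exact: standard_borel_real.
exact: extreme_of_ergodic ae.
Qed.
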